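(* Let $T$ be an arbitrary countable theory. Suppose $E$ is a strong type defined on $p(\mathfrak C)$ for some $p\in S(\emptyset)$ in countably many variables, and $E$ is refined by $\equiv_{KP}$ (i.e. $\equiv_{KP}$ restricted to $p(\mathfrak C)$ is contained in $E$). Fix any $a\models p$. Consider the orbit map $r_{[a]_E}\colon\mathrm{Gal}_{KP}(T)\to p(\mathfrak C)/E$ given by $\sigma\,\mathrm{Autf}_{KP}(\mathfrak C)\mapsto[\sigma(a)]_E$, and put $H=\ker r_{[a]_E}:=r_{[a]_E}^{-1}[\{[a]_E\}]$. Then: (1) $H\leq\mathrm{Gal}_{KP}(T)$ and the fibers of $r_{[a]_E}$ are the left cosets of $H$; (2) $r_{[a]_E}$ is a topological quotient mapping, and so $p(\mathfrak C)/E$ is homeomorphic to $\mathrm{Gal}_{KP}(T)/H$; (3) $E$ is type-definable [resp. Borel, or analytic, or $F_\sigma$, or relatively definable on $p(\mathfrak C)\times p(\mathfrak C)$] if and only if $H$ is closed [resp. Borel, or analytic, or $F_\sigma$, or clopen]; (4) $E_H\sim_B E$, where $E_H$ is the relation on $\mathrm{Gal}_{KP}(T)$ of lying in the same left coset of $H$.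
   Context: $T$ is a complete first-order theory with monster model $\mathfrak C$ ($\kappa$-saturated and strongly $\kappa$-homogeneous for a strong limit cardinal $\kappa$ larger than $|T|$ and all objects of interest); small means of size $<\kappa$; all models are small elementary submodels of $\mathfrak C$. Invariant means $\mathrm{Aut}(\mathfrak C)$-invariant. A strong type on an invariant set $X$ is an invariant equivalence relation on $X$ with a small number of classes, finer than the relation of having the same type over $\emptyset$. $\mathrm{Autf}_L(\mathfrak C)$ is the subgroup of $\mathrm{Aut}(\mathfrak C)$ generated by all $\mathrm{Aut}(\mathfrak C/M)$, $M\preceq\mathfrak C$; $\mathrm{Gal}(T)=\mathrm{Aut}(\mathfrak C)/\mathrm{Autf}_L(\mathfrak C)$. For a model $M$ enumerated by $m$, let $S_m(M)$ be the space of types over $M$ extending $\mathrm{tp}(m/\emptyset)$; $\mathrm{tp}(\sigma(m)/M)\mapsto\sigma\,\mathrm{Autf}_L(\mathfrak C)$ is a well-defined surjection $S_m(M)\to\mathrm{Gal}(T)$, and $\mathrm{Gal}(T)$ carries the resulting quotient topology (independent of $M$), making it a compact, possibly non-Hausdorff, topological group. $\mathrm{Autf}_{KP}(\mathfrak C)$ is the group of automorphisms fixing setwise all classes of all bounded, $\emptyset$-type-definable equivalence relations; $\equiv_{KP}$ is its orbit equivalence relation; $\mathrm{Gal}_{KP}(T)=\mathrm{Aut}(\mathfrak C)/\mathrm{Autf}_{KP}(\mathfrak C)$, which is the quotient of $\mathrm{Gal}(T)$ by the closure of its identity and has the quotient topology (for countable $T$ it is a compact Polish group). It acts on $p(\mathfrak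 C)/E$ by $\sigma\,\mathrm{Autf}_{KP}(\mathfrak C)\cdot[b]_E=[\sigma(b)]_E$. A topological quotient map is a surjection for which a set is closed iff its preimage is. The logic topology on $p(\mathfrak C)/E$: a set is closed iff its preimage in $p(\mathfrak C)$ is type-definable. $E$ is Borel [analytic, $F_\sigma$] if $\{\mathrm{tp}(bc/\emptyset):b\mathrel E c\}$ is such in $S(\emptyset)$; it is relatively definable on $p(\mathfrak C)\times p(\mathfrak C)$ if it is the intersection of that set with a definable set. For equivalence relations $E_1,E_2$ on Polish spaces, $E_1\leq_B E_2$ means that there is a Borel map $f$ with $x\mathrel{E_1}y\iff f(x)\mathrel{E_2}f(y)$; $E_1\sim_B E_2$ means $E_1\leq_B E_2\leq_B E_1$. In $\sim_B$, $E$ is interpreted as the relation $E^M$ on the space $S_a(M)$ of types over $M$ extending $p$, for any countable model $M$, where $q_1\mathrel{E^M}q_2$ iff $b\mathrel E c$ for some (equivalently, all) $b\models q_1$, $c\models q_2$ (its Borel cardinality is independent of $M$). *)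

(* Defs.v *)
From HB Require Import structures.
From mathcomp Require Import all_boot generic_quotient.
From mathcomp Require Export boolp classical_sets functions cardinality.
From mathcomp Require Import topology measurable_structure borel_hierarchy.

Set Implicit Arguments.
Unset Strict Implicit.
Unset Printing Implicit Defensive.

Local Open Scope classical_set_scope.
Local Open Scope card_scope.
Local Open Scope quotient_scope.

Record language : Type := Language {
  fsym : nat -> Type;
  rsym : nat -> Type }.

Definition countable_language (L : language) : Prop :=
  countable [set: {n & fsym L n}] /\ countable [set: {n & rsym L n}].

Inductive term (L : language) (V : Type) : Type :=
| Var of V
| App n of fsym L n & ('I_n -> term L V).

(* Formulas with free variables in V.  A quantifier binds the variable [None]
   of [option V].  The other connectives are classically definable. *)
Inductive formula (L : language) (V : Type) : Type :=
| Eq of term L V & term L V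
| Rel n of rsym L n & ('I_n -> term L V)
| Fal
| Imp of formula L V & formula L V
| All of formula L (option V).
Arguments Fal {L V}.

Definition Neg L V (phi : formula L V) : formula L V := Imp phi Fal.

HB.instance Definition _ L V := gen_eqMixin (formula L V).
HB.instance Definition _ L V := gen_choiceMixin (formula L V).
HB.instance Definition _ L V := isPointed.Build (formula L V) Fal.

Fixpoint term_in L V (P : V -> Prop) (t : term L V) : Prop :=
  match t with
  | Var v => P v
  | App n f ts => forall i, term_in P (ts i)
  end.

Fixpoint formula_in L V (P : V -> Prop) (phi : formula L V) : Prop :=
  match phi with
  | Eq t u => term_in P t /\ term_in P u
  | Rel n R ts => forall i, term_in P (ts i)
  | Fal => True
  | Imp phi psi => formula_in P phi /\ formula_in P psi
  | All phi => formula_in (fun o => if o is Some v then P v else True) phi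
  end.

Record structure (L : language) : Type := Structure {
  carrier :> Type;
  finterp : forall n, fsym L n -> ('I_n -> carrier) -> carrier;
  rinterp : forall n, rsym L n -> ('I_n -> carrier) -> Prop;
  carrier_inhabited : inhabited carrier }.

Fixpoint eval L (C : structure L) V (e : V -> C) (t : term L V) : C :=
  match t with
  | Var v => e v
  | App n f ts => finterp f (fun i => eval e (ts i))
  end.

Fixpoint sat L (C : structure L) V (e : V -> C) (phi : formula L V) : Prop :=
  match phi with
  | Eq t u => eval e t = eval e u
  | Rel n R ts => rinterp R (fun i => eval e (ts i))
  | Fal => False
  | Imp phi psi => sat e phi -> sat e psi
  | All phi => forall x : C, sat (fun o => oapp e x o) phi
  end.

Definition sentence (L : language) : Type := formula L void.
Definition theory (L : language) : Type := set (sentence L).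

Definition holds L (C : structure L) (phi : sentence L) : Prop :=
  sat (of_void C) phi.
Definition models L (T : theory L) (C : structure L) : Prop :=
  forall phi, T phi -> holds C phi.
Definition entails L (T : theory L) (phi : sentence L) : Prop :=
  forall C, models T C -> holds C phi.

Definition complete_theory L (T : theory L) : Prop :=
  (exists C, models T C) /\
  forall phi, entails T phi \/ entails T (Neg phi).

(* M is the universe of an elementary substructure of C: it is the image of
   an elementary embedding (formulas with variables in N, evaluated at the
   identity, are the sentences with parameters in N). *)
Definition elementary_submodel L (C : structure L) (M : set C) : Prop :=
  exists (N : structure L) (j : N -> C),
    (forall phi : formula L N, sat id phi <-> sat j phi) /\ range j = M.

Section Types.
Context {L : language} (C : structure L).

(* Formulas with variables in I and parameters from C are formulas over I + C,
   evaluated with each parameter naming itself. *)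
Definition env I (b : I -> C) (v : I + C) : C :=
  match v with inl i => b i | inr c => c end.

Definition formulas_over I (A : set C) : set (formula L (I + C)) :=
  [set phi | formula_in (fun v => if v is inr c then A c else True) phi].

Definition realizations I (q : set (formula L (I + C))) : set (I -> C) :=
  [set b | forall phi, q phi -> sat (env b) phi].

Definition finitely_satisfiable I (q : set (formula L (I + C))) : Prop :=
  forall s, finite_set s -> s `<=` q -> realizations s !=set0.

Definition tp I (A : set C) (b : I -> C) : set (formula L (I + C)) :=
  [set phi | formulas_over A phi /\ sat (env b) phi].

(* S_I(A), the complete types over A in variables indexed by I. *)
Record ctype (I : Type) (A : set C) : Type := CType {
  ctype_set :> set (formula L (I + C));
  _ : ctype_set `<=` formulas_over A;
  _ : finitely_satisfiable ctype_set;
  _ : forall phi, formulas_over A phi -> ctype_set phi \/ ctype_set (Neg phi) }.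

HB.instance Definition _ I A := gen_eqMixin (ctype I A).
HB.instance Definition _ I A := gen_choiceMixin (ctype I A).
HB.instance Definition _ I A := @isSubBaseTopological.Build (ctype I A)
  (formula L (I + C)) setT (fun phi => [set q : ctype I A | ctype_set q phi]).

Definition types_extending I (A : set C) (q : set (formula L (I + C))) :
  set (ctype I A) := [set q' : ctype I A | q `<=` ctype_set q'].

Definition definable I (X : set (I -> C)) : Prop :=
  exists phi : formula L (I + C), X = [set b | sat (env b) phi].

Definition type_definable_over I (A : set C) (X : set (I -> C)) : Prop :=
  exists2 Phi : set (formula L (I + C)),
    Phi `<=` formulas_over A & X = realizations Phi.

(* A pair of I-tuples is a tuple indexed by I + I. *)
Definition graph I (E : (I -> C) -> (I -> C) -> Prop) : set (I + I -> C) :=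
  [set d : I + I -> C | E (d \o inl) (d \o inr)].

Definition equivalence_on U (X : set U) (E : U -> U -> Prop) : Prop :=
  [/\ forall x y, E x y -> X x /\ X y,
      forall x, X x -> E x x,
      forall x y, E x y -> E y x &
      forall x y z, E x y -> E y z -> E x z].

Definition eclass U (E : U -> U -> Prop) (x : U) : set U := [set y | E x y].

Definition classes U (X : set U) (E : U -> U -> Prop) : set (set U) :=
  [set eclass E x | x in X].

Definition is_automorphism (s : C -> C) : Prop :=
  [/\ bijective s,
      forall n (f : fsym L n) x, s (finterp f x) = finterp f (s \o x) &
      forall n (R : rsym L n) x, rinterp R (s \o x) <-> rinterp R x].

Record aut : Type := Aut {
  aut_fun :> C -> C;
  autP : is_automorphism aut_fun }.

HB.instance Definition _ := gen_eqMixin aut.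
HB.instance Definition _ := gen_choiceMixin aut.

Lemma aut_ext (s t : aut) : s =1 t -> s = t.
Proof.
case: s t => [s sP] [t tP] /= /funext st; case: _ / st tP => tP.
by congr Aut.
Qed.

Lemma aut_one_subproof : is_automorphism id.
Proof. by split=> //; exists id. Qed.

Lemma aut_mul_subproof (s t : aut) : is_automorphism (s \o t).
Proof.
case: (autP s) (autP t) => [sb sf sr] [tb tf tr]; split.
- exact: bij_comp.
- by move=> n f x /=; rewrite tf sf.
- by move=> n R x; rewrite -(tr n R x) -(sr n R (t \o x)).
Qed.

Lemma aut_inv_ex (s : aut) : exists t : aut, cancel s t /\ cancel t s.
Proof.
case: (autP s) => [[t st ts] sf sr].
have tP : is_automorphism t.
  split; first by exists s.
  - move=> n f x; apply: (can_inj st); rewrite ts sf; congr finterp.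
    by apply/funext => i /=; rewrite ts.
  - move=> n R x; rewrite -(sr n R (t \o x)).
    by rewrite (_ : s \o (t \o x) = x)//; apply/funext => i /=; rewrite ts.
by exists (Aut tP).
Qed.

Definition aut_one : aut := Aut aut_one_subproof.
Definition aut_mul (s t : aut) : aut := Aut (aut_mul_subproof s t).
Definition aut_inv (s : aut) : aut := projT1 (cid (aut_inv_ex s)).

Lemma aut_mulA : associative aut_mul.
Proof. by move=> s t u; exact: aut_ext. Qed.
Lemma aut_mul1 : left_id aut_one aut_mul.
Proof. by move=> s; exact: aut_ext. Qed.
Lemma aut_mulr1 : right_id aut_one aut_mul.
Proof. by move=> s; exact: aut_ext. Qed.
Lemma aut_mulV : left_inverse aut_one aut_inv aut_mul.
Proof.
by move=> s; apply: aut_ext => x; have [+ _] := projT2 (cid (aut_inv_ex s)); apply.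
Qed.
Lemma aut_mulrV : right_inverse aut_one aut_inv aut_mul.
Proof.
by move=> s; apply: aut_ext => x; have [_ +] := projT2 (cid (aut_inv_ex s)); apply.
Qed.

HB.instance Definition _ :=
  isGroup.Build aut aut_mulA aut_mul1 aut_mulr1 aut_mulV aut_mulrV.

End Types.
Arguments types_extending {L C I} A q.

Section Cosets.
Context {G : groupType}.
Local Open Scope group_scope.

Definition lcoset (H : set G) (g : G) : set G := [set g * h | h in H].
Definition lcosets (H : set G) : set (set G) := range (lcoset H).
Definition same_lcoset (H : set G) (x y : G) : Prop :=
  exists X, [/\ lcosets H X, X x & X y].

Record subgroup : Type := Subgroup {
  subgroup_set :> set G;
  subgroup_closed : group_closed [in subgroup_set] }.

Record normal_subgroup : Type := NormalSubgroup {
  normal_subgroup_group :> subgroup;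
  normal_subgroupJ :
    forall x y, subgroup_set normal_subgroup_group x ->
      subgroup_set normal_subgroup_group (x ^ y) }.

Lemma subgroup1 (H : subgroup) : subgroup_set H 1.
Proof. by have [/set_mem] := subgroup_closed H. Qed.

Lemma subgroupV (H : subgroup) x : subgroup_set H x -> subgroup_set H x^-1.
Proof.
by move=> Hx; apply/set_mem/(group_closedV (subgroup_closed H))/mem_set.
Qed.

Lemma subgroupM (H : subgroup) x y :
  subgroup_set H x -> subgroup_set H y -> subgroup_set H (x * y).
Proof.
by move=> Hx Hy; apply/set_mem/(group_closedM (subgroup_closed H)); exact/mem_set.
Qed.

Definition lcoset_rel (H : subgroup) (x y : G) : bool :=
  `[< subgroup_set H (x^-1 * y) >].

Lemma lcoset_rel_refl H : reflexive (lcoset_rel H).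
Proof. by move=> x; apply/asboolP; rewrite mulVg; exact: subgroup1. Qed.

Lemma lcoset_rel_sym H : symmetric (lcoset_rel H).
Proof.
by move=> x y; apply/asboolP/asboolP => /subgroupV; rewrite invgM invgK.
Qed.

Lemma lcoset_rel_trans H : transitive (lcoset_rel H).
Proof.
move=> y x z /asboolP xy /asboolP yz; apply/asboolP.
by have := subgroupM xy yz; rewrite -mulgA mulVKg.
Qed.

Canonical lcoset_equiv (H : subgroup) : equiv_rel G :=
  EquivRel (lcoset_rel H)
    (@lcoset_rel_refl H) (@lcoset_rel_sym H) (@lcoset_rel_trans H).

Definition coset_space (H : subgroup) : Type := {eq_quot lcoset_equiv H}.
HB.instance Definition _ H := Choice.on (coset_space H).

Definition coset_of (H : subgroup) (g : G) : coset_space H :=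
  \pi_({eq_quot lcoset_equiv H}) g.

Definition coset_repr (H : subgroup) (x : coset_space H) : G :=
  repr (x : {eq_quot lcoset_equiv H}).

Lemma coset_reprK H : cancel (@coset_repr H) (@coset_of H).
Proof. exact: reprK. Qed.

Lemma coset_eqP (H : subgroup) (x y : G) :
  coset_of H x = coset_of H y <-> subgroup_set H (x^-1 * y).
Proof.
split; first by move=> /eqquotP /asboolP.
by move=> /asboolP xy; apply/eqquotP.
Qed.

Definition quotient_group (N : normal_subgroup) : Type := coset_space N.
HB.instance Definition _ N := Choice.on (quotient_group N).

Section QuotientGroup.
Variable N : normal_subgroup.

Definition quotient_one : quotient_group N := coset_of N 1.
Definition quotient_mul (x y : quotient_group N) : quotient_group N :=
  coset_of N (coset_repr x * coset_repr y).
Definition quotient_inv (x : quotient_group N) : quotient_group N :=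
  coset_of N (coset_repr x)^-1.

Lemma coset_ofM x y :
  quotient_mul (coset_of N x) (coset_of N y) = coset_of N (x * y).
Proof.
apply/coset_eqP.
have /coset_eqP := coset_reprK (coset_of N x).
have /coset_eqP := coset_reprK (coset_of N y).
move: (coset_repr _) (coset_repr _) => v u vy ux.
have := subgroupM vy (normal_subgroupJ y ux).
by rewrite conjgE invgM !mulgA mulgK.
Qed.

Lemma coset_ofV x : quotient_inv (coset_of N x) = coset_of N x^-1.
Proof.
apply/coset_eqP; rewrite invgK.
have /coset_eqP := coset_reprK (coset_of N x).
move: (coset_repr _) => u ux.
have := normal_subgroupJ x^-1 (subgroupV ux).
by rewrite conjgE invgM !invgK !mulgA mulgV mul1g.
Qed.

Lemma quotient_mulA : associative quotient_mul.
Proof.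
move=> x y z; rewrite -(coset_reprK x) -(coset_reprK y) -(coset_reprK z).
by rewrite !coset_ofM mulgA.
Qed.
Lemma quotient_mul1 : left_id quotient_one quotient_mul.
Proof. by move=> x; rewrite -(coset_reprK x) coset_ofM mul1g. Qed.
Lemma quotient_mulr1 : right_id quotient_one quotient_mul.
Proof. by move=> x; rewrite -(coset_reprK x) coset_ofM mulg1. Qed.
Lemma quotient_mulV : left_inverse quotient_one quotient_inv quotient_mul.
Proof. by move=> x; rewrite -(coset_reprK x) coset_ofV coset_ofM mulVg. Qed.
Lemma quotient_mulrV : right_inverse quotient_one quotient_inv quotient_mul.
Proof. by move=> x; rewrite -(coset_reprK x) coset_ofV coset_ofM mulgV. Qed.

HB.instance Definition _ := isGroup.Build (quotient_group N)
  quotient_mulA quotient_mul1 quotient_mulr1 quotient_mulV quotient_mulrV.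

End QuotientGroup.
End Cosets.
Arguments subgroup : clear implicits.
Arguments normal_subgroup : clear implicits.

(* The finest topology on Y for which f is continuous: a set is open (closed)
   iff its preimage under f is. *)
Definition final_topology (X : topologicalType) (Y : Type) (f : X -> Y) : Type :=
  Y.

Section FinalTopology.
Context {X : topologicalType}.

Section Topology.
Variables (Y : choiceType) (f : X -> Y).

HB.instance Definition _ := Choice.copy (final_topology f) Y.

Definition final_open (U : set (final_topology f)) : Prop := open (f @^-1` U).

Lemma final_openT : final_open setT.
Proof. exact: openT. Qed.
Lemma final_openI : setI_closed final_open.
Proof. by move=> U V oU oV; exact: openI. Qed.
Lemma final_open_bigcup (J : Type) (U : J -> set (final_topology f)) :
  (forall j, final_open (U j)) -> final_open (\bigcup_j U j).
Proof. by move=> oU; apply: bigcup_open => j _; exact: oU. Qed.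

HB.instance Definition _ := isOpenTopological.Build (final_topology f)
  final_openT final_openI final_open_bigcup.

End Topology.

HB.instance Definition _ (Y : groupType) (f : X -> Y) :=
  Group.copy (final_topology f) Y.

End FinalTopology.

(* f maps X onto Y, and a subset of Y is closed iff its preimage is; the
   topologies of X and Y are given by their closed sets. *)
Definition topological_quotient_map U V (X : set U) (closedX : set (set U))
    (Y : set V) (closedY : set (set V)) (f : U -> V) : Prop :=
  [/\ set_fun X Y f, set_surj X Y f &
      forall F, F `<=` Y -> (closedY F <-> closedX (X `&` f @^-1` F))].

Definition homeomorphism U V (X : set U) (closedX : set (set U))
    (Y : set V) (closedY : set (set V)) (f : U -> V) : Prop :=
  set_bij X Y f /\
  forall F, F `<=` Y -> (closedY F <-> closedX (X `&` f @^-1` F)).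

Definition borel (X : topologicalType) : set (set X) := <<s @open X >>.

Definition baire_space : topologicalType := {ptws nat -> nat}.

(* Continuous images of the Baire space, and the empty set. *)
Definition analytic (X : topologicalType) (A : set X) : Prop :=
  A = set0 \/ exists2 f : baire_space -> X, continuous f & range f = A.

Definition borel_reducible (X Y : topologicalType)
    (E : X -> X -> Prop) (F : Y -> Y -> Prop) : Prop :=
  exists2 f : X -> Y, (forall B, borel B -> borel (f @^-1` B)) &
    forall x y, E x y <-> F (f x) (f y).

Definition borel_equivalent (X Y : topologicalType)
    (E : X -> X -> Prop) (F : Y -> Y -> Prop) : Prop :=
  borel_reducible E F /\ borel_reducible F E.

Section Monster.
(* The cardinal kappa is that of the type K. *)
Context (K : Type) {L : language}.

Definition small U (A : set U) : Prop :=
  A #<= [set: K] /\ ~ ([set: K] #<= A).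

Definition strong_limit : Prop :=
  forall U : Type, small [set: U] -> small [set: set U].

Definition saturated (C : structure L) : Prop :=
  forall (A : set C) (q : set (formula L (unit + C))),
    small A -> q `<=` formulas_over A -> finitely_satisfiable q ->
    realizations q !=set0.

(* Every elementary map from a small subset of C into C extends to an
   automorphism. *)
Definition strongly_homogeneous (C : structure L) : Prop :=
  forall (A : set C) (f : C -> C), small A ->
    (forall phi : formula L C, formula_in A phi -> (sat id phi <-> sat f phi)) ->
    exists s : aut C, forall x, A x -> s x = f x.

(* The cardinality of T is that of the set of formulas in countably many
   variables. *)
Definition monster_model (T : theory L) (C : structure L) : Prop :=
  [/\ strong_limit, small [set: formula L nat], models T C,
      saturated C & strongly_homogeneous C].

Context {C : structure L}.

Definition small_model (M : set C) : Prop := elementary_submodel M /\ small M.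

Definition type_definable I (X : set (I -> C)) : Prop :=
  exists2 A : set C, small A & type_definable_over A X.

Definition bounded_equivalence I (X : set (I -> C))
    (E : (I -> C) -> (I -> C) -> Prop) : Prop :=
  equivalence_on X E /\ small (classes X E).

Definition strong_type I (X : set (I -> C))
    (E : (I -> C) -> (I -> C) -> Prop) : Prop :=
  [/\ bounded_equivalence X E,
      forall (s : aut C) b c, E b c -> E (s \o b) (s \o c) &
      forall b c, E b c -> tp set0 b = tp set0 c].

Definition aut_fixing (M : set C) : set (aut C) :=
  [set s : aut C | forall x, M x -> s x = x].

Definition autfL_set : set (aut C) :=
  smallest [set H : set (aut C) | group_closed [in H]]
    (\bigcup_(M in small_model) aut_fixing M).

(* Automorphisms fixing setwise every class of every bounded equivalence
   relation that is type-definable over the empty set, on any set of tuples of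
   any small length. *)
Definition autfKP_set : set (aut C) :=
  [set s : aut C | forall (J : Type) X E,
     small [set: J] -> bounded_equivalence X E ->
     type_definable_over set0 (graph E) ->
     forall c : set (J -> C), classes X E c -> [set s \o b | b in c] = c].

Local Open Scope group_scope.

Lemma autfL_closed : group_closed [in autfL_set].
Proof.
split=> [|s t /set_mem sL /set_mem tL]; apply/mem_set.
  by move=> H /= [[/set_mem]].
move=> H /= HL; have [[_ HF] _] := HL.
by apply/set_mem/HF; apply/mem_set; [exact: sL|exact: tL].
Qed.

Lemma autfKP_closed : group_closed [in autfKP_set].
Proof.
split=> [|s t /set_mem sKP /set_mem tKP]; apply/mem_set.
  move=> J X E _ _ _ c _; apply/seteqP; split=> [_ [b cb <-]|b cb].
    by rewrite (_ : _ \o b = b).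
  by exists b.
move=> J X E sJ bE dE c Ec.
have sc := sKP J X E sJ bE dE c Ec.
have tc := tKP J X E sJ bE dE c Ec.
apply/seteqP; split=> [_ [b cb <-]|b].
  rewrite -sc; rewrite -{1}tc in cb; case: cb => b' cb' <-.
  exists b' => //; apply/funext => j /=.
  have /(congr1 (fun u : aut C => u (b' j))) : t^-1 * t = 1 by rewrite mulVg.
  by move=> /= ->.
rewrite -{1}sc => -[b' cb' <-].
exists (t \o b'); first by rewrite -tc; exists b'.
apply/funext => j /=.
have /(congr1 (fun u : aut C => u (b' j))) : t^-1 * t = 1 by rewrite mulVg.
by move=> /= ->.
Qed.

Definition autfL : subgroup (aut C) := Subgroup autfL_closed.
Definition autfKP_subgroup : subgroup (aut C) := Subgroup autfKP_closed.

Lemma eval_aut (s : aut C) V (e : V -> C) (t : term L V) :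
  eval (s \o e) t = s (eval e t).
Proof.
elim: t => [//|n f ts IH] /=; have [_ -> _] := autP s.
by congr finterp; apply/funext => i; exact: IH.
Qed.

Lemma sat_aut (s : aut C) V (e : V -> C) (phi : formula L V) :
  sat (s \o e) phi <-> sat e phi.
Proof.
have [[g sg gs] _ sr] := autP s.
elim: phi e => {V} [V t u|V n R ts|V|V phi IH psi IH'|V phi IH] e /=.
- by rewrite !eval_aut; split=> [/(can_inj sg)|->].
- have -> : (fun i => eval (s \o e) (ts i)) = s \o (fun i => eval e (ts i)).
    by apply/funext => i; rewrite eval_aut.
  exact: sr.
- by [].
- by rewrite IH IH'.
- have sE x : (fun o => oapp (s \o e) (s x) o) = s \o (fun o => oapp e x o).
    by apply/funext => -[v|].
  split=> H x; first by apply/IH; rewrite -sE.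
  by rewrite -(gs x) sE; apply/IH.
Qed.

Lemma eval_in V (P : V -> Prop) (e e' : V -> C) (t : term L V) :
  (forall v, P v -> e v = e' v) -> term_in P t -> eval e t = eval e' t.
Proof.
move=> ee'; elim: t => [v /ee' //|n f ts IH] /= tsP.
by congr finterp; apply/funext => i; exact: IH.
Qed.

Lemma sat_in V (P : V -> Prop) (e e' : V -> C) (phi : formula L V) :
  (forall v, P v -> e v = e' v) -> formula_in P phi ->
  sat e phi <-> sat e' phi.
Proof.
elim: phi P e e' => {V} [V t u|V n R ts|V|V phi IH psi IH'|V phi IH] P e e' ee' /=.
- by move=> [tP uP]; rewrite (eval_in ee' tP) (eval_in ee' uP).
- move=> tsP; rewrite (_ : (fun i => _) = (fun i => eval e' (ts i)))//.
  by apply/funext => i; exact: eval_in (tsP i).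
- by [].
- by move=> [phiP psiP]; rewrite (IH _ _ _ ee' phiP) (IH' _ _ _ ee' psiP).
- move=> phiP.
  have H x : sat (fun o => oapp e x o) phi <-> sat (fun o => oapp e' x o) phi.
    by apply: IH phiP => -[v /ee'|].
  by split=> Hs x; apply/H.
Qed.

Lemma type_definable_aut I (X : set (I -> C)) (s : aut C) b :
  type_definable_over set0 X -> X b -> X (s \o b).
Proof.
move=> [Phi Phi0 ->] /= + phi phiP => /(_ phi phiP).
rewrite -(sat_aut s) => /(@sat_in _ _ _ _ _); apply; last exact: Phi0.
by case.
Qed.

Lemma classes_aut I (X : set (I -> C)) E (s : aut C) c :
  equivalence_on X E -> type_definable_over set0 (graph E) ->
  classes X E c -> classes X E [set s \o b | b in c].
Proof.
move=> [EX Er Es Et] dE [x Xx <-].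
have Eaut (u : aut C) b b' : E b b' -> E (u \o b) (u \o b').
  move=> Ebb'; pose d (v : I + I) := match v with inl i => b i | inr i => b' i end.
  exact: (type_definable_aut u dE (Ebb' : graph E d)).
exists (s \o x); first by have [] := EX _ _ (Eaut s _ _ (Er _ Xx)).
have VK (u : aut C) (b : I -> C) : (u^-1)%g \o (u \o b) = b.
  apply/funext => i /=.
  by have /(congr1 (fun w : aut C => w (b i))) : u^-1 * u = 1 by rewrite mulVg.
apply/seteqP; split=> [y /= sxy|_ [y xy <-]]; last exact: Eaut.
exists ((s^-1)%g \o y); first by rewrite /eclass/= -(VK s x); exact: Eaut.
by have := VK (s^-1)%g y; rewrite invgK.
Qed.

Lemma autfKP_normal x y :
  subgroup_set autfKP_subgroup x -> subgroup_set autfKP_subgroup (x ^ y).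
Proof.
move=> xKP J X E sJ bE dE c Ec.
have Eyc := classes_aut y bE.1 dE Ec.
have xc : [set x \o b | b in [set y \o b | b in c]] = [set y \o b | b in c].
  exact: xKP sJ bE dE _ Eyc.
have VK (b : J -> C) : (y^-1)%g \o (y \o b) = b.
  apply/funext => i /=.
  by have /(congr1 (fun w : aut C => w (b i))) : y^-1 * y = 1 by rewrite mulVg.
apply/seteqP; split=> [_ [b cb <-]|b cb].
  have : [set y \o b | b in c] (x \o (y \o b)).
    by rewrite -xc; exists (y \o b) => //; exists b.
  move=> [b' cb' yb']; suff -> : x ^ y \o b = b' by [].
  by rewrite -[RHS]VK yb'.
have : [set y \o b | b in c] (y \o b) by exists b.
rewrite -xc => -[_ [b' cb' <-] xyb'].
by exists b' => //; rewrite -[RHS]VK -xyb'.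
Qed.

Definition autfKP : normal_subgroup (aut C) := NormalSubgroup autfKP_normal.

(* M is enumerated by itself, through the inclusion map. *)
Definition enum_type (M : set C) : set (formula L (set_type M + C)) :=
  tp set0 (set_val : M -> C).
Arguments enum_type M : clear implicits.

(* tp(s(m)/M) |-> s Autf_L on S_m(M).  For a monster model C and a small model
   M such an s exists and its coset does not depend on the choice. *)
Definition gal_map (M : set C)
    (q : types_extending M (enum_type M)) : coset_space autfL :=
  coset_of autfL
    (xget 1 [set s : aut C | ctype_set (\val q) = tp M (s \o set_val)]).

(* Gal(T) with the quotient topology from S_m(M), which is in fact independent
   of M. *)
Definition gal (M : set C) : Type := final_topology (@gal_map M).
HB.instance Definition _ M := Topological.on (gal M).

(* s Autf_L |-> s Autf_KP, which is well defined as Autf_L is contained in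
   Autf_KP. *)
Definition gal_to_galKP (M : set C) (x : gal M) : quotient_group autfKP :=
  coset_of autfKP (coset_repr (x : coset_space autfL)).

Definition galKP (M : set C) : Type := final_topology (@gal_to_galKP M).
HB.instance Definition _ M := Topological.on (galKP M).
HB.instance Definition _ M := Group.on (galKP M).

Definition to_galKP (M : set C) (s : aut C) : galKP M := coset_of autfKP s.

Definition equiv_KP I (b c : I -> C) : Prop :=
  exists2 s : aut C, autfKP_set s & c = s \o b.

Definition logic_closed I (X : set (I -> C)) E (F : set (set (I -> C))) : Prop :=
  type_definable [set b | X b /\ F (eclass E b)].

Definition relatively_definable I (X : set (I -> C))
    (E : (I -> C) -> (I -> C) -> Prop) : Prop :=
  exists2 D : set (I + I -> C), definable D &
    graph E = graph (fun b c => X b /\ X c) `&` D.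

Definition pair_types I (E : (I -> C) -> (I -> C) -> Prop) :
    set (ctype (I + I) (@set0 C)) :=
  [set q | exists2 d, graph E d & ctype_set q = tp set0 d].

Definition type_relation I (p : ctype I (@set0 C)) (N : set C)
    (E : (I -> C) -> (I -> C) -> Prop)
    (q1 q2 : types_extending N (ctype_set p)) : Prop :=
  exists b c, [/\ realizations (ctype_set (\val q1)) b,
                  realizations (ctype_set (\val q2)) c & E b c].

(* s Autf_KP |-> [s(a)]_E, computed at a representative of the coset; it is
   independent of the representative when E is refined by equiv_KP. *)
Definition orbit_map I (M : set C) (E : (I -> C) -> (I -> C) -> Prop)
    (a : I -> C) (g : galKP M) : set (I -> C) :=
  eclass E (coset_repr (g : coset_space autfKP) \o a).

Definition lcosets_closed (M : set C) (H : set (galKP M))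
    (F : set (set (galKP M))) : Prop :=
  closed [set g | F (lcoset H g)].

End Monster.

(* Main.v *)
(* Fix a small model N and a small tuple m whose entries include a model.  The
   types over N of the conjugates of m form a compact Hausdorff space S, and
   tp(s m / N) |-> s Autf_KP is a surjection pi from S onto Gal_KP(T).  A set F
   of cosets is closed iff {s m | s in F} is type-definable, whichever m is
   used, so the topology of Gal_KP(T) can be computed in any such S; and pi is a
   closed map, because the relation of coming from the same coset is
   type-definable over the empty set: it is the intersection of all bounded
   type-definable relations on the conjugates of m.  Together with
   tp(s m) |-> tp(s a) this gives the quotient map.

   For N countable, S is compact metrizable and zero-dimensional.  If m
   enumerates N and N contains a, then rho : tp(s m / N) |-> tp(s a, a) is
   continuous and the preimage of E under rho is the preimage of H under pi, so
   F_sigma and analytic sets are transferred by images and preimages, and Borel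
   sets by Borel sections of the closed maps pi and rho.  For an arbitrary
   countable N the tuple m = (N, a) is used, and Borel sections of pi and of
   tp(s m / N) |-> tp(s a / N) give the two Borel reductions. *)

Require Import Defs.
From mathcomp Require Import all_boot finmap.
From mathcomp Require Import boolp classical_sets functions cardinality.
From mathcomp Require Import topology measurable_structure borel_hierarchy.

Set Implicit Arguments.
Unset Strict Implicit.
Unset Printing Implicit Defensive.

Local Open Scope classical_set_scope.

(** * Renaming, support and quantification of formulas *)

Section Syntax.
Context {L : language}.

(** The entries of [m] must include a model because an automorphism fixing a model moves no tuple
    out of its class for a bounded relation that is type-definable over the empty set. So the
    stabilizer of [m] lies in Autf_KP, and [s m], even through its type over a model, determines the
    coset of [s]. [E] itself is in general only invariant and cannot be approximated by formulas. It
    is therefore handled through automorphisms alone: its class at [a] determines it, and refinement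
    by [equiv_KP] lets it factor through cosets, so that compactness is applied only to sets
    attached to Autf_KP. Independence of all choices of models, tuples and parameters rests on one
    principle: a set that is type-definable over some small set and invariant under the
    automorphisms fixing [N] is type-definable over [N]. For Borel sets the obstacle is that
    continuous images need not be Borel. Compactness and a countable clopen base allow a canonical
    choice in each fiber, made by countably many Borel decisions. *)

Fixpoint rename_term V W (f : V -> W) (t : term L V) : term L W :=
  match t with
  | Var v => Var L (f v)
  | App n g ts => App g (fun i => rename_term f (ts i))
  end.

Fixpoint rename V W (f : V -> W) (phi : formula L V) : formula L W :=
  match phi with
  | Eq t u => Eq (rename_term f t) (rename_term f u)
  | Rel n R ts => Rel R (fun i => rename_term f (ts i))
  | Fal => Fal
  | Imp phi psi => Imp (rename f phi) (rename f psi)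
  | All phi => All (rename (omap f) phi)
  end.

Lemma eval_rename (C : structure L) V W (f : V -> W) (e : W -> C) t :
  Defs.eval e (rename_term f t) = Defs.eval (e \o f) t.
Proof.
by elim: t => [//|n g ts IH] /=; congr finterp; apply/funext => i; rewrite IH.
Qed.

Lemma sat_rename (C : structure L) V W (f : V -> W) (e : W -> C) phi :
  sat e (rename f phi) <-> sat (e \o f) phi.
Proof.
elim: phi W f e => {V} [V t u|V n R ts|V|V phi IH psi IH'|V phi IH] W f e /=.
- by rewrite !eval_rename.
- rewrite (_ : (fun i => _) = fun i => Defs.eval (e \o f) (ts i))//.
  by apply/funext => i; rewrite eval_rename.
- by [].
- by rewrite IH IH'.
- split=> H x; [move/IH: (H x)|apply/IH; move: (H x)];
    by rewrite (_ : _ \o _ = fun o => oapp (e \o f) x o)//; apply/funext => -[].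
Qed.

Lemma term_in_sub V (P Q : V -> Prop) (t : term L V) :
  (forall v, P v -> Q v) -> term_in P t -> term_in Q t.
Proof. by move=> PQ; elim: t => [v /PQ|n f ts IH /= tP i]; [|exact: IH]. Qed.

Lemma formula_in_sub V (P Q : V -> Prop) (phi : formula L V) :
  (forall v, P v -> Q v) -> formula_in P phi -> formula_in Q phi.
Proof.
elim: phi P Q => {V} [V t u|V n R ts|V|V phi IH psi IH'|V phi IH] P Q PQ //=.
- by move=> [tP uP]; split; exact: term_in_sub PQ _.
- by move=> tP i; exact: term_in_sub PQ _.
- by move=> [pP qP]; split; [exact: IH PQ pP|exact: IH' PQ qP].
- by apply: IH => -[v|//]; exact: PQ.
Qed.

Lemma term_in_rename V W (f : V -> W) (P : W -> Prop) (t : term L V) :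
  term_in P (rename_term f t) <-> term_in (P \o f) t.
Proof.
by elim: t => [//|n g ts IH] /=; split=> H i; apply/IH.
Qed.

Lemma formula_in_rename V W (f : V -> W) (P : W -> Prop) (phi : formula L V) :
  formula_in P (rename f phi) <-> formula_in (P \o f) phi.
Proof.
elim: phi W f P => {V} [V t u|V n R ts|V|V phi IH psi IH'|V phi IH] W f P //=.
- by rewrite !term_in_rename.
- by split=> H i; move/term_in_rename: (H i).
- by rewrite IH IH'.
- rewrite IH; split; apply: formula_in_sub => -[]//.
Qed.

Lemma term_support V (t : term L V) :
  exists2 P : set V, finite_set P & term_in P t.
Proof.
elim: t => [v|n f ts IH]; first by exists [set v].
have /choice[P PP] : forall i, exists P : set V, finite_set P /\ term_in P (ts i).
  by move=> i; have [P ? ?] := IH i; exists P.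
exists (\bigcup_(i in setT) P i).
  by apply: bigcup_finite => [|i _]; [exact: finite_finset|case: (PP i)].
by move=> i; apply: term_in_sub (PP i).2 => v Pv; exists i.
Qed.

Lemma formula_support V (phi : formula L V) :
  exists2 P : set V, finite_set P & formula_in P phi.
Proof.
elim: phi => {V} [V t u|V n R ts|V|V phi [P fP PP] psi [Q fQ QQ]|V phi [P fP PP]].
- have [P fP PP] := term_support t; have [Q fQ QQ] := term_support u.
  exists (P `|` Q); first by rewrite finite_setU.
  by split; [apply: term_in_sub PP|apply: term_in_sub QQ] => v ?; [left|right].
- have /choice[P PP] : forall i, exists P : set V, finite_set P /\ term_in P (ts i).
    by move=> i; have [P ? ?] := term_support (ts i); exists P.
  exists (\bigcup_(i in setT) P i).
    by apply: bigcup_finite => [|i _]; [exact: finite_finset|case: (PP i)].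
  by move=> i; apply: term_in_sub (PP i).2 => v Pv; exists i.
- by exists set0.
- exists (P `|` Q); first by rewrite finite_setU.
  by split; [apply: formula_in_sub PP|apply: formula_in_sub QQ] => v ?; [left|right].
- exists (Some @^-1` P); last by apply: formula_in_sub PP => -[].
  by apply: finite_preimage => // x y _ _ [].
Qed.

Definition And V (phi psi : formula L V) := Neg (Imp phi (Neg psi)).
Definition Conj V (l : seq (formula L V)) := foldr (@And V) (Neg Fal) l.

Section Connectives.
Context {C : structure L} {V : Type}.
Implicit Types (e : V -> C) (phi psi : formula L V) (l : seq (formula L V)).

Lemma sat_And e phi psi : sat e (And phi psi) <-> sat e phi /\ sat e psi.
Proof.
split=> /= [H|[? ?] H]; last by exact: H.
by split; apply: contrapT => nH; apply: H => // ? ?.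
Qed.

Lemma sat_Conj e l : sat e (Conj l) <-> forall phi, phi \in l -> sat e phi.
Proof.
elim: l => [|phi l IH]; first by split=> [_ phi|_ []].
rewrite -[Conj _]/(And phi (Conj l)) sat_And IH; split=> [[H H'] psi|H].
  by rewrite inE => /predU1P[->//|]; exact: H'.
by split=> [|psi psil]; apply: H; rewrite inE ?eqxx// psil orbT.
Qed.

Lemma formula_in_Conj (P : V -> Prop) l :
  (forall phi, phi \in l -> formula_in P phi) -> formula_in P (Conj l).
Proof.
elim: l => //= phi l IH H; split=> //; split; first by apply: H; rewrite mem_head.
by split=> //; apply: IH => psi psil; apply: H; rewrite inE psil orbT.
Qed.

End Connectives.

(** [All] binds only the variable [None], so the variables of [P] are renamed to [None] one after
    the other. The result is still a formula over [V]; its support, not its type, records that [P]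
    is gone. *)
Lemma exists_formula V (P : set V) (phi : formula L V) : finite_set P ->
  exists psi : formula L V,
    (forall (C : structure L) (e : V -> C), sat e psi <->
      exists2 e', (forall v, ~ P v -> e' v = e v) & sat e' phi) /\
    forall Q : set V, formula_in Q phi -> formula_in (Q `\` P) psi.
Proof.
elim/Peq : V => V in P phi *.
move=> /finite_seqP[s ->{P}]; elim: s => [|v s [psi [psiE psi_in]]].
  exists phi; split=> [C e|Q]; last by rewrite set_nil setD0.
  split=> [ephi|[e' e'e]]; first by exists e.
  by rewrite (_ : e' = e)//; apply/funext => w; rewrite e'e//= in_nil.
pose f w := if w == v then None else Some w.
exists (Neg (All (Neg (rename f psi)))); split=> [C e|Q phiQ].
- have fE x : (fun o => oapp e x o) \o f = fun w => if w == v then x else e w.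
    by apply/funext => w; rewrite /f/=; case: ifP.
  have -> : sat e (Neg (All (Neg (rename f psi)))) <->
      exists x, sat (fun w => if w == v then x else e w) psi.
    split=> [/= H|[x ex] /(_ x)/=]; last by apply; apply/sat_rename; rewrite fE.
    apply: contrapT => /forallNP nH; apply: H => x.
    by move/sat_rename; rewrite fE => /nH.
  split=> [[x /psiE[e' e'E e'phi]]|[e' e'E e'phi]].
    exists e' => // w /=; rewrite inE => /negP; rewrite negb_or => /andP[wv /negP ws].
    by rewrite e'E// (negbTE wv).
  exists (e' v); apply/psiE; exists e' => // w /= ws.
  case: eqVneq => [->//|wv]; apply: e'E => /=; rewrite inE (negbTE wv)/=; exact: ws.
- split=> //=; split=> //; apply/formula_in_rename.
  apply: formula_in_sub (psi_in _ phiQ) => w [Qw /= ws].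
  by rewrite /f; case: eqVneq => //= wv; split=> //; rewrite inE (negbTE wv).
Qed.

End Syntax.

(** * Small sets *)

Section SmallSets.
Local Open Scope card_scope.

Lemma card_le_inj T U (A : set T) (B : set U) (f : T -> U) :
  set_fun A B f -> set_inj A f -> A #<= B.
Proof.
move=> fAB fI; have [g] : $|{injfun A >-> B}| by apply/injfunPex; exists f.
exact: inj_card_le g.
Qed.

Lemma card_leT_inj T U (A : set T) (B : set U) :
  A #<= B -> exists f : A -> B, injective f.
Proof.
move=> /card_leP[f]; exists f => x y.
by apply: (@inj _ _ setT f); rewrite ?inE.
Qed.

(* Zorn's lemma for the graphs of partial injections. *)
Lemma card_le_total T U : [set: T] #<= [set: U] \/ [set: U] #<= [set: T].
Proof.
pose P (G : set (T * U)) := forall p q, G p -> G q -> (p.1 = q.1 <-> p.2 = q.2).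
have [F FP Ftot|G [GP Gmax]] := @Zorn_bigcup _ P.
  move=> p q [G FG Gp] [G' FG' G'q].
  by have [/(_ _ Gp)|/(_ _ G'q)] := Ftot _ _ FG FG'; [move=> ?; exact: FP FG' _ _ _ _|
    move=> ?; exact: FP FG _ _ _ _].
have [domG|/existsNP[t tG]] := pselect (forall t, exists u, G (t, u)).
  left; have [f fG] := choice domG; apply: (@card_le_inj _ _ _ _ f) => // x y _ _ fxy.
  exact: (GP _ _ (fG x) (fG y)).2.
have [ranG|/existsNP[u uG]] := pselect (forall u, exists t, G (t, u)).
  right; have [f fG] := choice ranG; apply: (@card_le_inj _ _ _ _ f) => // x y _ _ fxy.
  exact: (GP _ _ (fG x) (fG y)).1.
exfalso; apply: (Gmax (G `|` [set (t, u)])).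
  split=> [p ?|/(_ (t, u) (or_intror erefl)) Gtu]; [by left|by apply: tG; exists u].
move=> [x y] [x' y'] /= [Gp|[-> ->]] [Gq|[-> ->]] //.
- exact: GP Gp Gq.
- by split=> E; [case: tG; exists y; rewrite -E|case: uG; exists x; rewrite -E].
- by split=> E; [case: tG; exists y'; rewrite E|case: uG; exists x'; rewrite E].
Qed.

Context {K : Type}.

Lemma small_le U V (A : set U) (B : set V) : A #<= B -> small K B -> small K A.
Proof.
move=> AB [BK KB]; split; first exact: card_le_trans BK.
by move=> KA; apply: KB; exact: card_le_trans AB.
Qed.

Lemma small_inj U V (f : U -> V) :
  injective f -> small K [set: V] -> small K [set: U].
Proof.
by move=> fI; apply: small_le; apply: (@card_le_inj _ _ _ _ f) => // x y _ _ /fI.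
Qed.

Lemma small_sub U (A B : set U) : A `<=` B -> small K B -> small K A.
Proof. by move=> /subset_card_le; exact: small_le. Qed.

Lemma small_image U V (f : U -> V) (A : set U) : small K A -> small K (f @` A).
Proof. by apply: small_le; exact: card_image_le. Qed.

Lemma small_setT U (A : set U) : small K [set: A] <-> small K A.
Proof.
have e := card_setT A.
by split; apply: small_le; [rewrite -(card_le_eql e)|rewrite (card_le_eql e)].
Qed.

(** Cantor's diagonal argument. It will refute a family of pairwise inequivalent tuples indexed by
    all sets of classes. *)
Lemma small_not_power U (f : set U -> U) : ~ injective f.
Proof.
move=> fI; pose D : set U := [set x | exists2 A, f A = x & ~ A x].
have [DD|nDD] := pselect (D (f D)); last by apply: (nDD); exists D.
by case: (DD) => A /fI -> nD; exact: nD DD.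
Qed.

Hypothesis K_limit : strong_limit K.
Hypothesis nat_small : small K [set: nat].

Lemma small_countable U (A : set U) : countable A -> small K A.
Proof. by move=> /small_le; apply. Qed.

Lemma small_sum U V :
  small K [set: U] -> small K [set: V] -> small K [set: U + V].
Proof.
move=> sU sV.
(* Two copies of [W] fit into its double power set, [{{x}}] coding the left copy and [{{x}, set0}]
   the right one. Comparability of [U] and [V] reduces the general sum to this case. *)
have ssum W : small K [set: W] -> small K [set: W + W].
  move=> /K_limit/K_limit; apply: (@small_inj _ _ (fun w => match w with
    | inl x => [set [set x]] | inr x => [set [set x]; set0] end)).
  have ne0 (x : W) : [set x] <> set0 by move=> /seteqP[/(_ x erefl)].
  have inj1 (x y : W) : [set x] = [set y] -> x = y.
    by move=> /seteqP[/(_ x erefl)].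
  move=> [x|x] [y|y] /seteqP[xy yx].
  - by congr inl; apply: inj1; exact: xy.
  - by have /esym/ne0 := yx set0 (or_intror erefl).
  - by have /esym/ne0 := xy set0 (or_intror erefl).
  - by congr inr; have [/inj1|/ne0] := xy [set x] (or_introl erefl).
have sT W : small K [set: W] -> small K [set: [set: W]] by move=> /small_setT.
have [/card_leT_inj[f fI]|/card_leT_inj[f fI]] := card_le_total U V.
  pose g (w : U + V) : [set: V] + [set: V] := match w with
    | inl x => inl (f (SigSub (in_setT x))) | inr y => inr (SigSub (in_setT y)) end.
  apply: (@small_inj _ _ g) (ssum _ (sT _ sV)).
  by move=> [x|x] [y|y] //= [E]; [case: (fI _ _ E) => ->|rewrite E].
pose g (w : U + V) : [set: U] + [set: U] := match w with
  | inr x => inl (f (SigSub (in_setT x))) | inl y => inr (SigSub (in_setT y)) end.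
apply: (@small_inj _ _ g) (ssum _ (sT _ sU)).
by move=> [x|x] [y|y] //= [E]; [rewrite E|case: (fI _ _ E) => ->].
Qed.

Lemma small_prod U V :
  small K [set: U] -> small K [set: V] -> small K [set: U * V].
Proof.
move=> sU sV; apply: (@small_inj _ _ (fun p => [set inl p.1; inr p.2])) (K_limit (small_sum sU sV)).
move=> [x y] [x' y'] /seteqP[H _] /=.
have [[->]|//] := H _ (or_introl erefl).
by have [//|[->]] := H _ (or_intror erefl).
Qed.

Lemma small_setU U (A B : set U) : small K A -> small K B -> small K (A `|` B).
Proof.
move=> /small_setT sA /small_setT sB.
pose f (w : A + B) : U := match w with inl x => val x | inr x => val x end.
apply: (@small_sub _ _ (f @` setT)); last exact/small_image/small_sum.
move=> x [xA|xB]; first by exists (inl (SigSub (mem_set xA))).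
by exists (inr (SigSub (mem_set xB))).
Qed.

End SmallSets.

(** * Saturation and homogeneity for small tuples *)

Section Saturation.
Local Open Scope card_scope.
Context {K : Type} {L : language} {T : theory L} {C : structure L}.
Hypothesis Cm : monster_model K T C.

Lemma monster_strong_limit : strong_limit K. Proof. by case: Cm. Qed.

Lemma small_nat : small K [set: nat].
Proof.
case: Cm => _ + _ _ _.
by apply: (@small_inj _ _ _ (fun n => Eq (Var L n) (Var L n))) => m n [].
Qed.

Lemma finite_realizations I (s : set (formula L (I + C))) : finite_set s ->
  exists2 l : seq (formula L (I + C)), (forall phi, phi \in l <-> s phi) &
  forall b, realizations s b <-> sat (env b) (Conj l).
Proof.
move=> /finite_seqP[l ->]; exists l => // b.
by split=> [sb|/sat_Conj sb] //; apply/sat_Conj.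
Qed.

Lemma formulas_over_Conj I (A : set C) (l : seq (formula L (I + C))) :
  (forall phi, phi \in l -> formulas_over A phi) -> formulas_over A (Conj l).
Proof. exact: formula_in_Conj. Qed.

Lemma formulas_over_sub I (A B : set C) (phi : formula L (I + C)) :
  A `<=` B -> formulas_over A phi -> formulas_over B phi.
Proof. by move=> AB; apply: formula_in_sub => -[//|c]; exact: AB. Qed.

(* A maximal partial tuple [G] preserving finite satisfiability of [q] is
   total: the formulas in one variable which the finite parts of [q] impose on
   a missing coordinate form a type over [A] and the range of [G]. *)
Lemma saturation J (A : set C) (q : set (formula L (J + C))) :
  small K [set: J] -> small K A -> q `<=` formulas_over A ->
  finitely_satisfiable q -> realizations q !=set0.
Proof.
move=> sJ sA qA qfs; have [_ _ _ Csat _] := Cm.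
pose ext (G : set (J * C)) (b : J -> C) := forall j x, G (j, x) -> b j = x.
pose P (G : set (J * C)) := forall s, finite_set s -> s `<=` q ->
  exists2 b, realizations s b & ext G b.
have P0 : P set0 by move=> s fs /(qfs s fs)[b sb]; exists b.
have Pfun G j x y : P G -> G (j, x) -> G (j, y) -> x = y.
  move=> /(_ set0 (finite_set0 _) (sub0set _))[b _ bG] Gx Gy.
  by rewrite -(bG _ _ Gx) (bG _ _ Gy).
have [c0] := carrier_inhabited C.
pose fn (G : set (J * C)) j : C :=
  if pselect (exists x, G (j, x)) is left H then projT1 (cid H) else c0.
have fnP G j x : G (j, x) -> G (j, fn G j).
  by move=> Gx; rewrite /fn; case: pselect => [H|[]]; [case: (cid H)|exists x].
have fnE G j x : P G -> G (j, x) -> fn G j = x.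
  move=> PG Gx; apply: Pfun PG _ (Gx).
  exact: fnP Gx.
have [F FP Ftot|G [GP Gmax]] := @Zorn_bigcup _ P.
  set U := \bigcup_(X in F) X => s fs sq.
  have Ufun j x y : U (j, x) -> U (j, y) -> x = y.
    move=> [G FG Gx] [G' FG' G'y].
    have [/(_ _ Gx) G'x|/(_ _ G'y) Gy] := Ftot _ _ FG FG'.
      exact: Pfun (FP _ FG') G'x G'y.
    exact: Pfun (FP _ FG) Gx Gy.
  (* Finitely many coordinates receive all their values from one member of the chain; the extra
     [set0] serves when none of them has a value. *)
  have cover (l : seq {classic J}) : exists2 G, (F `|` [set set0]) G &
      forall j x, j \in l -> U (j, x) -> G (j, x).
    elim: l => [|j l [G FG GU]]; first by exists set0; [right|].
    have [[x [G' FG' G'x]]|nU] := pselect (exists x, U (j, x)); last first.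
      exists G => // k x; rewrite inE => /predU1P[-> Ux|]; last exact: GU.
      by case: nU; exists x.
    have Ux : U (j, x) by exists G'.
    have [G'G|GG'] : G' `<=` G \/ G `<=` G'.
      case: FG => [FG|->]; last by right; exact: sub0set.
      by have [] := Ftot _ _ FG FG'; [right|left].
      exists G => // k y; rewrite inE => /predU1P[-> Uy|kl]; last exact: GU.
      by apply: G'G; rewrite (Ufun _ _ _ Uy Ux).
    exists G'; first by left.
    move=> k y; rewrite inE => /predU1P[-> Uy|kl Uy]; first by rewrite (Ufun _ _ _ Uy Ux).
    exact/GG'/GU.
  have [l ls lE] := finite_realizations fs.
  have [Q /finite_preimage Qf Qphi] := formula_support (Conj l).
  have {}Qf : finite_set (inl @^-1` Q : set J) by apply: Qf => x y _ _ [].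
  have /(@finite_seqP {classic J})[V QV] := Qf.
  have VE j : Q (inl j) -> j \in V by move=> Qj; have : (inl @^-1` Q) j by []; rewrite QV.
  have [G FG GU] := cover V.
  have PG : P G by case: FG => [/FP|->].
  have [b sb bG] := PG s fs sq.
  (* [b] already agrees with the union on the coordinates that [s] mentions, so overwriting it with
     all values of the union preserves satisfaction of [s]. *)
  pose b' j := if pselect (exists x, U (j, x)) then fn U j else b j.
  have fnU j x : U (j, x) -> fn U j = x.
    by move=> Ux; apply: Ufun (Ux); exact: fnP Ux.
  exists b' => [|j x Ujx]; last first.
    by rewrite /b'; case: pselect => [H|[]]; [exact: fnU|exists x].
  apply/lE; move: sb => /lE; apply: (sat_in _ Qphi).1 => -[j|//] Qj /=.
  rewrite /b'; case: pselect => // -[x Ux].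
  by rewrite (bG j x) ?(fnU j x)//; apply: GU => //; exact: VE.
have dom j : exists x, G (j, x).
  apply: contrapT => jG.
  pose A' := A `|` [set x | exists j, G (j, x)].
  have sA' : small K A'.
    apply: (small_setU monster_strong_limit) => //.
    apply: small_sub (small_image (fn G) sJ) => x [k Gx].
    by exists k => //; exact: fnE.
  pose q1 : set (formula L (unit + C)) := [set psi | formulas_over A' psi /\
    exists s, [/\ finite_set s, s `<=` q & forall b, realizations s b -> ext G b ->
      sat (env (fun=> b j)) psi]].
  have [c q1c] : realizations q1 !=set0.
    apply: Csat sA' _ _ => [psi []//|t /finite_seqP[l ->] lq1].
    suff [s [fs sq sl]] : exists s, [/\ finite_set s, s `<=` q & forall b,
        realizations s b -> ext G b -> forall psi, psi \in l -> sat (env (fun=> b j)) psi].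
      by have [b sb bG] := GP s fs sq; exists (fun=> b j) => psi psil; exact: sl.
    elim: l lq1 => [|psi l IH] lq1; first by exists set0; split.
    have [_ [s [fs sq sl]]] := lq1 psi (mem_head _ _).
    have [|s' [fs' sq' sl']] := IH.
      by move=> phi phil; apply: lq1; rewrite /= inE (phil : phi \in l) orbT.
    exists (s `|` s'); split=> [||b sb bG phi].
    - by rewrite finite_setU.
    - by rewrite subUset.
    - rewrite inE => /predU1P[->|phil]; first by apply: sl bG => ? ?; apply: sb; left.
      by apply: sl' bG _ phil => ? ?; apply: sb; right.
  apply: (Gmax (G `|` [set (j, c tt)])).
    by split=> [p|/(_ (j, c tt) (or_intror erefl)) Gj]; [left|apply: jG; exists (c tt)].
  move=> s fs sq.
  have [l ls lE] := finite_realizations fs.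
  (* [h] substitutes the values already chosen by [G], [chi] quantifies away every remaining
     coordinate but [j], and [g] turns [j] into the single variable. The result belongs to [q1], so
     [c] satisfies it. *)
  pose h (v : J + C) : J + C := match v with
    | inl k => if pselect (exists x, G (k, x)) then inr (fn G k) else inl k
    | inr x => inr x end.
  have [Q fQ Qh] := formula_support (rename h (Conj l)).
  pose P1 : set (J + C) := Q `&` [set v | exists2 k, v = inl k & k <> j].
  have fP1 : finite_set P1 by apply: sub_finite_set fQ => v [].
  have [chi [chiE chi_in]] := exists_formula (rename h (Conj l)) fP1.
  pose g (v : J + C) : unit + C := if v is inr x then inr x else inl tt.
  have chiQ := chi_in _ Qh.
  have hb b : ext G b -> env b \o h = env b.
    move=> bG; apply/funext => -[k|//] /=; case: pselect => //= -[x Gx].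
    by rewrite (fnE _ _ _ GP Gx) (bG _ _ Gx).
  have gE b : sat (env (fun=> b j)) (rename g chi) <-> sat (env b) chi.
    rewrite sat_rename; apply: sat_in chiQ => -[k|//] [Qk P1k] /=.
    have [->//|kj] := pselect (k = j).
    by case: P1k; split=> //; exists k.
  have : sat (env c) (rename g chi).
    apply: q1c; split.
      apply/formula_in_rename.
      have : formula_in [set v | match v with inr x => A' x | _ => True end]
          (rename h (Conj l)).
        have lA : formulas_over A (Conj l).
          by apply: formulas_over_Conj => phi /ls/sq; exact: qA.
        apply/formula_in_rename; apply: formula_in_sub lA.
        move=> [k|x] /=; last by left.
        by case: pselect => // -[x Gx] _; right; exists k; rewrite (fnE _ _ _ GP Gx).
      by move=> /chi_in; apply: formula_in_sub => -[//|x []].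
    exists s; split=> // b sb bG; apply/gE/chiE; exists (env b) => //.
    by apply/sat_rename; rewrite hb//; apply/lE.
  rewrite (_ : c = fun=> (fun=> c tt) j); last by apply/funext => -[].
  move=> /gE/chiE[e e_out /sat_rename eh].
  pose b k := e (h (inl k)).
  have eC x : e (inr x) = x by rewrite e_out// => -[_ []].
  exists b.
    apply/lE; rewrite (_ : env b = e \o h)//.
    by apply/funext => -[//|x] /=; rewrite eC.
  rewrite /b /= => k x [Gx|[-> ->]] /=; case: pselect => [kG|nG] //=.
  - by rewrite eC; exact: fnE.
  - by case: nG; exists x.
  - by rewrite e_out// => -[_ [i [->]]].
have {}fnE j : G (j, fn G j) by have [x Gx] := dom j; exact: fnP Gx.
exists (fn G) => phi qphi.
have [|b bphi bG] := GP [set phi] (finite_set1 _); first by move=> _ ->.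
rewrite (_ : fn G = b); first exact: bphi.
by apply/funext => j; rewrite (bG _ _ (fnE j)).
Qed.

Lemma tp_set0P I (b b' : I -> C) A : tp A b = tp A b' <->
  forall phi, formulas_over A phi -> (sat (env b) phi <-> sat (env b') phi).
Proof.
split=> [/seteqP[H H'] phi phiA|H].
  by split=> bphi; [have [] := H phi (conj phiA bphi)|have [] := H' phi (conj phiA bphi)].
by apply/seteqP; split=> phi [phiA bphi]; split=> //; apply/H.
Qed.

(** The map sending each [b j] to [b' j] and fixing [A] is elementary by equality of types, and
    strong homogeneity extends it. [dec] names each point of its domain by a variable or a
    parameter; the equations between names, which are among the formulas of the types, show that the
    choice of name is harmless. *)
Lemma homogeneity J (A : set C) (b b' : J -> C) :
  small K [set: J] -> small K A -> tp A b = tp A b' ->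
  exists2 s : aut C, aut_fixing A s & b' = s \o b.
Proof.
move=> sJ sA /tp_set0P bb'; have [_ _ _ _ Chom] := Cm.
have ee (v w : J + C) : (forall x, v = inr x -> A x) -> (forall x, w = inr x -> A x) ->
    env b v = env b w -> env b' v = env b' w.
  move=> vA wA; apply: (bb' (Eq (Var L v) (Var L w)) _).1.
  split; rewrite /formulas_over/=; [case: v vA|case: w wA] => // x H; exact: H.
pose D := A `|` range b.
pose dec (x : C) : J + C :=
  if pselect (exists j, b j = x) is left H then inl (projT1 (cid H)) else inr x.
have decE x : env b (dec x) = x.
  by rewrite /dec; case: pselect => //= H; case: (cid H).
have decA x : D x -> forall y, dec x = inr y -> A y.
  rewrite /dec => -[Ax|[j _ jx]]; case: pselect => // nH y [<-]//.
  by case: nH; exists j.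
have [||s sE] := Chom D (env b' \o dec).
- by apply: (small_setU monster_strong_limit) => //; exact: small_image.
- move=> phi phiD; rewrite -(sat_rename dec) -(bb' (rename dec phi)).
    by rewrite sat_rename (_ : _ \o _ = id)//; apply/funext => x /=.
  apply/formula_in_rename; apply: formula_in_sub phiD => x Dx /=.
  by case E: (dec x) => [//|y]; exact: decA E.
exists s => [x Ax|].
  rewrite sE; last by left.
  rewrite -[RHS]/(env b' (inr x)); apply: ee; rewrite ?decE//.
    by apply: decA; left.
  by move=> y [<-].
apply/funext => j /=; rewrite sE; last by right; exists j.
rewrite -[LHS]/(env b' (inl j)); apply: ee; rewrite ?decE//.
by apply: decA; right; exists j.
Qed.

Lemma tp_aut I A (b : I -> C) (s : aut C) : aut_fixing A s -> tp A (s \o b) = tp A b.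
Proof.
move=> sA; apply/tp_set0P => phi phiA; rewrite -(sat_aut s (env b)).
by apply: sat_in phiA => -[//|x] /sA/= ->.
Qed.

End Saturation.

(** * Type-definable sets *)

Section TypeDefinable.
Context {K : Type} {L : language} {T : theory L} {C : structure L}.
Hypothesis Cm : monster_model K T C.

Definition reindex V W U (f : V -> W) (v : V + U) : W + U :=
  match v with inl i => inl (f i) | inr c => inr c end.

Lemma env_reindex I J (f : I -> J) (b : J -> C) : env b \o reindex f = env (b \o f).
Proof. by apply/funext => -[]. Qed.

Lemma sat_reindex I J (f : I -> J) (b : J -> C) phi :
  sat (env b) (rename (reindex f) phi) <-> sat (env (b \o f)) phi.
Proof. by rewrite sat_rename env_reindex. Qed.

Lemma formulas_over_reindex I J (f : I -> J) (A : set C) (phi : formula L (I + C)) :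
  formulas_over A phi -> formulas_over A (rename (reindex f) phi).
Proof.
by move=> phiA; apply/formula_in_rename; apply: formula_in_sub phiA => -[].
Qed.

Lemma formulas_over_And I (A : set C) (phi psi : formula L (I + C)) :
  formulas_over A phi -> formulas_over A psi -> formulas_over A (And phi psi).
Proof. by []. Qed.

(** Directedness makes any finite part of [q] follow from a single condition [R i]. The conditions
    need not be formulas, so they can combine a formula with membership in a given set. *)
Lemma compactness J (A : set C) (q : set (formula L (J + C))) D (D0 : set D)
    (R : D -> (J -> C) -> Prop) :
  small K [set: J] -> small K A -> q `<=` formulas_over A ->
  D0 !=set0 ->
  (forall i j, D0 i -> D0 j -> exists2 k, D0 k & forall b, R k b -> R i b /\ R j b) ->
  (forall i, D0 i -> exists b, R i b) ->
  (forall phi, q phi -> exists2 i, D0 i & forall b, R i b -> sat (env b) phi) ->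
  realizations q !=set0.
Proof.
move=> sJ sA qA [i0 D0i0] Rdir Rne qR; apply: (saturation Cm sJ sA qA).
move=> s /finite_seqP[l ->] lq.
suff [i D0i il] : exists2 i, D0 i &
    forall b, R i b -> forall phi, phi \in l -> sat (env b) phi.
  by have [b Rb] := Rne i D0i; exists b => phi; exact: il.
elim: l lq => [|phi l IH] lq; first by exists i0.
have [i D0i il] : exists2 i, D0 i &
    forall b, R i b -> forall phi, phi \in l -> sat (env b) phi.
  by apply: IH => psi psil; apply: lq; rewrite /= inE (psil : psi \in l) orbT.
have [j D0j jphi] := qR phi (lq _ (mem_head _ _)).
have [k D0k kij] := Rdir i j D0i D0j.
exists k => // b /kij[Rib Rjb] psi; rewrite inE => /predU1P[->|]; first exact: jphi.
exact: il.
Qed.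

Lemma realizations_tp I A (b b' : I -> C) :
  realizations (tp A b) b' <-> tp A b' = tp A b.
Proof.
split=> [bb'|<- phi []//]; apply/tp_set0P => phi phiA.
split=> [b'phi|bphi]; last exact: bb'.
by apply: contrapT => nbphi; have := bb' (Neg phi); apply.
Qed.

Notation TD := type_definable_over.

Lemma type_definable_over_sub I (A B : set C) (X : set (I -> C)) :
  A `<=` B -> TD A X -> TD B X.
Proof.
by move=> AB [Phi PhiA ->]; exists Phi => // phi /PhiA; exact: formulas_over_sub.
Qed.

Lemma type_definable_bigcap I A D (D0 : set D) (X : D -> set (I -> C)) :
  (forall i, D0 i -> TD A (X i)) -> TD A (\bigcap_(i in D0) X i).
Proof.
move=> H; exists [set phi | formulas_over A phi /\
    forall b, (\bigcap_(i in D0) X i) b -> sat (env b) phi].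
  by move=> phi [].
apply/seteqP; split=> [b Xb phi [_]|b H' i D0i]; first exact.
have [Phi PhiA XE] := H i D0i; rewrite XE => phi Phiphi; apply: H'; split; first exact: PhiA.
by move=> c /(_ i D0i); rewrite XE; exact.
Qed.

Lemma type_definableI I A (X Y : set (I -> C)) : TD A X -> TD A Y -> TD A (X `&` Y).
Proof.
move=> tX tY; rewrite -bigcap2E; apply: type_definable_bigcap => -[|[|n]] _ //=.
by exists set0 => //; apply/seteqP; split=> // b _ phi.
Qed.

Lemma type_definable_tp I A (b : I -> C) : TD A [set b' | tp A b' = tp A b].
Proof.
exists (tp A b); first by move=> phi [].
by apply/seteqP; split=> b' /= /realizations_tp.
Qed.

Lemma type_definable_preimage I J (f : I -> J) A (X : set (I -> C)) :
  TD A X -> TD A [set b : J -> C | X (b \o f)].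
Proof.
move=> [Phi PhiA ->]; exists (rename (reindex f) @` Phi).
  by move=> _ [phi /PhiA phiA <-]; exact: formulas_over_reindex.
apply/seteqP; split=> b /= H phi; first by move=> [psi /H psib <-]; apply/sat_reindex.
by move=> Phiphi; apply/sat_reindex; apply: H; exists phi.
Qed.

Definition tcat I J (b : I -> C) (c : J -> C) (v : I + J) : C :=
  match v with inl i => b i | inr j => c j end.

Lemma tcat_inl I J (b : I -> C) (c : J -> C) : tcat b c \o inl = b.
Proof. by []. Qed.
Lemma tcat_inr I J (b : I -> C) (c : J -> C) : tcat b c \o inr = c.
Proof. by []. Qed.
Lemma tcatE I J (d : I + J -> C) : d = tcat (d \o inl) (d \o inr).
Proof. by apply/funext => -[]. Qed.
Lemma comp_tcat I J (s : C -> C) (b : I -> C) (c : J -> C) :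
  s \o tcat b c = tcat (s \o b) (s \o c).
Proof. by apply/funext => -[]. Qed.

Lemma type_definable_section I J A (X : set (I + J -> C)) (a : J -> C) :
  TD A X -> TD (A `|` range a) [set b | X (tcat b a)].
Proof.
move=> [Phi PhiA ->].
pose r (v : I + J + C) : I + C := match v with
  | inl (inl i) => inl i | inl (inr j) => inr (a j) | inr c => inr c end.
have rE b : env b \o r = env (tcat b a) by apply/funext => -[[]|].
exists (rename r @` Phi).
  move=> _ [phi /PhiA phiA <-]; apply/formula_in_rename.
  apply: formula_in_sub phiA => -[[i|j]|c] //=; last by left.
  by move=> _; right; exists j.
apply/seteqP; split=> b /= H phi.
  by move=> [psi /H psib <-]; rewrite sat_rename rE.
by move=> Phiphi; rewrite -rE -sat_rename; apply: H; exists phi.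
Qed.

(** The defining set consists of all formulas over [B] that hold throughout the image. If [b']
    satisfies them, then each formula of [tp B b'] holds somewhere on the image, as otherwise its
    negation would be among them; compactness then finds one [b] for all. Projection is the case
    [B = A], and descent to other parameters is the case [f = id]. *)
Lemma type_definable_image I J (f : I -> J) A B (X : set (J -> C)) :
  small K [set: J] -> small K A -> B `<=` A -> TD A X ->
  TD B [set b' | exists2 b, X b & tp B b' = tp B (b \o f)].
Proof.
move=> sJ sA BA [Phi PhiA XE].
exists [set psi | formulas_over B psi /\
    forall b, X b -> sat (env (b \o f)) psi]; first by move=> phi [].
apply/seteqP; split=> [b' /= [b Xb /tp_set0P bb'] phi [phiB Xphi]|b' H].
  by apply/(bb' phi phiB); exact: Xphi.
have [|||||b bq] := @compactness J A
    (Phi `|` rename (reindex f) @` tp B b') _ (tp B b')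
    (fun psi b => X b /\ sat (env (b \o f)) psi) sJ sA.
- move=> phi [/PhiA//|[psi [psiB _] <-]]; apply: formulas_over_reindex.
  exact: formulas_over_sub psiB.
- by exists (Neg Fal); split=> // -[].
- move=> phi psi [phiB bphi] [psiB bpsi]; exists (And phi psi).
    by split; [exact: formulas_over_And|apply/sat_And].
  by move=> b [Xb /sat_And[]].
- move=> phi [phiB bphi]; apply: contrapT => /forallNP nX.
  suff : sat (env b') (Neg phi) by apply.
  by apply: H; split=> // b Xb bphi'; exact: nX (conj Xb bphi').
- move=> phi [Phiphi|[psi tpsi <-]].
    by exists (Neg Fal); [split=> // -[]|move=> b [+ _]; rewrite XE; exact].
  by exists psi => // b [_ ?]; apply/sat_reindex.
exists b; first by rewrite XE => phi Phiphi; apply: bq; left.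
apply/esym/realizations_tp => phi phit.
by apply/sat_reindex; apply: bq; right; exists phi.
Qed.

Lemma type_definable_over_aut I A (X : set (I -> C)) (s : aut C) b :
  TD A X -> aut_fixing A s -> X b -> X (s \o b).
Proof.
move=> [Phi PhiA ->] sA Xb phi Phiphi.
have /tp_set0P/(_ phi (PhiA _ Phiphi)) := tp_aut b sA.
by move=> [_]; apply; exact: Xb.
Qed.

Lemma type_definable_proj I J (f : I -> J) A (X : set (J -> C)) :
  small K [set: I] -> small K [set: J] -> small K A -> TD A X ->
  TD A [set b' | exists2 b, X b & b' = b \o f].
Proof.
move=> sI sJ sA tX.
rewrite (_ : [set b' | _] = [set b' | exists2 b, X b & tp A b' = tp A (b \o f)]).
  exact: type_definable_image tX.
apply/seteqP; split=> [_ [b Xb ->]|b' [b Xb /esym/(homogeneity Cm sI sA)[s sF ->]]].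
  by exists b.
by exists (s \o b) => //; exact: type_definable_over_aut tX sF Xb.
Qed.

(** Tuples of equal type over [B] are conjugate over [B], so the closure of an invariant set under
    equality of types over [B] is the set itself. *)
Lemma type_definable_descent I A B (X : set (I -> C)) :
  small K [set: I] -> small K A -> small K B -> TD A X ->
  (forall s b, aut_fixing B s -> X b -> X (s \o b)) -> TD B X.
Proof.
move=> sI sA sB tX Xinv.
have sAB := small_setU (monster_strong_limit Cm) sA sB.
have := @type_definable_image I I id (A `|` B) B X sI sAB (@subsetUr _ _ _)
  (type_definable_over_sub (@subsetUl _ _ _) tX).
rewrite (_ : [set b' | _] = X)//; apply/seteqP; split=> b.
  by move=> [b' Xb' /esym/(homogeneity Cm sI sB)[s sF ->]]; exact: Xinv.
by move=> Xb; exists b.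
Qed.

(** * Elementary submodels and bounded equivalence relations *)

Lemma model_realizes V (N : set C) (phi : formula L V) e :
  elementary_submodel N -> sat (e : V -> C) phi ->
  exists2 e', (forall v, N (e' v)) & sat (e' : V -> C) phi.
Proof.
move=> [N0 [j [jE <-]]] ephi.
have [P fP Pphi] := formula_support phi.
have [psi [psiE psi_in]] := exists_formula phi fP.
have [n0] := carrier_inhabited N0.
(* The existential closure [psi] mentions no variable, so its truth does not depend on the
   assignment and it transfers between [C] and the submodel. *)
have : sat (fun=> n0) psi.
  rewrite -[fun=> n0]/(id \o (fun=> n0)) -sat_rename; apply/jE.
  rewrite sat_rename; have epsi : sat e psi by apply/psiE; exists e.
  by rewrite -(sat_in (e := e) _ (psi_in _ Pphi))// => v [].
move=> /psiE[e' _]; rewrite -[e']/(id \o e') -sat_rename => /jE.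
by rewrite sat_rename => ?; exists (j \o e') => // v; exists (e' v).
Qed.

Lemma sat_over0 I (e : I + C -> C) (phi : formula L (I + C)) :
  formulas_over set0 phi -> (sat e phi <-> sat (env (e \o inl)) phi).
Proof. by apply: sat_in => -[]. Qed.

(** It suffices to prove each formula [phi] implied by [E] at [(b, s b)]. Boundedness limits the
    length of sequences that are pairwise unrelated by a suitable half [psi] of [phi], and a longest
    one can be found in [N]. Hence [b] is [psi]-related to some [d] in [N]; as [s] fixes [d], so is
    [s b], and the two halves give [phi]. *)
Lemma bounded_equivalence_fixing J (X : set (J -> C)) E (N : set C) (s : aut C) b :
  small K [set: J] -> bounded_equivalence K X E -> TD set0 (graph E) ->
  elementary_submodel N -> aut_fixing N s -> X b -> E b (s \o b).
Proof.
move=> sJ [[EX Er Es Et] EC] [Phi0 Phi00 EPhi0] Nm sN Xb.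
pose sem (phi : formula L (J + J + C)) x y := sat (env (tcat x y)) phi.
pose Phi := [set phi | formulas_over set0 phi /\ forall x y, E x y -> sem phi x y].
have EPhi x y : (forall phi, Phi phi -> sem phi x y) -> E x y.
  move=> H; have : graph E (tcat x y); last by [].
  rewrite EPhi0 => phi Phiphi; apply: H; split; first exact: Phi00.
  move=> x' y' Exy; have : graph E (tcat x' y') by [].
  by rewrite EPhi0; exact.
have PhiAnd phi psi : Phi phi -> Phi psi -> Phi (And phi psi).
  move=> [phi0 H] [psi0 H']; split=> [|x y Exy]; first exact: formulas_over_And.
  by apply/sat_And; split; [exact: H|exact: H'].
pose swap (v : J + J) : J + J := match v with inl i => inr i | inr i => inl i end.
pose sw (phi : formula L (J + J + C)) : formula L (J + J + C) := rename (@reindex _ _ C swap) phi.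
have swE phi x y : sem (sw phi) x y <-> sem phi y x.
  rewrite /sem sat_reindex (_ : _ \o swap = tcat y x)//.
  by apply/funext => -[].
have Phisw phi : Phi phi -> Phi (sw phi).
  move=> [phi0 H]; split=> [|x y Exy]; last by apply/swE/H/Es.
  exact: formulas_over_reindex.
have Top : Phi (Neg Fal) by split=> // x y _ [].
have s0 : small K (@set0 C).
  by apply: (small_countable (small_nat Cm)); exact: countable0.
(* The analogue of halving an entourage of a uniformity. If no such [psi] existed, compactness would
   give a [d] that is [E]-related to two tuples violating [phi], against transitivity. *)
have half phi : Phi phi -> exists psi, [/\ Phi psi,
    forall x y, sem psi x y -> sem psi y x &
    forall d x y, sem psi d x -> sem psi d y -> sem phi x y].
  move=> Phiphi; apply: contrapT => /forallNP nhalf.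
  pose f1 (v : J + J) : J + (J + J) := match v with inl i => inl i | inr i => inr (inl i) end.
  pose f2 (v : J + J) : J + (J + J) := match v with inl i => inl i | inr i => inr (inr i) end.
  pose f3 (v : J + J) : J + (J + J) := inr v.
  pose R psi d := [/\ sat (env (d \o f1)) psi, sat (env (d \o f2)) psi &
    ~ sat (env (d \o f3)) phi].
  have SL := monster_strong_limit Cm.
  have [|||||d dq] := @compactness (J + (J + J)) set0
    (rename (reindex f1) @` Phi `|` rename (reindex f2) @` Phi `|`
      [set Neg (rename (reindex f3) phi)]) _ Phi R
    (small_sum SL sJ (small_sum SL sJ sJ)) s0.
  - move=> _ [[[psi [psi0 _] <-]|[psi [psi0 _] <-]]|->].
    + exact: formulas_over_reindex.
    + exact: formulas_over_reindex.
    + by split=> //; apply: formulas_over_reindex; case: Phiphi.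
  - by exists (Neg Fal).
  - move=> psi psi' H H'; exists (And psi psi'); first exact: PhiAnd.
    by move=> d [/sat_And[? ?] /sat_And[? ?] ?].
  - move=> psi Phipsi; apply: contrapT => /forallNP nR.
    apply: (nhalf (And psi (sw psi))); split; first by apply: PhiAnd => //; exact: Phisw.
      by move=> x y /sat_And[H /swE H']; apply/sat_And; split=> //; apply/swE.
    move=> d x y /sat_And[H _] /sat_And[H' _]; apply: contrapT => nphi.
    apply: (nR (tcat d (tcat x y))); split.
    + by rewrite (_ : _ \o _ = tcat d x)//; apply/funext => -[].
    + by rewrite (_ : _ \o _ = tcat d y)//; apply/funext => -[].
    + by rewrite (_ : _ \o _ = tcat x y)//; apply/funext => -[].
  - move=> _ [[[psi Psi <-]|[psi Psi <-]]|->].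
    + by exists psi => // d [? _ _]; apply/sat_reindex.
    + by exists psi => // d [_ ? _]; apply/sat_reindex.
    + by exists (Neg Fal) => // d [_ _ ?] /sat_reindex.
  have E1 : E (d \o inl) (d \o inr \o inl).
    apply: EPhi => psi Psi; rewrite /sem.
    rewrite (_ : tcat _ _ = d \o f1); last by apply/funext => -[].
    by apply/sat_reindex; apply: dq; left; left; exists psi.
  have E2 : E (d \o inl) (d \o inr \o inr).
    apply: EPhi => psi Psi; rewrite /sem.
    rewrite (_ : tcat _ _ = d \o f2); last by apply/funext => -[].
    by apply/sat_reindex; apply: dq; left; right; exists psi.
  have := dq _ (or_intror erefl); apply; apply/sat_reindex.
  have [_ H] := Phiphi; have := H _ _ (Et _ _ _ (Es _ _ E1) E2).
  by rewrite /sem (_ : tcat _ _ = d \o f3)//; apply/funext => -[].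
apply: (EPhi) => phi /half[psi [[psi0 Psi] psis psit]].
(* Membership in [X] is relaxed to one formula [theta] holding on the diagonal, because [X] is not
   given by a single formula. Being a chain is then one formula and can be realized in [N]. *)
pose chain n theta (d : nat -> J -> C) :=
  (forall i, (i < n)%N -> sem theta (d i) (d i)) /\
  forall i j, (i < n)%N -> (j < n)%N -> i <> j -> ~ sem psi (d i) (d j).
have [n [theta [Theta [d dn] nd]]] : exists n theta, [/\ Phi theta,
    exists d, chain n theta d & ~ exists d, chain n.+1 theta d].
  apply: contrapT => nn.
  have Pn n theta : Phi theta -> exists d, chain n theta d.
    move=> Theta; elim: n => [|n IH]; first by exists (fun _ => b).
    by apply: contrapT => nd; apply: nn; exists n, theta.
  (* If all lengths occurred for all [theta], compactness would give a chain in [X] indexed by the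
     power set of the set of classes, with entries in distinct classes. *)
  pose U : Type := classes X E; pose Lam : Type := {classic set U}.
  have sL : small K [set: Lam].
    by apply: (monster_strong_limit Cm); apply/small_setT.
  pose at_ (l : Lam) (j : J) := (l, j).
  pose r (l m : Lam) (v : J + J) := match v with inl j => (l, j) | inr j => (m, j) end.
  have rE x l m : x \o r l m = tcat (x \o at_ l) (x \o at_ m) by apply/funext => -[].
  pose q : set (formula L (Lam * J + C)) :=
    [set rename (reindex (r lt.1 lt.1)) lt.2 | lt in [set lt : Lam * _ | Phi lt.2]] `|`
    [set Neg (rename (reindex (r lm.1 lm.2)) psi) |
      lm in [set lm : Lam * Lam | lm.1 <> lm.2]].
  pose R (lt : seq Lam * formula L (J + J + C)) (x : Lam * J -> C) :=
    (forall l, l \in lt.1 -> sem lt.2 (x \o at_ l) (x \o at_ l)) /\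
    forall l m, l \in lt.1 -> m \in lt.1 -> l <> m -> ~ sem psi (x \o at_ l) (x \o at_ m).
  have [|||||x xq] := @compactness _ set0 q _ [set lt | Phi lt.2] R
      (small_prod (monster_strong_limit Cm) sL sJ) s0.
  - move=> _ [[[l th] [th0 _] <-]|[lm _ <-]]; first exact: formulas_over_reindex.
    by split=> //; exact: formulas_over_reindex.
  - by exists ([::], Neg Fal).
  - move=> [l th] [l' th'] /= H H'; exists (l ++ l', And th th'); first exact: PhiAnd.
    move=> x [/= H1 H2]; split; split=> /=.
    + by move=> m ml; have /sat_And[] := H1 m (etrans (mem_cat _ _ _) (introT orP (or_introl ml))).
    + by move=> m m' ml ml'; apply: H2; rewrite mem_cat ?ml ?ml'.
    + by move=> m ml; have /sat_And[] := H1 m (etrans (mem_cat _ _ _) (introT orP (or_intror ml))).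
    + by move=> m m' ml ml'; apply: H2; rewrite mem_cat ?ml ?ml' orbT.
  - move=> [l th] /= Th; have [d [d1 d2]] := Pn (size l) th Th.
    exists (fun p => d (index p.1 l) p.2); split=> /= [m|m m'].
      by rewrite -index_mem; exact: d1.
    move=> ml m'l mm'; apply: (d2 (index m l) (index m' l)); rewrite ?index_mem// => im.
    by apply: mm'; rewrite -(nth_index m ml) -(nth_index m m'l) im.
  - move=> _ [[[l th] Th <-]|[[l m] lm <-]].
      exists ([:: l], th) => // x [/(_ l (mem_head _ _)) H _].
      by apply/sat_reindex; rewrite rE.
    exists ([:: l; m], Neg Fal) => // x [_ H] /=; rewrite sat_reindex rE.
    by apply: H; rewrite ?inE ?eqxx ?orbT.
  have Xx l : X (x \o at_ l).
    suff /EX[] : E (x \o at_ l) (x \o at_ l) by [].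
    apply: EPhi => th Th; rewrite /sem -rE; apply/sat_reindex; apply: xq; left.
    by exists (l, th).
  have xC l : classes X E (eclass E (x \o at_ l)) by exists (x \o at_ l).
  apply: (@small_not_power U (fun l => SigSub (mem_set (xC l)))) => l m [lm].
  apply: contrapT => nlm.
  have := xq (Neg (rename (reindex (r l m)) psi)); apply; first by right; exists (l, m).
  apply/sat_reindex; rewrite rE; apply: Psi.
  by have : eclass E (x \o at_ m) (x \o at_ m) := Er _ (Xx m); rewrite -lm.
pose r i j (v : J + J) := match v with inl x => (i, x) | inr x => (j, x) end : nat * J.
pose l1 := [seq rename (@reindex _ _ C (r i i)) theta | i <- iota 0 n].
pose l2 := [seq Neg (rename (@reindex _ _ C (r i.1 i.2)) psi) |
  i <- [seq p <- [seq (i, j) | i <- iota 0 n, j <- iota 0 n] | p.1 != p.2]].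
have semE (e : nat * J + C -> C) i j ph : formulas_over set0 ph ->
    sat e (rename (reindex (r i j)) ph) <->
    sem ph (fun x => e (inl (i, x))) (fun x => e (inl (j, x))).
  move=> ph0; rewrite sat_rename (sat_over0 _ ph0) /sem.
  by rewrite (_ : _ \o inl = tcat (fun x => e (inl (i, x))) (fun x => e (inl (j, x))))//;
    apply/funext => -[].
have th0 : formulas_over set0 theta by case: Theta.
have chainE (e : nat * J + C -> C) : sat e (Conj (l1 ++ l2)) <->
    chain n theta (fun i x => e (inl (i, x))).
  rewrite sat_Conj; split=> [H|[H H'] ph].
    split=> [i lt_in|i j lt_in lt_jn ij].
      apply/(semE e i i _ th0); apply: H; rewrite mem_cat; apply/orP; left.
      by apply/mapP; exists i; rewrite ?mem_iota.
    rewrite -(semE e i j _ psi0).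
    apply: (H (Neg (rename (reindex (r i j)) psi))); rewrite mem_cat; apply/orP; right.
    apply/mapP; exists (i, j) => //; rewrite mem_filter /=; apply/andP; split; first exact/eqP.
    by apply/allpairsP; exists (i, j); rewrite !mem_iota.
  rewrite mem_cat => /orP[/mapP[i]|/mapP[[i j]]].
    by rewrite mem_iota => /H ? ->; apply/semE.
  rewrite mem_filter => /andP[/= /eqP ij /allpairsP[[i' j'] [/= + + [? ?]]] ->]; subst i' j'.
  by rewrite !mem_iota => iln jln /= /(semE e i j _ psi0); exact: H'.
have [|e' e'N /chainE[d1 d2]] := model_realizes (phi := Conj (l1 ++ l2))
    (e := env (fun p => d p.1 p.2)) Nm.
  by apply/chainE.
pose d' i x := e' (inl (i, x)).
have thb : sem theta b b by case: Theta => _; apply; exact: Er.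
(* Otherwise [b], placed at index [n], would extend the chain beyond its maximal length [n]. *)
have [i lt_in ib] : exists2 i, (i < n)%N & sem psi (d' i) b.
  apply: contrapT => ni; apply: nd; exists (fun i => if (i < n)%N then d' i else b).
  split=> [i _|i j]; first by case: ifP => // lt_in; exact: d1.
  case: ifP => lt_in ltiS; case: ifP => lt_jn ltjS ij; first exact: d2.
  - by move=> ib; apply: ni; exists i.
  - by move=> /psis jb; apply: ni; exists j.
  - have eqn k : (k < n)%N = false -> (k < n.+1)%N -> k = n.
      move=> /negbT; rewrite -leqNgt ltnS => nk kn.
      by apply/eqP; rewrite eqn_leq nk kn.
    by case: ij; rewrite (eqn i)// (eqn j).
apply: (psit (d' i)) => //.
have := ib; rewrite /sem -(sat_aut s) => /(sat_over0 _ psi0).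
rewrite (_ : _ \o inl = tcat (d' i) (s \o b))//.
by apply/funext => -[x|x] //=; exact: sN (e'N _).
Qed.

End TypeDefinable.

(** * Borel and analytic sets *)

Section BorelSets.
Context {X : topologicalType}.
Implicit Types A B : set X.

Lemma borel_open A : open A -> borel A.
Proof. exact: sub_sigma_algebra. Qed.

Lemma borelC A : borel A -> borel (~` A).
Proof. by move=> /sigma_algebraCD; rewrite setTD. Qed.

Lemma borel_closed A : closed A -> borel A.
Proof. by move=> /closed_openC/borel_open/borelC; rewrite setCK. Qed.

Lemma borel_bigcup (F : nat -> set X) : (forall n, borel (F n)) -> borel (\bigcup_n F n).
Proof. exact: sigma_algebra_bigcup. Qed.

Lemma borelU A B : borel A -> borel B -> borel (A `|` B).
Proof.
by move=> bA bB; rewrite -bigcup2E; apply: borel_bigcup => -[|[|n]] //=; exact: sigma_algebra0.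
Qed.

Lemma borelI A B : borel A -> borel B -> borel (A `&` B).
Proof.
move=> bA bB; rewrite -(setCK (A `&` B)) setCI.
by apply: borelC; apply: borelU; exact: borelC.
Qed.

End BorelSets.

Lemma borel_measurable (X Y : topologicalType) (f : X -> Y) :
  (forall O, open O -> borel (f @^-1` O)) ->
  forall B, borel B -> borel (f @^-1` B).
Proof.
move=> fO B bB; apply: (bB [set A | borel (f @^-1` A)]); split; last exact: fO.
split=> [|A bA|F bF] /=.
- by rewrite preimage_set0; exact: sigma_algebra0.
- by rewrite setTD preimage_setC; exact: borelC.
- by rewrite preimage_bigcup; exact: borel_bigcup.
Qed.

Lemma continuous_borel (X Y : topologicalType) (f : X -> Y) B :
  continuous f -> borel B -> borel (f @^-1` B).
Proof.
move=> /continuousP fc; apply: borel_measurable => O /fc; exact: borel_open.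
Qed.

Lemma compact_decreasing (Z : topologicalType) (F : nat -> set Z) :
  compact [set: Z] -> (forall n, closed (F n)) -> (forall n, F n.+1 `<=` F n) ->
  (forall n, F n !=set0) -> \bigcap_n F n !=set0.
Proof.
move=> Zc Fc Fd /choice[u uF].
have Fle m n : (m <= n)%N -> F n `<=` F m.
  elim: n => [|n IH]; first by rewrite leqn0 => /eqP->.
  rewrite leq_eqVlt => /predU1P[->//|/IH]; exact: subset_trans (Fd n).
have [|z [_ uz]] := Zc (u @ \oo) _; first exact: filterT.
exists z => n _; apply: Fc => V Vz.
have := uz (F n) V _ Vz; rewrite /= => -[|x [? ?]]; last by exists x.
by exists n => // m /= /Fle; apply; exact: uF.
Qed.

Definition clopen_base (Z : topologicalType) (U : nat -> set Z) :=
  (forall n, clopen (U n)) /\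
  forall O z, open O -> O z -> exists2 n, U n z & U n `<=` O.

(* The value at [y] is the point of the fiber with lexicographically largest
   sequence of memberships in the clopen base. *)
Lemma borel_section (Z Y : topologicalType) (f : Z -> Y) (U : nat -> set Z) :
  compact [set: Z] -> clopen_base U -> [set: Z] !=set0 ->
  (forall F, closed F -> closed (f @` F)) ->
  (forall y, closed (f @^-1` [set y])) ->
  exists2 g : Y -> Z, {in range f, cancel g f} &
    forall B, borel B -> borel (g @^-1` B).
Proof.
move=> Zc [Uc Ub] [z0 _] fcl fib.
pose step n (F : set Z) := if pselect (F `&` U n !=set0) then F `&` U n else F.
(* Off the range of [f] the search starts from all of [Z], which makes [g] total. *)
pose F y := fix F n : set Z := if n is n'.+1 then step n' (F n')
  else [set z | range f y -> f z = y].
have FS y n : F y n.+1 = step n (F y n) by [].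
have Fcl y n : closed (F y n).
  elim: n => [|n IH].
    have [yf|yf] := pselect (range f y).
      rewrite (_ : F y 0 = f @^-1` [set y]); first exact: fib.
      by apply/seteqP; split=> z /=; [apply|move=> ->].
    rewrite (_ : F y 0 = setT); first exact: closedT.
    by apply/seteqP; split=> z //=.
  rewrite FS /step; case: pselect => // ?; apply: closedI => //; exact: (Uc n).2.
have Fd y n : F y n.+1 `<=` F y n by rewrite FS /step; case: pselect => [? z []|?].
have Fne y n : F y n !=set0.
  elim: n => [|n IH]; last by rewrite FS /step; case: pselect.
  have [[z _ zy]|yf] := pselect (range f y); first by exists z.
  by exists z0.
have /choice[g gF] : forall y, (\bigcap_n F y n) !=set0.
  by move=> y; apply: compact_decreasing.
have gU y n : U n (g y) <-> F y n `&` U n !=set0.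
  split=> [Ug|FU]; first by exists (g y); split=> //; exact: gF.
  by have := gF y n.+1 I; rewrite FS /step; case: pselect => [? []|].
(* All clopen [W] are treated at once because the decision at stage [n] may replace [W] by its
   intersection with [U n]. For [W = U n] the set is the preimage of [U n] under [g]. *)
have bF n W : clopen W -> borel [set y | F y n `&` W !=set0].
  elim: n W => [|n IH] W Wc.
    rewrite (_ : [set y | _] = f @` W `|` (~` range f `&` [set _ | W !=set0])).
      apply: borelU; first by apply: borel_closed; apply: fcl; case: Wc.
      apply: borelI; first by apply: borelC; apply: borel_closed; apply: fcl; exact: closedT.
      have [W0|W0] := pselect (W !=set0).
        by rewrite (_ : [set _ | _] = setT);
          [apply: borel_open; exact: openT|apply/seteqP; split].
      by rewrite (_ : [set _ | _] = set0);
          [apply: borel_open; exact: open0|apply/seteqP; split].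
    apply/seteqP; split=> y /=.
      move=> [z [/= zy Wz]]; have [/zy <-|yf] := pselect (range f y); first by left; exists z.
      by right; split=> //; exists z.
    by move=> [[z Wz <-]|[yf [z Wz]]]; exists z; split.
  rewrite (_ : [set y | _] =
    ([set y | F y n `&` U n !=set0] `&` [set y | F y n `&` (U n `&` W) !=set0]) `|`
    (~` [set y | F y n `&` U n !=set0] `&` [set y | F y n `&` W !=set0])).
    have bU := IH (U n) (Uc n).
    apply: borelU; apply: borelI => //; last exact: IH.
      by apply: (IH (U n `&` W)); exact: clopenI.
    exact: borelC.
  apply/seteqP; split=> y; rewrite /mkset FS /step; case: pselect => H /=.
  - by rewrite -setIA => ?; left.
  - by move=> ?; right.
  - by rewrite -setIA => -[[]|[]].
  - by move=> [[]|[]].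
exists g => [y /set_mem yf|]; first by exact: (gF y 0 I yf).
apply: borel_measurable => O oO.
rewrite (_ : g @^-1` O = \bigcup_n [set y | U n `<=` O /\ U n (g y)]).
  apply: borel_bigcup => n; have [UO|nUO] := pselect (U n `<=` O).
    rewrite (_ : [set y | _] = [set y | F y n `&` U n !=set0]); first exact: bF.
    by apply/seteqP; split=> y /=; [move=> [_ /gU]|move=> /gU].
  by rewrite (_ : [set y | _] = set0);
    [apply: borel_open; exact: open0|apply/seteqP; split=> y // -[]].
apply/seteqP; split=> y /=; last by move=> [n _ [UO /UO]].
by move=> /(Ub _ _ oO)[n Ung UO]; exists n.
Qed.

(** Distinct fibers are disjoint closed sets, which normality of [Z] separates. As [f] is a closed
    map, the points whose whole fiber lies in a given open set form an open set; two such sets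
    separate [x] from [y]. *)
Lemma quotient_hausdorff (Z Y : topologicalType) (f : Z -> Y) :
  compact [set: Z] -> hausdorff_space Z -> continuous f ->
  (forall F, closed F -> closed (f @` F)) -> range f = setT -> hausdorff_space Y.
Proof.
move=> Zc ZH fc fcl fsurj; rewrite open_hausdorff => x y xy.
have pt w : closed (f @^-1` [set w]).
  have [z _ <-] : range f w by rewrite fsurj.
  apply: preimage_closed => //.
  rewrite -image_set1; apply: fcl; exact: accessible_closed_set1 (hausdorff_accessible ZH) z.
have Zn := compact_normal ZH Zc.
have [|V /set_nbhsP[W [oW fxW WV]] clV] := Zn (f @^-1` [set x]) (pt x) (~` (f @^-1` [set y])).
  by move=> z /= zx; apply: open_nbhs_nbhs; split;
    [exact: closed_openC|move=> zy; move: xy; rewrite -zx -zy eqxx].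
have oA O : open O -> open (~` (f @` (~` O))).
  by move=> oO; apply/closed_openC/fcl/open_closedC.
exists (~` (f @` (~` W)), ~` (f @` closure V)) => /=.
  split; apply/mem_set => -[z zW zE]; first by apply: zW; exact: fxW.
  by apply: (clV z).
split; [exact: oA|by apply/closed_openC/fcl; exact: closed_closure|].
apply/eqP/seteqP; split=> // w [/= wW wV].
have [z _ zw] : range f w by rewrite fsurj.
have [Wz|nWz] := pselect (W z); last by apply: wW; exists z.
by apply: wV; exists z => //; apply: subset_closure; exact: WV.
Qed.

(** * The Baire space and analytic sets *)

Definition cylinder (w : nat -> nat) (n : nat) : set (nat -> nat) :=
  [set v | forall i, (i < n)%N -> v i = w i].

Lemma cylinder_sub w m n : (m <= n)%N -> cylinder w n `<=` cylinder w m.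
Proof. by move=> mn v vw i im; apply: vw; exact: leq_trans mn. Qed.

Lemma cylinder_eq w v n m : cylinder w n v -> (m <= n)%N -> cylinder v m = cylinder w m.
Proof.
move=> vw mn; apply/seteqP; split=> u uv i im; rewrite uv//.
  by apply: vw; exact: leq_trans mn.
by apply/esym/vw; exact: leq_trans mn.
Qed.

Lemma baire_nbhsP (w : baire_space) (U : set baire_space) :
  nbhs w U <-> exists n, cylinder w n `<=` U.
Proof.
split=> [wU|[n]].
  pose F := filter_from [set: nat] (cylinder w).
  have FF : Filter F.
    apply: filter_from_filter; first by exists 0%N.
    move=> i j _ _; exists (maxn i j) => // v vw.
    by split; apply: cylinder_sub vw; [exact: leq_maxl|exact: leq_maxr].
  (* The filter generated by the cylinders converges to [w] in every coordinate, hence it refines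
     the neighbourhood filter of the pointwise topology. *)
  have /pointwise_cvgP Fw : forall t : nat, (fun g : baire_space => g t) @ F --> w t.
    move=> t B /nbhs_singleton Bwt; exists t.+1 => // v vw /=.
    by rewrite vw.
  by have [n _ nU] := Fw U wU; exists n.
move=> nU; apply: filterS nU _.
have /pointwise_cvgP ev : {ptws, nbhs w --> w} by [].
elim: n => [|n IH]; first exact: filterS filterT.
have wn : nbhs w [set v : baire_space | v n = w n].
  by apply: (ev n [set w n]); exact: discrete_set1.
apply: filterS (filterI IH wn) => v [vw vn] i.
by rewrite ltnS leq_eqVlt => /predU1P[->//|]; exact: vw.
Qed.

Lemma baire_continuousP (Z : topologicalType) (h : baire_space -> Z) :
  continuous h <-> forall w O, open O -> O (h w) ->
    exists n, cylinder w n `<=` h @^-1` O.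
Proof.
split=> [hc w O oO Ow|H w O]; first by apply/baire_nbhsP/hc; exact: open_nbhs_nbhs.
rewrite nbhsE => -[B [oB Bw] BO]; apply/baire_nbhsP.
by have [n nB] := H w B oB Bw; exists n => v /nB /BO.
Qed.

(* A nonempty closed subset [P] of the Baire space is a retract: a point off
   [P] is sent to a point of [P] sharing its longest prefix extendible in [P]. *)
Lemma analytic_closed_image (Z : topologicalType) (P : set (nat -> nat))
    (h : (nat -> nat) -> Z) :
  (forall w, ~ P w -> exists n, forall v, cylinder w n v -> ~ P v) ->
  (forall w O, P w -> open O -> O (h w) ->
    exists n, forall v, P v -> cylinder w n v -> O (h v)) ->
  analytic (h @` P).
Proof.
move=> Pcl hc; have [[p0 Pp0]|P0] := pselect (P !=set0); last first.
  by left; rewrite (_ : P = set0) ?image_set0//; apply/nonemptyPn.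
right; pose dead w n := forall v, cylinder w n v -> ~ P v.
pose S (w : nat -> nat) := [set u | P u /\ exists2 n, cylinder w n u & dead w n.+1].
have Sne w : ~ P w -> S w !=set0.
  move=> /Pcl[n]; elim: n => [|n IH] wn; first by case: (wn p0).
  have [|] := pselect (dead w n); first exact: IH.
  move=> /existsNP[u /not_implyP[wu /contrapT Pu]].
  by exists u; split=> //; exists n.
have Seq w v n : dead w n -> cylinder w n v -> S v = S w.
  move=> wn wv; apply/seteqP; split=> u [Pu [k uk vk]]; split=> //.
    have kn : (k < n)%N.
      rewrite ltnNge; apply/negP => nk; apply: (wn u) => //.
      by rewrite -(cylinder_eq wv (leqnn n)); exact: cylinder_sub uk.
    exists k; first by rewrite -(cylinder_eq wv (ltnW kn)).
    by move=> x; rewrite -(cylinder_eq wv kn); exact: vk.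
  have kn : (k < n)%N.
    rewrite ltnNge; apply/negP => nk; apply: (wn u) => //.
    exact: cylinder_sub uk.
  exists k; first by rewrite (cylinder_eq wv (ltnW kn)).
  by move=> x; rewrite (cylinder_eq wv kn); exact: vk.
(* The choice depends on [w] only through the set [S w], which is constant on a cylinder disjoint
   from [P]. So [rho] is locally constant off [P]. *)
pose rho (w : nat -> nat) : nat -> nat := if pselect (P w) then w else xget p0 (S w).
have rhoP w : P w -> rho w = w by move=> Pw; rewrite /rho; case: pselect => /= [|/(_ Pw)].
have rhoS w : ~ P w -> S w (rho w).
  move=> nPw; have := xgetPex p0 (Sne w nPw); rewrite /rho.
  by case: pselect => // /nPw.
have rhoeq w v : ~ P w -> ~ P v -> S v = S w -> rho v = rho w.
  by move=> nPw nPv SE; rewrite /rho SE; case: pselect => /= [/nPv//|_]; case: pselect => /= [/nPw|].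
exists (h \o rho).
  apply/baire_continuousP => w O oO /= Ow.
  have [Pw|nPw] := pselect (P w).
    have [n hn] := hc w O Pw oO (eq_rect _ (fun x => O (h x)) Ow _ (rhoP w Pw)).
    exists n => v wv /=; have [Pv|nPv] := pselect (P v).
      by rewrite rhoP//; exact: hn.
    (* [w] is in [P] and shares [n] entries with [v], so the longest prefix of [v] extendible in [P]
       has length at least [n], and [rho v] stays in the cylinder of [w]. *)
    have [Prv [k rvk vk]] := rhoS v nPv; apply: hn => //.
    rewrite -(cylinder_eq wv (leqnn n)); apply: cylinder_sub rvk.
    rewrite leqNgt; apply/negP => kn; apply: (vk w) => // i ik.
    by apply/esym/wv; exact: leq_trans kn.
  have [n wn] := Pcl w nPw; exists n => v wv /=.
  by rewrite (rhoeq w v)//; [exact: wn|exact: Seq wv].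
apply/seteqP; split=> [_ [w _ <-] /=|_ [w Pw <-]].
  have [Pw|/rhoS[Prw _]] := pselect (P w); first by rewrite rhoP//; exists w.
  by exists (rho w).
by exists w => //=; rewrite rhoP.
Qed.

Lemma analytic_image (X Y : topologicalType) (f : X -> Y) (A : set X) :
  continuous f -> analytic A -> analytic (f @` A).
Proof.
move=> fc [->|[g gc <-]]; first by left; rewrite image_set0.
right; exists (f \o g); first by move=> x; apply: continuous_comp; [exact: gc|exact: fc].
by rewrite image_comp.
Qed.

(* The fiber product of [f] and [g : baire_space -> Y] is coded by a closed
   subset of the Baire space: the even entries of a code are the memberships of
   the point of [Z] in the clopen base, its odd entries the point of the Baire
   space. *)
Lemma analytic_preimage (Z Y : topologicalType) (f : Z -> Y) (U : nat -> set Z)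
    (A : set Y) :
  compact [set: Z] -> hausdorff_space Z -> clopen_base U -> hausdorff_space Y ->
  continuous f -> analytic A -> analytic (f @^-1` A).
Proof.
move=> Zc ZH [Uc Ub] YH fc [->|[g gc <-]]; first by left; rewrite preimage_set0.
have [[z0 _]|Z0] := pselect ([set: Z] !=set0); last first.
  by left; apply/seteqP; split=> z // _; apply: Z0; exists z.
pose code (w : nat -> nat) z := forall n, w n.*2 = `[< U n z >] :> nat.
pose odds (w : nat -> nat) : baire_space := fun n => w n.*2.+1.
pose good w z := code w z /\ f z = g (odds w).
pose P := [set w | exists z, good w z].
have code_inj w z z' : code w z -> code w z' -> z = z'.
  move=> wz wz'; apply/eqP/negPn/negP => zz'.
  move: ZH; rewrite open_hausdorff => /(_ z z' zz')[[V V'] /= [/set_mem Vz /set_mem Vz']].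
  move=> [oV _ /eqP/seteqP[VV' _]]; have [n Unz UV] := Ub V z oV Vz.
  have : U n z' by apply/asboolP; have := wz' n; rewrite (wz n) (asboolT Unz); case: asboolP.
  by move=> /UV Vz''; exact: (VV' z').
pose h w := if pselect (P w) is left H then projT1 (cid H) else z0.
have hP w : P w -> good w (h w) by rewrite /h; case: pselect => // H _; case: (cid H).
rewrite (_ : _ @^-1` _ = h @` P); last first.
  apply/seteqP; split=> [z [v _ /= vz]|_ [w /hP[_ hw] <-]]; last by exists (odds w).
  pose w n := if odd n then v n./2 else `[< U n./2 z >] : nat.
  have wz : good w z.
    split=> [n|]; first by rewrite /w odd_double half_double.
    rewrite -vz; congr g; apply/funext => n.
    by rewrite /odds /w /= odd_double /= uphalf_double.
  have Pw : P w by exists z.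
  by exists w => //; have [hw _] := hP w Pw; case: wz => wz _; exact: code_inj hw wz.
apply: analytic_closed_image => [w nPw|w O Pw oO Ohw].
  (* If every prefix of [w] extended to a code, the points compatible with its even entries would
     form nonempty decreasing closed sets, and compactness would give a [z] coded by [w]. Were [f z]
     different from [g (odds w)], a code close enough to [w] would violate disjoint neighbourhoods
     of the two. *)
  apply: contrapT => /forallNP alive.
  have {}alive n : exists p z, cylinder w n p /\ good p z.
    apply: contrapT => H; apply: (alive n) => p wp [z pz].
    by apply: H; exists p, z.
  pose F n := [set z | forall i, (i < n)%N -> w i.*2 = `[< U i z >] :> nat].
  have [||n|z zF] := @compact_decreasing Z F Zc.
  - elim=> [|n IH]; first by rewrite (_ : F 0%N = setT)//; apply/seteqP; split.
    rewrite (_ : F n.+1 = F n `&` [set z | w n.*2 = `[< U n z >] :> nat]).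
      apply: closedI => //; have [oU cU] := Uc n.
      case: (w n.*2) => [|[|k]].
      + rewrite (_ : [set z | _] = ~` U n); first exact: open_closedC.
        by apply/seteqP; split=> z /=; case: asboolP.
      + rewrite (_ : [set z | _] = U n)//.
        by apply/seteqP; split=> z /=; case: asboolP.
      + rewrite (_ : [set z | _] = set0); first exact: closed0.
        by apply/seteqP; split=> z //=; case: asboolP.
    apply/seteqP; split=> z.
      by move=> zF; split=> [i il|]; apply: zF; rewrite ?ltnS// ltnW.
    by move=> [zF zn] i; rewrite ltnS leq_eqVlt => /predU1P[->//|]; exact: zF.
  - by move=> n z zF i il; apply: zF; exact: ltnW.
  - have [p [z [wp [pz _]]]] := alive n.*2; exists z => i il.
    by rewrite -pz wp// ltn_double.
  have zw : code w z by move=> n; exact: (zF n.+1 I).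
  have /eqP fg : f z <> g (odds w) by move=> fg; apply: nPw; exists z.
  move: YH; rewrite open_hausdorff => /(_ _ _ fg)[[V V'] /= [/set_mem Vz /set_mem Vg]].
  move=> [oV oV' /eqP/seteqP[VV' _]].
  have [k Ukz UV] : exists2 k, U k z & U k `<=` f @^-1` V.
    by apply: Ub => //; exact: open_comp.
  have [m mV] := (baire_continuousP g).1 gc (odds w) V' oV' Vg.
  (* The common prefix must contain entry [k.*2], the membership in [U k], and the odd entries
     [i.*2.+1] for [i < m]. *)
  have [p [z' [wp [pz' fz']]]] := alive (maxn k.*2.+1 m.*2).
  apply: (VV' (f z')); split.
    apply: UV; apply/asboolP; have := pz' k.
    by rewrite wp ?leq_max ?leqnn// zw (asboolT Ukz); case: asboolP.
  rewrite fz'; apply: mV => i im; rewrite /odds wp//.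
  by rewrite leq_max -doubleS leq_double im orbT.
have [k Uk UO] := Ub O (h w) oO Ohw.
exists k.*2.+1 => v /hP[vz _] wv; apply: UO; apply/asboolP.
have [wz _] := hP w Pw.
by have := vz k; rewrite wv// wz (asboolT Uk); case: asboolP.
Qed.

(** * Countable languages *)

Section Coding.
Local Open Scope card_scope.
Context {L : language}.
Variables (cf : {n & Defs.fsym L n} -> nat) (cr : {n & Defs.rsym L n} -> nat).
Hypotheses (cfI : injective cf) (crI : injective cr).

Fixpoint term_code V (e : V -> nat) (t : term L V) : GenTree.tree nat :=
  match t with
  | Var v => GenTree.Leaf (e v)
  | App n f ts => GenTree.Node (cf (existT _ n f))
      [seq term_code e (ts i) | i <- enum 'I_n]
  end.

(** Under [All] the bound variable is numbered 0 and the others move up by one, which keeps an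
    injective numbering injective. *)
Fixpoint formula_code V (e : V -> nat) (phi : formula L V) : GenTree.tree nat :=
  match phi with
  | Eq t u => GenTree.Node 0 [:: term_code e t; term_code e u]
  | Rel n R ts => GenTree.Node 1 (GenTree.Leaf (cr (existT _ n R)) ::
      [seq term_code e (ts i) | i <- enum 'I_n])
  | Fal => GenTree.Node 2 [::]
  | Imp phi psi => GenTree.Node 3 [:: formula_code e phi; formula_code e psi]
  | All phi => GenTree.Node 4 [:: formula_code (oapp (fun v => (e v).+1) 0) phi]
  end.


Lemma term_code_inj V (P : set V) (e : V -> nat) (t u : term L V) :
  (forall v w, P v -> P w -> e v = e w -> v = w) ->
  term_in P t -> term_in P u -> term_code e t = term_code e u -> t = u.
Proof.
move=> eI; elim: t u => [v|n f ts IH] [w|m g us] //= Pt Pu.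
  by move=> [/eI->].
move=> [/cfI fg tu].
suff H (s s' : {n & Defs.fsym L n}) (ts' : 'I_(projT1 s) -> term L V) us' : s = s' ->
    [seq term_code e (ts' i) | i <- enum 'I_(projT1 s)] =
    [seq term_code e (us' i) | i <- enum 'I_(projT1 s')] ->
    (forall i u, term_in P u -> term_code e (ts' i) = term_code e u -> ts' i = u) ->
    (forall i, term_in P (us' i)) -> App (projT2 s) ts' = App (projT2 s') us'.
  by apply: (H (existT _ n f) (existT _ m g)) => // i u' Pu' tu'; exact: IH.
move=> ss'; case: _ / ss' us' => us' /eq_in_map tu' IH' Pu'.
by congr App; apply/funext => i; apply: IH' => //; apply: tu'; rewrite mem_enum.
Qed.

(** Injectivity is relative to [P] because the parameters come from [C], which may be uncountable;
    only a countable set of them is numbered. *)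
Lemma formula_code_inj V (P : set V) (e : V -> nat) (phi psi : formula L V) :
  (forall v w, P v -> P w -> e v = e w -> v = w) ->
  formula_in P phi -> formula_in P psi ->
  formula_code e phi = formula_code e psi -> phi = psi.
Proof.
elim: phi P e psi => {V} [V t u|V n R ts|V|V phi IH psi IH'|V phi IH] P e
  [t' u'|m R' us||phi' psi'|phi'] //= eI.
- move=> [p1 p2] [q1 q2] [e1 e2].
  by rewrite (term_code_inj eI p1 q1 e1) (term_code_inj eI p2 q2 e2).
- move=> Pt Pu [/crI RR' tu].
  suff H (s s' : {n & Defs.rsym L n}) (ts' : 'I_(projT1 s) -> term L V) us' : s = s' ->
      [seq term_code e (ts' i) | i <- enum 'I_(projT1 s)] =
      [seq term_code e (us' i) | i <- enum 'I_(projT1 s')] ->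
      (forall i, term_in P (ts' i)) ->
      (forall i, term_in P (us' i)) -> Rel (projT2 s) ts' = Rel (projT2 s') us'.
    exact: (H (existT _ n R) (existT _ m R')).
  move=> ss'; case: _ / ss' us' => us' /eq_in_map tu' Pt' Pu'.
  congr Rel; apply/funext => i; apply: (term_code_inj eI) => //.
  by apply: tu'; rewrite mem_enum.
- move=> [p1 p2] [q1 q2] [e1 e2].
  by rewrite (IH _ _ _ eI p1 q1 e1) (IH' _ _ _ eI p2 q2 e2).
- move=> Pphi Ppsi [/IH H]; congr All; apply: H Pphi Ppsi.
  by move=> [v|] [w|] //= Pv Pw [/eI->].
Qed.

End Coding.

Section Countability.
Local Open Scope card_scope.
Context {L : language}.
Hypothesis L_countable : countable_language L.

Lemma countable_formula_in V (P : set V) :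
  countable P -> countable [set phi : formula L V | formula_in P phi].
Proof.
move=> /countable_injP[e eI]; case: L_countable => /countable_injP[cf cfI] /countable_injP[cr crI].
have {}cfI : injective cf by move=> x y; apply: cfI; rewrite in_setT.
have {}crI : injective cr by move=> x y; apply: crI; rewrite in_setT.
have eI' v w : P v -> P w -> e v = e w -> v = w.
  by move=> Pv Pw; apply: eI; exact/mem_set.
apply: card_le_trans (countableP (@setT (GenTree.tree nat))).
apply: (@card_le_inj _ _ _ _ (formula_code cf cr e)) => // phi psi /set_mem Pp /set_mem Pq.
exact: (formula_code_inj cfI crI eI').
Qed.

Lemma countable_sum U V (A : set U) (B : set V) : countable A -> countable B ->
  countable [set w | match w with inl x => A x | inr y => B y end].
Proof.
move=> /countable_injP[f fI] /countable_injP[g gI].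
apply: card_le_trans (countableP (@setT (nat + nat))).
apply: (@card_le_inj _ _ _ _ (fun w => match w with inl x => inl (f x) | inr y => inr (g y) end)) => //.
by move=> [x|x] [y|y] /set_mem Ax /set_mem Ay //= [];
  [move=> /fI->|move=> /gI->]; rewrite ?inE.
Qed.

Lemma countable_formulas_over (C : structure L) I (A : set C) :
  countable [set: I] -> countable A -> countable (@formulas_over L C I A).
Proof.
move=> cI cA; apply: countable_formula_in.
apply: sub_countable (countable_sum cI cA); apply: subset_card_le.
by move=> [i|c].
Qed.

(** Finite trees serve as Skolem terms: leaves enumerate [A], and a node applies the witness
    function of a formula to the values of its subtrees. There are countably many trees, and their
    values pass the Tarski-Vaught test. *)
Lemma loewenheim_skolem (C : structure L) (A : set C) : countable A ->
  exists N : set C, [/\ countable N, elementary_submodel N & A `<=` N].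
Proof.
move=> cA; have [c0] := carrier_inhabited C.
have [en enA] : exists en : nat -> C, A `<=` range en.
  move: cA => /countable_injP[f fI].
  exists (fun n => if pselect (exists2 x, A x & f x = n) is left H
    then projT1 (cid2 H) else c0) => x Ax.
  exists (f x) => //; case: pselect => [H|[]]; last by exists x.
  by case: (cid2 H) => y /= Ay /fI->//; rewrite inE.
have [dec decE] : exists dec : nat -> formula L (option nat), forall phi, exists n, dec n = phi.
  have : countable [set phi : formula L (option nat) | formula_in setT phi].
    exact/countable_formula_in/countableP.
  move=> /countable_injP[f fI].
  exists (fun n => if pselect (exists phi, f phi = n) is left H
    then projT1 (cid H) else Fal) => phi.
  have inT V (psi : formula L V) : formula_in setT psi.
    by have [P _ PP] := formula_support psi; apply: formula_in_sub PP.
  exists (f phi); case: pselect => [H|[]]; last by exists phi.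
  by case: (cid H) => psi /= /fI->//; rewrite inE; exact: inT.
pose wit (phi : formula L (option nat)) (e : nat -> C) : C :=
  if pselect (exists x, sat (fun o => oapp e x o) phi) is left H then projT1 (cid H) else c0.
pose ev := fix ev (t : GenTree.tree nat) : C := match t with
  | GenTree.Leaf n => en n
  | GenTree.Node n ts => wit (dec n) (nth c0 (map ev ts)) end.
pose N := range ev.
have witN phi (l : seq C) : (forall i, (i < size l)%N -> N (nth c0 l i)) ->
    N (wit phi (nth c0 l)).
  move=> lN; have [n <-] := decE phi.
  suff [ts <-] : exists ts, map ev ts = l by exists (GenTree.Node n ts).
  elim: l lN => [|x l IH] lN; first by exists [::].
  have [t _ tx] := lN 0%N isT.
  have [|ts tsl] := IH; first by move=> i il; exact: (lN i.+1).
  by exists (t :: ts); rewrite /= tsl tx.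
have tarski_vaught V (e : V -> C) (phi : formula L (option V)) : (forall v, N (e v)) ->
    (exists x, sat (fun o => oapp e x o) phi) ->
    exists2 x, N x & sat (fun o => oapp e x o) phi.
  move=> eN ex; have [P fP Pphi] := formula_support phi.
  have /(@finite_seqP {classic V})[vs vsE] : finite_set (Some @^-1` P).
    by apply: finite_preimage fP => x y _ _ [].
  have vsP v : P (Some v) -> v \in vs.
    by move=> Pv; have : (Some @^-1` P) v by []; rewrite vsE.
  pose env := nth c0 (map e (vs : seq V)).
  (* Only the finitely many variables in [vs] matter. Replacing each by its position turns the
     assignment into a list of values in [N], to which [wit] applies. *)
  pose phi' := rename (omap (fun v : V => index (v : {classic V}) vs)) phi.
  have phiE x : sat (fun o => oapp env x o) phi' <-> sat (fun o => oapp e x o) phi.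
    rewrite sat_rename; apply: (sat_in (P := P)) Pphi => -[v Pv|//] /=.
    rewrite /env (nth_map v) ?index_mem ?vsP//.
    by rewrite (@nth_index {classic V} v v vs (vsP v Pv)).
  exists (wit phi' env).
    by apply: witN => i; rewrite size_map => il; case: vs il {vsE vsP env phi' phiE} => // v vs il;
      rewrite (nth_map v).
  apply/phiE; rewrite /wit; case: pselect => [H|[]]; first by case: (cid H).
  by have [x /phiE ?] := ex; exists x.
have funN n (f : Defs.fsym L n) (x : 'I_n -> N) : exists y : N, val y = finterp f (val \o x).
  have [||y Ny yE] := tarski_vaught 'I_n (val \o x) (Eq (Var L None) (App f (fun i => Var L (Some i)))).
  - by move=> i; apply/set_mem; exact: valP.
  - by exists (finterp f (val \o x)).
  - by exists (SigSub (mem_set Ny)).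
pose N0 := @Structure L N (fun n f x => projT1 (cid (funN n f x)))
  (fun n R x => rinterp R (val \o x)) (inhabits (SigSub (mem_set (imageT ev (GenTree.Leaf 0%N))))).
pose j : N0 -> C := fun x : N => val x.
have evalE V (e : V -> N0) t : j (Defs.eval e t) = Defs.eval (j \o e) t.
  elim: t => //= n f ts IH; rewrite /j; case: cid => y /= ->; congr finterp.
  by apply/funext => i /=; exact: IH.
have satE V (phi : formula L V) (e : V -> N0) : sat e phi <-> sat (j \o e) phi.
  elim: phi e => {V} [V t u|V n R ts|V|V phi IH psi IH'|V phi IH] e /=.
  - by rewrite -!evalE; split=> [->//|/val_inj].
  - rewrite (_ : _ \o _ = fun i => Defs.eval (j \o e) (ts i))//.
    by apply/funext => i; exact: evalE.
  - by [].
  - by rewrite IH IH'.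
  - have oE (x : N0) : j \o (fun o => oapp e x o) = fun o => oapp (j \o e) (j x) o.
      by apply/funext => -[].
    split=> H x; last by apply/IH; rewrite oE.
    apply: contrapT => nphi.
    have [||y Ny /=] := tarski_vaught V (j \o e) (Neg phi).
    + by move=> v; apply/set_mem; exact: valP.
    + by exists x.
    + by apply; have /IH := H (SigSub (mem_set Ny)); rewrite oE.
exists N; split.
- by apply: card_le_trans (card_image_le _ _) _; exact: countableP.
- exists N0, j; split=> [phi|]; first by rewrite satE.
  apply/seteqP; split=> [_ [x _ <-]|x Nx]; first by apply/set_mem; exact: valP.
  by exists (SigSub (mem_set Nx)).
- by move=> x /enA[n _ <-]; exists (GenTree.Leaf n).
Qed.

End Countability.

(** * Spaces of types *)

Section TypeSpaces.
Context {L : language} {C : structure L} {I : Type} {A : set C}.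
Implicit Types q : ctype I A.

Lemma ctype_over q phi : ctype_set q phi -> formulas_over A phi.
Proof. by case: q => q qA fs tot /= /qA. Qed.

Lemma ctype_fs q : finitely_satisfiable (ctype_set q).
Proof. by case: q. Qed.

(** Complete types are maximal finitely satisfiable sets, so inclusion already forces equality. *)
Lemma ctype_ext q q' : (forall phi, ctype_set q phi -> ctype_set q' phi) -> q = q'.
Proof.
move=> qq'; have E : ctype_set q = ctype_set q'.
  apply/seteqP; split=> // phi q'phi.
  case: q qq' => q qA fs tot /= qq'; have [//|/qq' nphi] := tot _ (ctype_over q'phi).
  have [|b b_phi] := @ctype_fs q' [set phi; Neg phi] (finite_set2 _ _).
    by move=> _ [->|->].
  by have := b_phi _ (or_intror erefl); case; apply: b_phi; left.
case: q q' E {qq'} => q qA fs tot [q' qA' fs' tot'] /= E.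
by case: _ / E in qA' fs' tot' *; congr CType; exact: Prop_irrelevance.
Qed.

Lemma ctype_deduce q (l : seq (formula L (I + C))) phi : formulas_over A phi ->
  (forall psi, psi \in l -> ctype_set q psi) ->
  (forall b, (forall psi, psi \in l -> sat (env b) psi) -> sat (env b) phi) ->
  ctype_set q phi.
Proof.
move=> phiA lq H; have [//|nphi] : ctype_set q phi \/ ctype_set q (Neg phi).
  by case: q lq => q ? ? tot /= _; exact: tot.
have [||b bl] := @ctype_fs q [set` Neg phi :: l]; first exact: finite_seq.
  by move=> psi /=; rewrite inE => /predU1P[->//|]; exact: lq.
have := bl (Neg phi) (mem_head _ _); case; apply: H => psi psil.
by apply: bl; rewrite /= inE psil orbT.
Qed.

Lemma ctype_Neg q phi : formulas_over A phi ->
  ctype_set q (Neg phi) <-> ~ ctype_set q phi.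
Proof.
move=> phiA; split=> [nphi qphi|nphi].
  have [|b bl] := @ctype_fs q [set phi; Neg phi] (finite_set2 _ _).
    by move=> _ [->|->].
  by have := bl _ (or_intror erefl); case; apply: bl; left.
by case: q nphi => q ? ? tot /= nphi; have [] := tot phi phiA.
Qed.

Lemma ctype_open phi : open [set q : ctype I A | ctype_set q phi].
Proof.
exists [set [set q : ctype I A | ctype_set q phi]] => [_ ->|]; last by rewrite bigcup_set1.
exists [fset phi]%fset; first by move=> psi _; rewrite in_setT.
apply/seteqP; split=> q /=; first by apply; rewrite /= inE.
by move=> qphi psi /=; rewrite inE => /eqP ->.
Qed.

Lemma ctype_clopen phi : clopen [set q : ctype I A | ctype_set q phi].
Proof.
split; first exact: ctype_open.
have [phiA|nphiA] := pselect (formulas_over A phi).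
  rewrite (_ : [set q : ctype I A | _] = ~` [set q : ctype I A | ctype_set q (Neg phi)]).
    exact/open_closedC/ctype_open.
  by apply/seteqP; split=> q /=; rewrite ctype_Neg//; [move=> ? ?|move=> /contrapT].
rewrite (_ : [set q : ctype I A | _] = set0); first exact: closed0.
by apply/seteqP; split=> q // /ctype_over.
Qed.

Lemma ctype_base (O : set (ctype I A)) q : open O -> O q ->
  exists2 phi, formulas_over A phi & ctype_set q phi /\ [set q : ctype I A | ctype_set q phi] `<=` O.
Proof.
move=> [D DI <-] [B DB Bq]; have [F _ FE] := DI _ DB.
have Fq phi : phi \in F -> ctype_set q phi.
  exact: (eq_ind_r (fun X : set (ctype I A) => X q) Bq FE phi).
have FA : formulas_over A (Conj F).
  by apply: formulas_over_Conj => phi /Fq; exact: ctype_over.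
exists (Conj F) => //; split.
  by apply: (ctype_deduce FA Fq) => b /sat_Conj.
move=> q' q'F; exists B => //.
apply: (eq_ind _ (fun X : set (ctype I A) => X q') _ _ FE) => phi phiF.
have phiq := Fq _ phiF; apply: (@ctype_deduce _ [:: Conj F]); first exact: ctype_over phiq.
  by move=> psi; rewrite inE => /eqP ->.
by move=> b /(_ _ (mem_head _ _)) /sat_Conj; apply.
Qed.

Lemma ctype_hausdorff : hausdorff_space (ctype I A).
Proof.
rewrite open_hausdorff => q q' qq'.
have [phi [qphi nphi]] : exists phi, ctype_set q phi /\ ~ ctype_set q' phi.
  apply: contrapT => /forallNP H; move: qq'; apply/negP/negPn/eqP/ctype_ext => phi qphi.
  by apply: contrapT => nphi; exact: H (conj qphi nphi).
exists ([set q : ctype I A | ctype_set q phi], [set q : ctype I A | ctype_set q (Neg phi)]) => /=.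
  by split; apply/mem_set => //=; apply/(ctype_Neg _ (ctype_over qphi)).
split; [exact: ctype_open|exact: ctype_open|apply/eqP/seteqP; split=> // x [/= xp]].
by move=> /(ctype_Neg _ (ctype_over qphi)).
Qed.

(** An ultrafilter on types converges to the set of formulas contained in almost every type. The
    ultrafilter property makes this set complete, and any finite part of it lies in a single
    type. *)
Lemma ctype_compact : compact [set: ctype I A].
Proof.
rewrite compact_ultra => F FU _.
pose S : set (formula L (I + C)) := [set phi | F [set q : ctype I A | ctype_set q phi]].
have SA : S `<=` formulas_over A.
  by move=> phi Sphi; have [q /ctype_over] := @filter_ex _ F _ _ Sphi.
have Sfs : finitely_satisfiable S.
  move=> s /finite_seqP[l ->] lS.
  suff /filter_ex[q ql] : F [set q : ctype I A | forall phi, phi \in l -> ctype_set q phi].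
    by have [||b bl] := @ctype_fs q [set` l]; [exact: finite_seq|exact: ql|exists b].
  elim: l lS => [|phi l IH] lS; first exact: filterS filterT.
  have Fl : F [set q : ctype I A | forall phi, phi \in l -> ctype_set q phi].
    by apply: IH => psi psil; apply: lS; rewrite /= inE (psil : psi \in l) orbT.
  apply: filterS (filterI (lS phi (mem_head _ _)) Fl) => q [/= qphi ql] psi.
  by rewrite inE => /predU1P[->//|]; exact: ql.
have Stot phi : formulas_over A phi -> S phi \/ S (Neg phi).
  move=> phiA; have [|H] := in_ultra_setVsetC [set q : ctype I A | ctype_set q phi] FU; first by left.
  by right; apply: filterS H => q /=; rewrite ctype_Neg.
exists (CType SA Sfs Stot); split=> // O.
rewrite nbhsE => -[B [oB Bq] BO].
have [phi _ [Sphi phiB]] := ctype_base oB Bq.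
by apply: filterS Sphi => q /phiB /BO.
Qed.

Lemma tp_sub (b : I -> C) : tp A b `<=` formulas_over A.
Proof. by move=> phi []. Qed.
Lemma tp_fs (b : I -> C) : finitely_satisfiable (tp A b).
Proof. by move=> s _ sb; exists b => phi /sb[]. Qed.
Lemma tp_total (b : I -> C) phi : formulas_over A phi -> tp A b phi \/ tp A b (Neg phi).
Proof. by move=> phiA; have [?|?] := pselect (sat (env b) phi); [left|right]. Qed.
Definition tpc (b : I -> C) : ctype I A := CType (@tp_sub b) (@tp_fs b) (@tp_total b).

Lemma tpc_eq (b b' : I -> C) : tp A b = tp A b' -> tpc b = tpc b'.
Proof. by move=> bb'; apply: ctype_ext => phi /=; rewrite bb'. Qed.

Lemma eq_tpc q b : ctype_set q = tp A b -> q = tpc b.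
Proof. by move=> qb; apply: ctype_ext => phi; rewrite qb. Qed.

Lemma realizations_ctype q b : realizations (ctype_set q) b <-> q = tpc b.
Proof.
split=> [qb|-> phi []//]; apply: ctype_ext => phi qphi.
by split; [exact: ctype_over qphi|exact: qb].
Qed.

End TypeSpaces.
Arguments tpc {L C I} A b.

Section TypesExtending.
Context {L : language} {C : structure L} {I : Type} {A : set C}.
Variable q0 : set (formula L (I + C)).
Notation Z := (@types_extending L C I A q0).

Lemma types_extending_closed : closed Z.
Proof.
rewrite (_ : Z = \bigcap_(phi in q0) [set q : ctype I A | ctype_set q phi]).
  by apply: closed_bigI => phi _; case: (@ctype_clopen _ _ I A phi).
by apply/seteqP; split=> q /=.
Qed.

Lemma set_val_continuous : continuous (set_val : Z -> ctype I A).
Proof. exact: initial_continuous. Qed.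

Lemma types_extending_compact : compact [set: Z].
Proof.
move=> F FF _.
have [|q [_ Fq]] := @ctype_compact L C I A (set_val @ F) _; first exact: filterT.
have qZ : Z q.
  apply: types_extending_closed => V Vq.
  have FR : F (set_val @^-1` (range (set_val : Z -> ctype I A))).
    by apply: filterE => x; exists x.
  have [y [[x _ <-{y}] Vx]] := Fq _ V FR Vq.
  by exists (set_val x); split=> //; apply/set_mem; exact: valP.
exists (SigSub (mem_set qZ)); split=> // B V FB [W [[O oO <-] Oq OV]].
have FO : F (set_val @^-1` (set_val @` B)).
  by apply: (filterS (P := B)) FB => x Bx; exists x.
have [y [[x Bx <-{y}] Ox]] := Fq _ O FO (open_nbhs_nbhs (conj oO Oq)).
by exists x; split=> //; exact: OV.
Qed.

Lemma types_extending_hausdorff : hausdorff_space Z.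
Proof.
rewrite open_hausdorff => x y xy.
have := @ctype_hausdorff L C I A; rewrite open_hausdorff.
move=> /(_ (set_val x) (set_val y))[|[V W] /= [/set_mem Vx /set_mem Wy] [oV oW /eqP VW]].
  by apply/eqP => E; case/eqP: xy; apply: val_inj; exact: E.
exists (set_val @^-1` V, set_val @^-1` W) => /=; first by split; exact/mem_set.
split; [by exists V|by exists W|].
by apply/eqP; rewrite -preimage_setI VW preimage_set0.
Qed.

Lemma types_extending_closedP (F : set Z) : closed F <-> closed (set_val @` F).
Proof.
split=> [Fc|Fc].
  apply: compact_closed; first exact: ctype_hausdorff.
  apply: continuous_compact; first exact/continuous_subspaceT/set_val_continuous.
  exact: subclosed_compact Fc types_extending_compact _.
rewrite (_ : F = set_val @^-1` (set_val @` F)).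
  by apply: preimage_closed Fc => x _; exact: set_val_continuous.
by apply/seteqP; split=> [x Fx|x [y Fy /val_inj <-]//]; exists x.
Qed.

Lemma countable_enum U (D : set U) : countable D -> D !=set0 ->
  exists f : nat -> U, range f = D.
Proof.
move=> /pfcard_geP[->|/surjfunPex[f ->]]; first by move=> [].
by exists f.
Qed.

Lemma types_extending_base :
  countable (@formulas_over L C I A) -> exists U : nat -> set Z, clopen_base U.
Proof.
move=> /countable_enum[|f fE]; first by exists Fal.
exists (fun n => [set x : Z | ctype_set (set_val x) (f n)]); split=> [n|O x [O' oO' <-] Ox].
  exact: (preimage_clopen (ctype_clopen (f n)) set_val_continuous).
have [phi phiA [xphi phiO]] := ctype_base oO' Ox.
by have [n _ nphi] : range f phi by [rewrite fE|]; exists n; rewrite /= nphi// => y /phiO.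
Qed.

End TypesExtending.

(** * The Kim-Pillay automorphisms *)

Section KimPillay.
Local Open Scope group_scope.
Context {K : Type} {L : language} {T : theory L} {C : structure L}.
Hypothesis Cm : monster_model K T C.
Notation TD := type_definable_over.
Notation KP := (@autfKP_set K L C).

Let K_limit : strong_limit K := monster_strong_limit Cm.

Lemma small_set0 U : small K (@set0 U).
Proof. exact/(small_countable (small_nat Cm))/countable0. Qed.

Lemma ctype_realized J (A : set C) (q : ctype J A) :
  small K [set: J] -> small K A -> exists b, q = tpc A b.
Proof.
move=> sJ sA; have [b] := saturation Cm sJ sA (@ctype_over _ _ _ _ q) (ctype_fs (q := q)).
by move=> /realizations_ctype ->; exists b.
Qed.

(** The dictionary used by all later topological arguments: continuity and closedness of maps
    between type spaces become statements about preimages and projections of type-definable sets.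
    Saturation realizes every type over [A]. *)
Lemma closed_type_definable J (A : set C) (F : set (ctype J A)) :
  small K [set: J] -> small K A -> closed F <-> TD A [set b | F (tpc A b)].
Proof.
move=> sJ sA; split=> [Fc|[Phi PhiA FE]].
  exists [set phi | formulas_over A phi /\ forall q, F q -> ctype_set q phi].
    by move=> phi [].
  apply/seteqP; split=> b /=; first by move=> Fb phi [phiA /(_ _ Fb)[]].
  move=> H.
  apply: contrapT => nFb.
  have [phi phiA [[_ bphi] phiF]] := ctype_base (closed_openC Fc) nFb.
  have : sat (env b) (Neg phi); last exact.
  apply: H; split=> // q Fq; apply/ctype_Neg => // qphi.
  exact: phiF q qphi Fq.
rewrite (_ : F = \bigcap_(phi in Phi) [set q : ctype J A | ctype_set q phi]).
  by apply: closed_bigI => phi _; case: (@ctype_clopen _ _ J A phi).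
apply/seteqP; split=> q; have [b ->] := ctype_realized q sJ sA; rewrite -[F _]/([set b | F (tpc A b)] b) FE.
  by move=> Fb phi Phiphi; split; [exact: PhiA|exact: Fb].
by move=> Fb phi Phiphi; have [] := Fb phi Phiphi.
Qed.

Lemma autKV (s : aut C) x : s^-1 (s x) = x.
Proof. by have /(congr1 (fun u : aut C => u x)) : s^-1 * s = 1 by rewrite mulVg. Qed.

Lemma autVK (s : aut C) x : s (s^-1 x) = x.
Proof. by have /(congr1 (fun u : aut C => u x)) : s * s^-1 = 1 by rewrite mulgV. Qed.

Lemma aut_fixingV A (s : aut C) : aut_fixing A s -> aut_fixing A s^-1.
Proof. by move=> sA x Ax; rewrite -{1}(sA x Ax) autKV. Qed.

Lemma aut_fixing_range J (m : J -> C) (s t : aut C) :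
  s \o m = t \o m -> aut_fixing (range m) (s^-1 * t).
Proof.
move=> st _ [j _ <-]; rewrite -[RHS](autKV s); congr (s^-1 _).
by have /(congr1 (fun f => f j)) /= -> := st.
Qed.

Lemma graph_aut J (E : (J -> C) -> (J -> C) -> Prop) (s : aut C) x y :
  TD set0 (graph E) -> E x y -> E (s \o x) (s \o y).
Proof.
move=> tE Exy; have : graph E (tcat x y) by [].
by move=> /(type_definable_aut s tE); rewrite comp_tcat.
Qed.

Lemma autfKPP s : KP s <-> forall J (X : set (J -> C)) E, small K [set: J] ->
  bounded_equivalence K X E -> TD set0 (graph E) -> forall b, X b -> E b (s \o b).
Proof.
split=> [sKP J X E sJ bE tE b Xb|H J X E sJ bE tE c [x Xx <-]].
  have [_ Er _ _] := bE.1.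
  have sc := sKP J X E sJ bE tE (eclass E b) (ex_intro2 _ _ b Xb erefl).
  have : [set s \o b' | b' in eclass E b] (s \o b) by exists b => //; exact: Er.
  by rewrite sc.
have [EX Er Es Et] := bE.1.
apply/seteqP; split=> [_ [b xb <-]|b xb].
  by apply: Et (xb) _; apply: H bE tE _ _ => //; case: (EX _ _ xb).
exists ((s^-1)%g \o b); last by apply/funext => j /=; rewrite autVK.
have Xb := (EX _ _ xb).2.
have Xsb : X ((s^-1)%g \o b).
  by have /EX[] := graph_aut s^-1 tE (Er _ Xb).
apply: Et (xb) _; have := H J X E sJ bE tE _ Xsb.
rewrite (_ : s \o _ = b); first exact: Es.
by apply/funext => j /=; rewrite autVK.
Qed.

Lemma KPM s t : KP s -> KP t -> KP (s * t).
Proof. exact: (subgroupM (H := autfKP_subgroup K)). Qed.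
Lemma KPV s : KP s -> KP s^-1.
Proof. exact: (subgroupV (H := autfKP_subgroup K)). Qed.
Lemma KPJ s t : KP s -> KP (t^-1 * s * t).
Proof. by rewrite -mulgA; exact: autfKP_normal. Qed.

(* For instance a model, or any set containing one. *)
Definition KP_base (A : set C) := forall s, aut_fixing A s -> KP s.

Lemma KP_base_model N : elementary_submodel N -> KP_base N.
Proof.
move=> Nm s sN; apply/autfKPP => J X E sJ bE tE b Xb.
exact: (bounded_equivalence_fixing Cm sJ bE tE Nm sN Xb).
Qed.

Lemma KP_base_sub A B : A `<=` B -> KP_base A -> KP_base B.
Proof. by move=> AB KA s sB; apply: KA => x /AB; exact: sB. Qed.

Lemma autfL_KP : autfL_set K `<=` KP.
Proof.
apply: smallest_sub; first exact: autfKP_closed.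
by move=> s [N [Nm _] sN]; exact: KP_base_model Nm _ sN.
Qed.

(** The reason why [tp(s m / A)] determines the coset of [s]: if [t m = u s m] with [u] fixing [A],
    then [s^-1 * t] is a conjugate of [u] times an automorphism fixing [m]. *)
Lemma KP_tp J (m : J -> C) A (s t : aut C) : small K [set: J] -> small K A ->
  KP_base A -> KP_base (range m) -> tp A (s \o m) = tp A (t \o m) -> KP (s^-1 * t).
Proof.
move=> sJ sA KA Km /(homogeneity Cm sJ sA)[u uA tusm].
have -> : s^-1 * t = s^-1 * u * s * ((u * s)^-1 * t).
  by rewrite invgM !mulgA !mulgK.
apply: KPM; first exact/KPJ/KA.
by apply: Km; apply: aut_fixing_range; rewrite tusm.
Qed.

Definition KP_pairs J (m : J -> C) : set (J + J -> C) :=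
  [set d | exists s t : aut C, d = tcat (s \o m) (t \o m) /\ KP (s^-1 * t)].

(* On the conjugates of a tuple [m] whose stabilizer lies in Autf_KP, every
   bounded type-definable relation [E] and [b] induce a bounded type-definable
   relation, whose value at [(s m, t m)] is [E (s b) (t b)]. *)
Lemma type_definable_KP_pairs J (m : J -> C) :
  small K [set: J] -> KP_base (range m) -> TD set0 (KP_pairs m).
Proof.
move=> sJ Km.
(* The sets [Y] need not be equivalence relations. The intersection is tested first against
   conjugacy of both halves to [m], then, for each [E] and [b], against a projection of [W]. *)
rewrite (_ : KP_pairs m = \bigcap_(Y in [set Y | TD set0 Y /\ KP_pairs m `<=` Y]) Y).
  by apply: type_definable_bigcap => Y [].
apply/seteqP; split=> [d dKP Y [_]|d H]; first exact.
have s0 := @small_set0 C.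
pose Y1 := [set d : J + J -> C | tp set0 (d \o inl) = tp set0 m /\ tp set0 (d \o inr) = tp set0 m].
have [] : Y1 d.
  apply: H; split.
    apply: type_definableI; exact: (type_definable_preimage _ (type_definable_tp _ _)).
  by move=> _ [s [t [-> _]]]; split; rewrite ?tcat_inl ?tcat_inr; exact: tp_aut.
move=> /esym/(homogeneity Cm sJ s0)[s _ dl] /esym/(homogeneity Cm sJ s0)[t _ dr].
exists s, t; split; first by rewrite -dl -dr -tcatE.
apply/autfKPP => I X E sI bE tE b Xb; have [EX Er Es Et] := bE.1.
have Eaut (u : aut C) x y : E x y -> E (u \o x) (u \o y).
  exact: graph_aut.
pose i1 (v : J + I) : (J + J) + (I + I) := match v with inl j => inl (inl j) | inr i => inr (inl i) end.
pose i2 (v : J + I) : (J + J) + (I + I) := match v with inl j => inl (inr j) | inr i => inr (inr i) end.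
(* Quadruples [(x, y, x', y')] such that [(x, x')] and [(y, y')] are conjugates of [(m, b)] and
   [E x' y'] holds; the last two entries are then projected away. *)
pose W := [set e : (J + J) + (I + I) -> C | [/\ tp set0 (e \o i1) = tp set0 (tcat m b),
  tp set0 (e \o i2) = tp set0 (tcat m b) & graph E (e \o inr)]].
have tW : TD set0 W.
  pose Q (i : J + I -> (J + J) + (I + I)) := [set e : (J + J) + (I + I) -> C |
    [set b' | tp set0 b' = tp set0 (tcat m b)] (e \o i)].
  have -> : W = Q i1 `&` Q i2 `&` [set e : (J + J) + (I + I) -> C | graph E (e \o inr)].
    by apply/seteqP; split=> e => [[? ? ?]|[[? ?] ?]]; split.
  apply: type_definableI; last exact: type_definable_preimage.
  by apply: type_definableI; apply: type_definable_preimage; exact: type_definable_tp.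
have sJI : small K [set: J + I] by exact: small_sum.
have sJJ : small K [set: J + J] by exact: small_sum.
have sJJII : small K [set: (J + J) + (I + I)] by apply: small_sum => //; exact: small_sum.
have [e [/esym/(homogeneity Cm sJI s0)[u _ e1] /esym/(homogeneity Cm sJI s0)[v _ e2] Ee] de] :
    [set d | exists2 e, W e & d = e \o inl] d.
  apply: H; split; first exact: (type_definable_proj Cm).
  move=> _ [s' [t' [-> st]]].
  exists (tcat (tcat (s' \o m) (t' \o m)) (tcat (s' \o b) (t' \o b))) => //; split.
  - by rewrite (_ : _ \o i1 = s' \o tcat m b); [exact: tp_aut|apply/funext => -[]].
  - by rewrite (_ : _ \o i2 = t' \o tcat m b); [exact: tp_aut|apply/funext => -[]].
  - rewrite tcat_inr /graph/= !tcat_inl !tcat_inr.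
    have := autfKPP (s'^-1 * t') => -[/(_ st) /(_ I X E sI bE tE b Xb) /(Eaut s')].
    rewrite (_ : s' \o (_ \o b) = t' \o b)//; apply/funext => i /=.
    exact: (autVK s' (t' (b i))).
(* [u] and [s] agree on [m] but perhaps not on [b]. They differ by an automorphism fixing [m], which
   lies in Autf_KP and so moves [b] within its class. *)
have us : E (u \o b) (s \o b).
  have : E b ((u^-1 * s)%g \o b).
    apply: (autfKPP _).1 sI bE tE _ Xb; apply: Km; apply: aut_fixing_range.
    rewrite -dl de; apply/funext => j.
    by have /(congr1 (fun f => f (inl j))) /= := e1.
  move=> /(Eaut u); rewrite (_ : u \o (_ \o b) = s \o b)//; apply/funext => i /=.
  exact: (autVK u (s (b i))).
have vt : E (v \o b) (t \o b).
  have : E b ((v^-1 * t)%g \o b).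
    apply: (autfKPP _).1 sI bE tE _ Xb; apply: Km; apply: aut_fixing_range.
    rewrite -dr de; apply/funext => j.
    by have /(congr1 (fun f => f (inl j))) /= := e2.
  move=> /(Eaut v); rewrite (_ : v \o (_ \o b) = t \o b)//; apply/funext => i /=.
  exact: (autVK v (t (b i))).
have uv : E (u \o b) (v \o b).
  move: Ee; rewrite /graph /=.
  rewrite (_ : (e \o inr) \o inl = u \o b); last first.
    by apply/funext => i; have /(congr1 (fun f => f (inr i))) /= := e1.
  rewrite (_ : (e \o inr) \o inr = v \o b)//.
  by apply/funext => i; have /(congr1 (fun f => f (inr i))) /= := e2.
have := Et _ _ _ (Es _ _ us) (Et _ _ _ uv vt).
move=> /(Eaut s^-1); rewrite (_ : (s^-1)%g \o (s \o b) = b)//; apply/funext => i /=.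
exact: autKV.
Qed.

End KimPillay.

(** * The topology of the Kim-Pillay group *)

Section GaloisGroup.
Local Open Scope group_scope.
Context {K : Type} {L : language} {T : theory L} {C : structure L}.
Hypothesis Cm : monster_model K T C.
Context {M : set C}.
Hypothesis M_model : small_model K M.
Notation TD := type_definable_over.
Notation KP := (@autfKP_set K L C).
Notation KPbase := (@KP_base K L C).
Notation G := (@galKP K L C M).
Notation pr := (@to_galKP K L C M).

Let K_limit : strong_limit K := monster_strong_limit Cm.
Let s0 : small K (@set0 C) := small_set0 Cm C.

Lemma to_galKPP s t : pr s = pr t <-> KP (s^-1 * t).
Proof. exact: coset_eqP. Qed.

Lemma to_galKP_mul s t : pr s * pr t = pr (s * t).
Proof. exact: coset_ofM. Qed.

Lemma to_galKP_inv s : (pr s)^-1 = pr s^-1.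
Proof. exact: coset_ofV. Qed.

Lemma to_galKP_surj (g : G) : exists s, g = pr s.
Proof. by exists (coset_repr (g : coset_space (autfKP K))); rewrite /to_galKP coset_reprK. Qed.

Lemma to_galKP_fixing A s t : KPbase A -> aut_fixing A s -> pr (s * t) = pr t.
Proof.
move=> KA sA; apply/to_galKPP; rewrite invgM; apply: KPJ; exact/KPV/KA.
Qed.

Lemma to_galKP_base J (m : J -> C) (s t : aut C) : KPbase (range m) -> s \o m = t \o m -> pr s = pr t.
Proof. by move=> Km st; apply/to_galKPP/Km/aut_fixing_range. Qed.

Definition galKP_fiber J (m : J -> C) (F : set G) : set (J -> C) :=
  [set b | exists2 s : aut C, b = s \o m & F (pr s)].

(** In a conjugate of the joint tuple [(m, m')] the first half determines the coset, because the
    stabilizer of [m] lies in Autf_KP. Projecting to the second half yields the fiber of [m']. *)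
Lemma galKP_fiber_transfer J J' (m : J -> C) (m' : J' -> C) A F :
  small K [set: J] -> small K [set: J'] -> small K A -> KPbase (range m) ->
  TD A (galKP_fiber m F) -> TD A (galKP_fiber m' F).
Proof.
move=> sJ sJ' sA Km tF.
pose D := [set d : J + J' -> C | galKP_fiber m F (d \o inl)] `&`
  [set d | tp set0 d = tp set0 (tcat m m')].
have tD : TD A D.
  apply: type_definableI; first exact: type_definable_preimage.
  exact: type_definable_over_sub (type_definable_tp _ _).
have sJJ : small K [set: J + J'] by exact: small_sum.
rewrite (_ : galKP_fiber m' F = [set b' | exists2 d, D d & b' = d \o inr]).
  exact: (type_definable_proj Cm).
apply/seteqP; split=> [_ [s -> Fs]|_ [d [[s ds Fs] /esym/(homogeneity Cm sJJ s0)[t _ dt]] ->]].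
  exists (tcat (s \o m) (s \o m')); last by [].
  split; first by exists s.
  by rewrite -comp_tcat /=; exact: tp_aut.
exists t; first by rewrite dt comp_tcat.
rewrite -(@to_galKP_base _ m s t)// -ds dt comp_tcat//.
Qed.

Lemma galKP_fiber_invariant J (m : J -> C) F A (s : aut C) b :
  KPbase A -> aut_fixing A s -> galKP_fiber m F b -> galKP_fiber m F (s \o b).
Proof. by move=> KA sA [t -> Ft]; exists (s * t) => //; rewrite (to_galKP_fixing _ KA sA). Qed.

(** Two choices are hidden on the left: an automorphism realizing [q] and a representative of its
    Autf_L coset. The first is harmless by [KP_tp], the second because Autf_L is contained in
    Autf_KP. *)
Lemma gal_mapP (q : types_extending M (@enum_type L C M)) (s : aut C) :
  ctype_set (\val q) = tp M (s \o set_val) ->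
  gal_to_galKP (gal_map K q : gal K M) = pr s.
Proof.
move=> qs; have [Mm sM] := M_model.
pose s' := xget 1 [set s : aut C | ctype_set (\val q) = tp M (s \o set_val)].
have qs' : ctype_set (\val q) = tp M (s' \o set_val).
  exact: (@xgetI _ 1 [set s : aut C | ctype_set (\val q) = tp M (s \o set_val)] s).
have -> : gal_to_galKP (gal_map K q : gal K M) = pr s'.
  apply/to_galKPP/(autfL_KP Cm).
  have /coset_eqP := coset_reprK (coset_of (autfL K) s').
  by move=> /subgroupV; rewrite invgM invgK => /subgroupV; rewrite invgM invgK.
apply/to_galKPP; apply: (KP_tp Cm (m := set_val : M -> C) (A := M)) => //.
- exact/small_setT.
- exact: (KP_base_model Cm).
- apply: KP_base_sub (KP_base_model Cm Mm) => x Mx.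
  by exists (SigSub (mem_set Mx)).
- by rewrite -qs'.
Qed.

(* When [m] enumerates a model M and [A] is M, this is S_m(M). *)
Definition conj_types J (m : J -> C) (A : set C) : set (ctype J A) := types_extending A (tp set0 m).

Arguments conj_types {J} m A _.

Lemma conj_typesP J (m : J -> C) A (q : conj_types m A) :
  small K [set: J] -> small K A -> exists s : aut C, set_val q = tpc A (s \o m).
Proof.
move=> sJ sA; have [b qb] := ctype_realized Cm (set_val q) sJ sA.
have /esym/(homogeneity Cm sJ s0)[s _ bs] : tp set0 b = tp set0 m.
  apply/realizations_tp => phi mphi.
  have : ctype_set (set_val q) phi by have /set_mem := valP q; apply.
  by rewrite qb => -[].
by exists s; rewrite -bs.
Qed.

Lemma tpc_conj J (m : J -> C) A (s : aut C) : conj_types m A (tpc A (s \o m)).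
Proof.
move=> phi [phi0 mphi]; split; first exact: formulas_over_sub phi0.
by have /tp_set0P/(_ phi phi0)[_] := tp_aut (A := set0) m (s := s) (fun _ F => False_ind _ F); apply.
Qed.

Lemma closed_conj_types J (m : J -> C) A (F : set (conj_types m A)) :
  small K [set: J] -> small K A ->
  closed F <-> TD A [set b | exists2 q, F q & set_val q = tpc A b].
Proof.
move=> sJ sA; rewrite types_extending_closedP (closed_type_definable Cm _ sJ sA).
by rewrite (_ : [set b | (set_val @` F) (tpc A b)] = [set b | exists2 q, F q & set_val q = tpc A b]).
Qed.

(** The topology is a final topology taken twice, so closedness can be read in the type space over
    [M]. A tuple with the type of [s m] over [M] is [t s m] with [t] fixing [M], and [t s] is in the
    coset of [s]. *)
Lemma galKP_closedM (F : set G) : closed F <-> TD M (galKP_fiber (set_val : M -> C) F).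
Proof.
have [Mm sM] := M_model; have sM' : small K [set: M] by exact/small_setT.
pose p (q : types_extending M (@enum_type L C M)) : G := gal_to_galKP (gal_map K q : gal K M).
have -> : closed F <-> closed (p @^-1` F).
  rewrite -openC -[in X in _ <-> X]openC; exact: iff_refl.
rewrite -/(conj_types (set_val : M -> C) M) in p *.
rewrite (closed_conj_types (p @^-1` F))//.
rewrite (_ : [set b | _] = galKP_fiber (set_val : M -> C) F)//.
apply/seteqP; split=> [b [q Fq qb]|_ [s -> Fs]].
  have [s qs] := conj_typesP q sM' sM.
  have /esym/(homogeneity Cm sM' sM)[t tM ->] : tp M b = tp M (s \o set_val).
    by have := congr1 (@ctype_set _ _ _ _) qb; rewrite qs /=.
  exists (t * s) => //; rewrite (to_galKP_fixing _ (KP_base_model Cm Mm) tM).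
  have qs' : ctype_set (\val q) = tp M (s \o set_val).
    exact: (congr1 (@ctype_set L C M M) qs).
  by rewrite -(gal_mapP qs').
exists (SigSub (mem_set (@tpc_conj _ (set_val : M -> C) M s))) => //=.
by rewrite /p (gal_mapP (s := s)).
Qed.

(** * The map from types of conjugates onto the Kim-Pillay group *)

Section ConjTypes.
Context {J : Type} (m : J -> C) (N : set C).
Hypotheses (sJ : small K [set: J]) (Km : KPbase (range m)).
Hypotheses (sN : small K N) (KN : KPbase N).

(** After transfer to the enumeration of [M], the fiber is invariant under automorphisms fixing [M];
    this replaces the arbitrary parameters [A] by [M]. *)
Lemma galKP_closed (F : set G) A : small K A -> TD A (galKP_fiber m F) -> closed F.
Proof.
have [Mm sM] := M_model; have sM' : small K [set: M] by exact/small_setT.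
move=> sA tF; apply/galKP_closedM.
have tF' : TD A (galKP_fiber (set_val : M -> C) F).
  exact: galKP_fiber_transfer tF.
apply: (type_definable_descent Cm sM' sA sM tF') => s b.
by apply: galKP_fiber_invariant; exact: (KP_base_model Cm).
Qed.

Lemma closed_galKP (F : set G) : closed F -> TD N (galKP_fiber m F).
Proof.
have [Mm sM] := M_model; have sM' : small K [set: M] by exact/small_setT.
have KM : KPbase (range (set_val : M -> C)).
  apply: KP_base_sub (KP_base_model Cm Mm) => x Mx.
  by exists (SigSub (mem_set Mx)).
move=> /galKP_closedM tF.
have tF' : TD M (galKP_fiber m F) by exact: galKP_fiber_transfer tF.
apply: (type_definable_descent Cm sJ sM sN tF') => s b.
exact: galKP_fiber_invariant.
Qed.

Definition conj_map (q : conj_types m N) : G := pr (projT1 (cid (conj_typesP q sJ sN))).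

Lemma conj_mapE q (s : aut C) : set_val q = tpc N (s \o m) -> conj_map q = pr s.
Proof.
rewrite /conj_map; case: cid => t /= -> /(congr1 (@ctype_set _ _ _ _)) /= ts.
apply/to_galKPP; exact: (KP_tp Cm sJ sN KN Km).
Qed.

Lemma conj_map_surj : range conj_map = setT.
Proof.
apply/seteqP; split=> // g _; have [s ->] := to_galKP_surj g.
exists (SigSub (mem_set (@tpc_conj _ m N s))) => //; exact: conj_mapE.
Qed.

Lemma galKP_fiber_conj_map (F : set G) :
  [set b | exists2 q, (conj_map @^-1` F) q & set_val q = tpc N b] = galKP_fiber m F.
Proof.
apply/seteqP; split=> [b [q Fq qb]|_ [s -> Fs]].
  have [s qs] := conj_typesP q sJ sN.
  have /esym/(homogeneity Cm sJ sN)[t tN ->] : tp N b = tp N (s \o m).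
    by have := congr1 (@ctype_set _ _ _ _) qb; rewrite qs /=.
  by exists (t * s) => //; rewrite (to_galKP_fixing _ KN tN) -(conj_mapE qs).
exists (SigSub (mem_set (@tpc_conj _ m N s))) => //=.
by rewrite (conj_mapE (s := s)).
Qed.

Lemma conj_map_closed (F : set G) : closed F <-> closed (conj_map @^-1` F).
Proof.
rewrite (closed_conj_types _ sJ sN) galKP_fiber_conj_map.
by split; [exact: closed_galKP|exact: galKP_closed].
Qed.

Lemma conj_map_continuous : continuous conj_map.
Proof. by apply/continuous_closedP => F /conj_map_closed. Qed.

Lemma conj_map_closed_map (F : set (conj_types m N)) : closed F -> closed (conj_map @` F).
Proof.
move=> /(closed_conj_types _ sJ sN) tF.
have sJJ : small K [set: J + J] by exact: small_sum.
apply: (galKP_closed (A := N)) => //.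
pose D := @KP_pairs K L C J m `&`
  [set d : J + J -> C | exists2 q, F q & set_val q = tpc N (d \o inr)].
have tD : TD N D.
  apply: type_definableI; last exact: (type_definable_preimage inr tF).
  exact: type_definable_over_sub (type_definable_KP_pairs Cm sJ Km).
rewrite (_ : galKP_fiber m _ = [set b | exists2 d, D d & b = d \o inl]).
  exact: (type_definable_proj Cm).
apply/seteqP; split=> [_ [s -> [q Fq qs]]|_ [_ [[s [t [-> st]]] [q Fq qt]] ->]].
  have [t qt] := conj_typesP q sJ sN.
  exists (tcat (s \o m) (t \o m)) => //; split; last by exists q.
  by exists s, t; split=> //; apply/to_galKPP; rewrite -qs (conj_mapE qt).
exists s => //; exists q => //; rewrite (conj_mapE qt); exact/esym/to_galKPP.
Qed.

Lemma galKP_hausdorff : hausdorff_space G.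
Proof.
apply: quotient_hausdorff (@types_extending_compact _ _ _ _ _)
  (@types_extending_hausdorff _ _ _ _ _) conj_map_continuous conj_map_closed_map conj_map_surj.
Qed.

End ConjTypes.
End GaloisGroup.
Arguments conj_types {L C J} m A _.

(** * Transfer of complexity *)

Section Transfer.
Context {Z Y1 Y2 : topologicalType} {f1 : Z -> Y1} {f2 : Z -> Y2} {U : nat -> set Z}.
Hypotheses (Zc : compact [set: Z]) (ZH : hausdorff_space Z) (Zb : clopen_base U).
Hypotheses (Y1H : hausdorff_space Y1) (Y2H : hausdorff_space Y2).
Hypotheses (f1c : continuous f1) (f2c : continuous f2).

Lemma compact_closed_map (Y : topologicalType) (f : Z -> Y) (F : set Z) :
  hausdorff_space Y -> continuous f -> closed F -> closed (f @` F).
Proof.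
move=> YH fc Fc; apply: compact_closed => //; apply: continuous_compact.
  exact: continuous_subspaceT.
exact: subclosed_compact Fc Zc _.
Qed.

Lemma compact_borel_section (Y : topologicalType) (f : Z -> Y) :
  hausdorff_space Y -> continuous f -> [set: Z] !=set0 ->
  exists2 g : Y -> Z, {in range f, cancel g f} & forall B, borel B -> borel (g @^-1` B).
Proof.
move=> YH fc Z0; apply: (borel_section Zc Zb Z0) => [F|y].
  exact: compact_closed_map.
apply: preimage_closed => [z _|]; first exact: fc.
exact: accessible_closed_set1 (hausdorff_accessible YH) y.
Qed.

Context {A1 : set Y1} {A2 : set Y2}.
Hypotheses (A12 : f1 @^-1` A1 = f2 @^-1` A2) (A2f2 : A2 `<=` range f2).

Lemma image_preimage_transfer : A2 = f2 @` (f1 @^-1` A1).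
Proof.
rewrite A12; apply/seteqP; split=> [y Ay|_ [z Az <-]//].
by have [z _ zy] := A2f2 Ay; exists z => //=; rewrite zy.
Qed.

(** A continuous image of a Borel set need not be Borel. Instead [A2] is the preimage, under a Borel
    section of [f2], of the common preimage of both sets, cut down to the closed range of [f2]. *)
Lemma borel_transfer : borel A1 -> borel A2.
Proof.
move=> bA1; have [Z0|Z0] := pselect ([set: Z] !=set0); last first.
  rewrite (_ : A2 = set0); first exact: sigma_algebra0.
  by apply/seteqP; split=> y // /A2f2[z]; case: Z0; exists z.
have [g gK gb] := compact_borel_section Y2H f2c Z0.
rewrite (_ : A2 = range f2 `&` g @^-1` (f1 @^-1` A1)).
  apply: borelI; last by apply: gb; exact: continuous_borel.
  by apply: borel_closed; apply: compact_closed_map => //; exact: closedT.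
rewrite A12; apply/seteqP; split=> [y Ay|y [yf] /=]; last by rewrite gK// inE.
by split; [exact: A2f2|rewrite /= gK// inE; exact: A2f2].
Qed.

Lemma analytic_transfer : analytic A1 -> analytic A2.
Proof.
move=> aA1; rewrite image_preimage_transfer; apply: analytic_image => //.
exact: analytic_preimage Zb Y1H f1c aA1.
Qed.

Lemma Fsigma_transfer : Fsigma A1 -> Fsigma A2.
Proof.
move=> [F Fc FE]; exists (fun n => f2 @` (f1 @^-1` F n)) => [n|].
  apply: compact_closed_map => //; apply: preimage_closed (Fc n) => z _; exact: f1c.
rewrite image_preimage_transfer FE preimage_bigcup image_bigcup.
by [].
Qed.

End Transfer.

Lemma borel_reducible_transfer (Z Y1 Y2 : topologicalType) (f1 : Z -> Y1) (f2 : Z -> Y2)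
    (U : nat -> set Z) (E1 : Y1 -> Y1 -> Prop) (E2 : Y2 -> Y2 -> Prop) :
  compact [set: Z] -> clopen_base U -> [set: Z] !=set0 ->
  hausdorff_space Y1 -> continuous f1 -> continuous f2 -> range f1 = setT ->
  (forall x y, E1 (f1 x) (f1 y) <-> E2 (f2 x) (f2 y)) -> borel_reducible E1 E2.
Proof.
move=> Zc Zb Z0 Y1H f1c f2c f1T E12.
have [g gK gb] := compact_borel_section Zc Zb Y1H f1c Z0.
have {}gK y : f1 (g y) = y by rewrite gK// f1T inE.
exists (f2 \o g) => [B bB|x y]; first exact: (gb _ (continuous_borel f2c bB)).
by rewrite -{1}(gK x) -{1}(gK y).
Qed.

(** * Orbit maps of strong types *)

Section StrongType.
Context {K : Type} {L : language} {T : theory L} {C : structure L}.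
Hypotheses (L_countable : countable_language L) (Cm : monster_model K T C).
Context {I : Type} (I_countable : countable [set: I]).
Context {p : ctype I (@set0 C)} {E : (I -> C) -> (I -> C) -> Prop}.
Hypothesis E_strong : strong_type K (realizations (ctype_set p)) E.
Hypothesis E_refined : forall b c, realizations (ctype_set p) b ->
  realizations (ctype_set p) c -> equiv_KP K b c -> E b c.
Context {a : I -> C} (a_p : realizations (ctype_set p) a).
Context {M : set C} (M_model : small_model K M).

Notation TD := type_definable_over.
Notation KP := (@autfKP_set K L C).
Notation KPbase := (@KP_base K L C).
Notation G := (@galKP K L C M).
Notation pr := (@to_galKP K L C M).
Let X := realizations (ctype_set p).
Let r : G -> set (I -> C) := orbit_map E a.
Let H := r @^-1` [set eclass E a].
Let K_limit : strong_limit K := monster_strong_limit Cm.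
Let s0 : small K (@set0 C) := small_set0 Cm C.
Let sI : small K [set: I] := small_countable (small_nat Cm) I_countable.

Lemma strong_type_aut (s : aut C) b c : E (s \o b) (s \o c) <-> E b c.
Proof.
have [_ Einv _] := E_strong; split; last exact: Einv.
move=> /(Einv (s^-1)%g).
have sK x : (s^-1)%g \o (s \o x) = x by apply/funext => i /=; rewrite autKV.
by rewrite !sK.
Qed.

Lemma realizationsP b : X b <-> exists s : aut C, b = s \o a.
Proof.
have /realizations_ctype pa := a_p.
rewrite /X pa; split=> [/realizations_tp/esym/(homogeneity Cm sI s0)[s _ ->]|[s ->]].
  by exists s.
by apply/realizations_tp; apply: tp_aut.
Qed.

Lemma realizations_aut (s : aut C) b : X b -> X (s \o b).
Proof. by move=> /realizationsP[t ->]; apply/realizationsP; exists (s * t)%g. Qed.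

Lemma type_definable_realizations : TD set0 X.
Proof. by exists (ctype_set p) => // phi; exact: ctype_over. Qed.

Lemma strong_type_KP s b : KP s -> X b -> E b (s \o b).
Proof. by move=> sKP Xb; apply: E_refined => //; [exact: realizations_aut|exists s]. Qed.

Lemma strong_type_KPr (s t : aut C) b : KP (s^-1 * t)%g -> X b -> E (s \o b) (t \o b).
Proof.
move=> st Xb; apply/(strong_type_aut (s^-1)%g); have := strong_type_KP st Xb.
rewrite (_ : (s^-1)%g \o (s \o b) = b)//; apply/funext => i /=; exact: autKV.
Qed.

Let EX b c : E b c -> X b /\ X c. Proof. by case: E_strong => -[[+ _ _ _] _] _ _; apply. Qed.
Let Er b : X b -> E b b. Proof. by case: E_strong => -[[_ + _ _] _] _ _; apply. Qed.
Let Es b c : E b c -> E c b. Proof. by case: E_strong => -[[_ _ + _] _] _ _; apply. Qed.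
Let Et b c d : E b c -> E c d -> E b d.
Proof. by case: E_strong => -[[_ _ _ +] _] _ _; apply. Qed.
Let Xsa (s : aut C) : X (s \o a). Proof. exact: realizations_aut. Qed.

Lemma eclassE b c : X c -> eclass E b = eclass E c <-> E b c.
Proof.
move=> Xc; split=> [bc|bc]; first by have : eclass E c c := Er Xc; rewrite -bc.
by apply/seteqP; split=> d; [apply: Et; exact: Es|exact: Et].
Qed.

Lemma orbit_mapE s : r (pr s) = eclass E (s \o a).
Proof.
rewrite /r /orbit_map; apply/eclassE => //; apply: strong_type_KPr => //.
by apply/(@to_galKPP K L C M); rewrite /to_galKP coset_reprK.
Qed.

Lemma orbit_map_eq s t : r (pr s) = r (pr t) <-> E (s \o a) (t \o a).
Proof. by rewrite !orbit_mapE; exact: eclassE. Qed.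

Lemma orbit_kernelP s : H (pr s) <-> E a (s \o a).
Proof.
rewrite /H /= orbit_mapE; split=> [/eclassE/Es|/Es/eclassE ->//]; exact.
Qed.

Lemma orbit_map_coset s t : r (pr s) = r (pr t) <-> lcoset H (pr s) (pr t).
Proof.
rewrite orbit_map_eq; split=> [st|[h Hh hE]].
  exists (pr (s^-1 * t)%g); last by rewrite to_galKP_mul mulgA mulgV mul1g.
  apply/orbit_kernelP/(strong_type_aut s).
  rewrite (_ : s \o ((s^-1 * t)%g \o a) = t \o a)//.
  by apply/funext => i /=; exact: autVK.
have [u hu] := to_galKP_surj h; rewrite hu in Hh hE.
move: hE; rewrite to_galKP_mul => /to_galKPP ut.
apply: (@Et _ ((s * u)%g \o a)); last exact: strong_type_KPr.
by have /orbit_kernelP/(strong_type_aut s) := Hh.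
Qed.

Lemma orbit_map_lcoset g g' : r g = r g' <-> lcoset H g g'.
Proof.
by have [s ->] := to_galKP_surj g; have [t ->] := to_galKP_surj g'; exact: orbit_map_coset.
Qed.

Lemma orbit_map_in g : classes X E (r g).
Proof.
have [s ->] := to_galKP_surj g; rewrite orbit_mapE.
by exists (s \o a).
Qed.

Lemma orbit_map_onto x : classes X E x -> exists g, r g = x.
Proof.
by move=> [b /realizationsP[s ->] <-]; exists (pr s); exact: orbit_mapE.
Qed.

Lemma orbit_kernel_group : group_closed [in H].
Proof.
have H1 : H 1%g by apply/(orbit_kernelP 1%g)/Er.
split=> [|x y]; first exact/mem_set.
move=> /set_mem Hx /set_mem Hy; apply/mem_set.
have [s xs] := to_galKP_surj x; have [t yt] := to_galKP_surj y.
rewrite xs in Hx *; rewrite yt in Hy *; rewrite to_galKP_inv to_galKP_mul.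
move/orbit_kernelP: Hx => Hs; move/orbit_kernelP: Hy => Ht; apply/orbit_kernelP.
apply: Et Hs _; have := Ht; rewrite -(strong_type_aut (s * t^-1)%g) => /Es.
rewrite (_ : (s * t^-1)%g \o (t \o a) = s \o a)//; apply/funext => i /=.
by congr (s _); exact: autKV.
Qed.

Lemma orbit_fibers : [set r @^-1` [set x] | x in classes X E] = lcosets H.
Proof.
have fib g : r @^-1` [set r g] = lcoset H g.
  by apply/seteqP; split=> g' /=; [move=> /esym/orbit_map_lcoset|move=> /orbit_map_lcoset/esym].
apply/seteqP; split=> [_ [x /orbit_map_onto[g <-] <-]|_ [g _ <-]].
  by rewrite fib; exists g.
by exists (r g); [exact: orbit_map_in|exact: fib].
Qed.

(** Both the coset of [s] and the tuple [s a] can be read off a conjugate of the joint tuple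
    [(M, a)]. The condition on [s a] thus becomes one on this conjugate, and projecting to the
    second half leads back. *)
Lemma logic_closedP (F : set (set (I -> C))) :
  logic_closed K X E F <-> closed (r @^-1` F).
Proof.
have [Mm sM] := M_model; have sM' : small K [set: M] by exact/small_setT.
pose m : M + I -> C := tcat set_val a.
have sMI : small K [set: M + I] by exact: small_sum.
have Km : KPbase (range m).
  apply: KP_base_sub (KP_base_model Cm Mm) => x Mx.
  by exists (inl (SigSub (mem_set Mx))).
split=> [[A sA tB]|/(closed_galKP Cm M_model m sMI sM (KP_base_model Cm Mm)) tF].
  apply: (galKP_closed Cm M_model sMI Km sA).
  rewrite (_ : galKP_fiber m _ = [set d | tp set0 d = tp set0 m] `&`
      [set d : M + I -> C | [set b | X b /\ F (eclass E b)] (d \o inr)]).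
    apply: type_definableI; last exact: type_definable_preimage.
    exact: type_definable_over_sub (type_definable_tp _ _).
  apply/seteqP; split=> [_ [s -> Fs]|_ [/esym/(homogeneity Cm sMI s0)[s _ ->] [_ Fs]]].
    split; first exact: tp_aut.
    by split; [exact: Xsa|move: Fs; rewrite /= orbit_mapE].
  by exists s => //=; rewrite orbit_mapE.
exists M => //.
rewrite (_ : [set b | _] = [set b | exists2 d, galKP_fiber m (r @^-1` F) d & b = d \o inr]).
  exact: (type_definable_proj Cm).
apply/seteqP; split=> [_ [/realizationsP[s ->] Fs]|_ [_ [s -> Fs] ->]].
  by exists (s \o m) => //; exists s => //=; rewrite orbit_mapE.
by split; [exact: Xsa|move: Fs; rewrite /= orbit_mapE].
Qed.

Lemma orbit_quotient_map :
  topological_quotient_map [set: G] closed (classes X E) (logic_closed K X E) r.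
Proof.
split=> [g _|x /orbit_map_onto[g <-]|F _]; first exact: orbit_map_in.
  by exists g.
by rewrite setTI; exact: logic_closedP.
Qed.

Lemma orbit_homeomorphism : exists2 h : set G -> set (I -> C),
  forall g, h (lcoset H g) = r g &
  homeomorphism (lcosets H) (lcosets_closed H) (classes X E) (logic_closed K X E) h.
Proof.
(* The default [1] is never returned on a coset, which is nonempty. *)
pose h (S : set G) := r (xget 1%g S).
have hE g : h (lcoset H g) = r g.
  apply/esym/orbit_map_lcoset; apply: xgetPex; exists g; exact/orbit_map_lcoset.
exists h => //; split.
  split=> [_ [g _ <-]|_ _ /set_mem[g _ <-] /set_mem[g' _ <-]|x /orbit_map_onto[g <-]].
  - by rewrite hE; exact: orbit_map_in.
  - rewrite !hE => gg'; apply/seteqP; split=> x /orbit_map_lcoset gx;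
      by apply/orbit_map_lcoset; rewrite -gx gg'.
  - by exists (lcoset H g); [exists g|exact: hE].
move=> F _; rewrite logic_closedP /lcosets_closed.
rewrite (_ : [set g | _] = r @^-1` F)//.
apply/seteqP; split=> g /=; first by rewrite hE => -[].
by move=> Fg; split; [exists g|rewrite /= hE].
Qed.

(* An Aut-invariant relation is recovered from its section at [a] by taking all
   conjugates of [(b, a)]. *)
Lemma type_definable_invariant (R : (I -> C) -> (I -> C) -> Prop) A :
  (forall b c, R b c -> X b /\ X c) ->
  (forall (s : aut C) b c, R b c -> R (s \o b) (s \o c)) ->
  small K A -> TD A [set b | R b a] -> TD set0 (graph R).
Proof.
move=> RX Rinv sA tR.
have sII : small K [set: I + I] by exact: small_sum.
have sAa : small K (A `|` range a) by apply: small_setU => //; exact: small_image.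
(* Equality of the second half with [a] is expressed through its type over [range a], hence
   type-definably. *)
pose D := [set d : I + I -> C | [set b | R b a] (d \o inl)] `&`
  [set d : I + I -> C | [set b | tp (range a) b = tp (range a) a] (d \o inr)].
have tD : TD (A `|` range a) D.
  apply: type_definableI; apply: type_definable_preimage.
    exact: type_definable_over_sub (@subsetUl _ _ _) tR.
  exact: type_definable_over_sub (@subsetUr _ _ _) (type_definable_tp _ _).
have aE c : tp (range a) c = tp (range a) a -> c = a.
  move=> /tp_set0P ca; apply/funext => i.
  apply: (ca (Eq (Var L (inl i)) (Var L (inr (a i)))) _).2 => //.
  by split=> //=; exists i.
have := @type_definable_image K L T C Cm _ _ id _ set0 _ sII sAa (@sub0set _ _) tD.
rewrite (_ : [set b' | _] = graph R)//; apply/seteqP; split=> d.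
  move=> [d' [Rd' /aE d'a] /esym/(homogeneity Cm sII s0)[s _ ->]].
  rewrite /graph /= -d'a in Rd' *; exact: Rinv.
move=> Rd; have [_ /realizationsP[s ds]] := RX _ _ Rd.
have sVa : (s^-1)%g \o (d \o inr) = a.
  by rewrite ds; apply/funext => i /=; exact: autKV.
exists ((s^-1)%g \o d); last first.
  by apply/esym; exact: (@tp_aut L C _ set0 d (s^-1)%g).
split; last by rewrite /mkset -[X in tp _ X = _]/((s^-1)%g \o (d \o inr)) sVa.
by have := Rinv (s^-1)%g _ _ Rd; rewrite sVa.
Qed.

(** Closedness of [H] means that the point [[a]_E] is closed in the logic topology, that is, that
    the slice of [E] at [a] is type-definable. Invariance spreads this slice to all of [E]. *)
Lemma type_definable_kernel : type_definable K (graph E) <-> closed H.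
Proof.
have -> : closed H <-> logic_closed K X E [set eclass E a] by rewrite logic_closedP.
have fibE : [set b | X b /\ [set eclass E a] (eclass E b)] = [set b | E b a].
  apply/seteqP; split=> b /=; first by move=> [_ /eclassE]; apply; exact: a_p.
  by move=> ba; have [Xb _] := EX ba; split=> //; apply/eclassE.
rewrite /logic_closed fibE; split=> -[A sA tA].
  exists (A `|` range a); first by apply: small_setU => //; exact: small_image.
  exact: (type_definable_section a tA).
exists set0 => //; apply: type_definable_invariant tA => //.
by move=> s b c; apply: (strong_type_aut s b c).2.
Qed.

(** If [H] is clopen, both [E] and its complement [R] among pairs from [X] are type-definable over
    the empty set. Their defining sets are jointly inconsistent, and a finite inconsistent part
    separates the two relations by a formula. *)
Lemma relatively_definable_kernel : relatively_definable X E <-> clopen H.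
Proof.
pose R b c := [/\ X b, X c & ~ E b c].
have tX := type_definable_realizations.
split=> [[_ [phi ->] ED]|[oH cH]].
  have [P fP Pphi] := formula_support phi.
  pose A := [set c | P (inr c)].
  have sA : small K A.
    apply: (small_countable (small_nat Cm)); apply: finite_set_countable.
    by apply: finite_preimage fP => x y _ _ [].
  have sAa : small K (A `|` range a) by apply: small_setU => //; exact: small_image.
  have phiA : formulas_over A phi by apply: formula_in_sub Pphi => -[].
  have EDP b c : E b c <-> [/\ X b, X c & sat (env (tcat b c)) phi].
    split=> [Ebc|[Xb Xc bc]].
      have : graph E (tcat b c) by [].
      by rewrite ED => -[[]].
    suff : graph E (tcat b c) by [].
    by rewrite ED.
  have tdef (psi : formula L (I + I + C)) : formulas_over A psi ->
      TD (A `|` range a) ([set b | X b] `&` [set b | [set d | sat (env d) psi] (tcat b a)]).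
    move=> psiA; apply: type_definableI.
      exact: type_definable_over_sub tX.
    apply: type_definable_section; exists [set psi]; first by move=> _ ->.
    by apply/seteqP; split=> d /=; [move=> dpsi _ ->|apply].
  split; last first.
    have : closed (r @^-1` [set eclass E a]); last by [].
    apply/logic_closedP; exists (A `|` range a) => //.
    rewrite (_ : [set b | _] = ([set b | X b] `&` [set b | [set d | sat (env d) phi] (tcat b a)])).
      exact: tdef.
    apply/seteqP; split=> b /= [Xb].
      by move=> /eclassE => /(_ a_p)/EDP[].
    by move=> bphi; split=> //; apply/eclassE => //; exact/EDP.
  rewrite -(setCK H); apply: closed_openC.
  have : closed (r @^-1` (~` [set eclass E a])); last by [].
  apply/logic_closedP; exists (A `|` range a) => //.
  rewrite (_ : [set b | _] =
      ([set b | X b] `&` [set b | [set d | sat (env d) (Neg phi)] (tcat b a)])).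
    by apply: tdef; split.
  apply/seteqP; split=> b /= [Xb].
    by move=> nE; split=> // bphi; apply/nE/eclassE => //; exact/EDP.
  move=> nphi; split=> // /eclassE => /(_ a_p)/EDP[_ _]; exact: nphi.
have [A sA tE] : exists2 A, small K A & TD A [set b | E b a].
  have [A sA tE] := type_definable_kernel.2 cH.
  exists (A `|` range a); first by apply: small_setU => //; exact: small_image.
  exact: (type_definable_section a tE).
have [B sB tR] : exists2 B, small K B & TD B [set b | R b a].
  have : closed (r @^-1` (~` [set eclass E a])) by exact: (open_closedC oH).
  move=> /logic_closedP[B sB]; rewrite (_ : [set b | _] = [set b | R b a]).
    by exists B.
  apply/seteqP; split=> b /=; first by move=> [Xb nE]; split=> // ba; apply/nE/eclassE.
  by move=> [Xb _ nE]; split=> // /eclassE => /(_ a_p).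
have [||Phi Phi0 EPhi] := type_definable_invariant _ _ sA tE.
- exact: EX.
- by move=> s b c; apply: (strong_type_aut s b c).2.
have [||Psi Psi0 RPsi] := type_definable_invariant _ _ sB tR.
- by move=> b c [].
- move=> s b c [Xb Xc nE]; split; [exact: realizations_aut|exact: realizations_aut|].
  by move=> /strong_type_aut.
have sII : small K [set: I + I] by exact: small_sum.
have [s [fs sPP nreal]] : exists s, [/\ finite_set s, s `<=` Phi `|` Psi &
    ~ (realizations s !=set0)].
  apply: contrapT => Hs.
  have [||d dq] := saturation Cm sII s0 (q := Phi `|` Psi).
  - by move=> phi [/Phi0|/Psi0].
  - by move=> s fs sPP; apply: contrapT => nr; apply: Hs; exists s.
  have Ed : graph E d by rewrite EPhi => phi ?; apply: dq; left.
  have [_ _] : graph R d by rewrite RPsi => phi ?; apply: dq; right.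
  by apply.
have [l ls] := (finite_seqP s).1 fs.
(* These formulas hold on [E]; a pair in [R] satisfying them would realize the whole inconsistent
   part. *)
pose l1 := [seq phi <- l | `[< Phi phi >]].
exists [set d | sat (env d) (Conj l1)]; first by exists (Conj l1).
apply/seteqP; split=> d Ed.
  split; first by have [] := EX Ed.
  apply/sat_Conj => phi; rewrite mem_filter => /andP[/asboolP Pphi _].
  by move: Ed; rewrite EPhi; apply.
have [[Xb Xc] /sat_Conj dl1] := Ed; apply: contrapT => nE.
have : graph R d by split.
rewrite RPsi => dPsi; apply: nreal; exists d => phi sphi.
have [Pphi|Pphi] := sPP phi sphi; last exact: dPsi.
apply: dl1; rewrite mem_filter; apply/andP; split; first exact/asboolP.
by move: sphi; rewrite ls.
Qed.

Lemma pair_typesP (d : I + I -> C) : pair_types E (tpc set0 d) <-> graph E d.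
Proof.
have sII : small K [set: I + I] by exact: small_sum.
split=> [[d' Ed' /= /(homogeneity Cm sII s0)[s _ d's]]|Ed]; last by exists d.
by move: Ed'; rewrite d's => /strong_type_aut.
Qed.

(** * Complexity and Borel cardinality over a countable model *)

Section CountableModel.
Context {N : set C} (N_countable : countable N) (N_model : elementary_submodel N).
Let sN : small K N := small_countable (small_nat Cm) N_countable.
Let cN' : countable [set: N].
Proof. by rewrite /countable (card_le_eql (card_setT N)). Qed.
Let KN : KPbase N := KP_base_model Cm N_model.

Section Kernel.
Hypothesis aN : range a `<=` N.
Let m : N -> C := set_val.
Let sN' : small K [set: N] := small_countable (small_nat Cm) cN'.
Let Km : KPbase (range m).
Proof. by apply: KP_base_sub KN => x Nx; exists (SigSub (mem_set Nx)). Qed.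
Let pi : conj_types m N -> G := @conj_map K L T C Cm M N m N sN' sN.

(** The positions of the entries of [a] in [m], so that [s a] is read off [s m]. *)
Let ja (i : I) : N := SigSub (mem_set (aN (imageT a i))).

Let rho (q : conj_types m N) : ctype (I + I) (@set0 C) :=
  tpc set0 (tcat (projT1 (cid (conj_typesP Cm q sN' sN)) \o a) a).

(** Realizations of [q] are conjugate over [N], and [N] contains [a], so all of them give the pair
    the same type. *)
Let rhoE q b : set_val q = tpc N b -> rho q = tpc set0 (tcat (b \o ja) a).
Proof.
rewrite /rho; case: cid => s /= -> /(congr1 (@ctype_set _ _ _ _)) /=.
move=> /(homogeneity Cm sN' sN)[t tN ->]; apply: tpc_eq.
rewrite -[RHS](tp_aut (A := set0) _ (s := (t^-1)%g)); last by [].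
congr tp; apply/funext => -[i|i] /=; first by rewrite autKV.
by apply/esym; apply: (aut_fixingV tN); apply: aN; exists i.
Qed.

Let rho_continuous : continuous rho.
Proof.
have sII : small K [set: I + I] by exact: small_sum.
apply/continuous_closedP => F /(closed_type_definable Cm _ sII s0) tF.
apply/(closed_conj_types Cm _ sN' sN).
rewrite (_ : [set b | _] = [set b | tp set0 b = tp set0 m] `&`
  [set b : N -> C | [set c | [set d | F (tpc set0 d)] (tcat c a)] (b \o ja)]).
  apply: type_definableI; first exact: type_definable_over_sub (type_definable_tp _ _).
  apply: type_definable_preimage; apply: type_definable_over_sub (type_definable_section a tF).
  by move=> x [//|]; exact: aN.
apply/seteqP; split=> [b [q /= Fq qb]|_ [/esym/(homogeneity Cm sN' s0)[s _ ->] /= Fs]].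
  split; last by rewrite /= -(rhoE qb).
  have [s] := conj_typesP Cm q sN' sN.
  rewrite qb => /(congr1 (@ctype_set _ _ _ _)) /= /esym/(homogeneity Cm sN' sN)[t _ ->].
  by have := tp_aut (A := set0) m (s := (t * s)%g); apply.
exists (SigSub (mem_set (@tpc_conj _ _ _ m N s))) => //=.
by rewrite (rhoE (b := s \o m)).
Qed.

Let pi_rho : pi @^-1` H = rho @^-1` pair_types E.
Proof.
apply/seteqP; split=> q; have [s qs] := conj_typesP Cm q sN' sN;
  rewrite /= /pi (conj_mapE Cm sN' Km sN KN qs) (rhoE qs) pair_typesP orbit_kernelP.
  exact: Es.
exact: Es.
Qed.

Let pair_types_range : pair_types E `<=` range rho.
Proof.
have sII : small K [set: I + I] by exact: small_sum.
move=> q [d Ed /eq_tpc ->].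
have [/realizationsP[s ds] /realizationsP[t dt]] := EX Ed.
(* Applying [t^-1] brings the pair [(s a, t a)] to one with second half [a] without changing its
   type over the empty set. *)
exists (SigSub (mem_set (@tpc_conj _ _ _ m N (t^-1 * s)%g))) => //.
rewrite (rhoE (b := (t^-1 * s)%g \o m))//; apply: tpc_eq.
rewrite -[RHS](tp_aut (A := set0) _ (s := (t^-1)%g)); last by [].
congr tp; rewrite [in RHS](tcatE d) ds dt comp_tcat; congr tcat.
by apply/funext => i /=; rewrite autKV.
Qed.

Lemma complexity_kernel : [/\ borel (pair_types E) <-> borel H,
  analytic (pair_types E) <-> analytic H & Fsigma (pair_types E) <-> Fsigma H].
Proof.
have [U Ub] := types_extending_base (tp set0 m) (countable_formulas_over L_countable cN' N_countable).
have Zc := @types_extending_compact L C N N (tp set0 m).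
have ZH := @types_extending_hausdorff L C N N (tp set0 m).
have YH := @ctype_hausdorff L C (I + I) set0.
have GH := galKP_hausdorff Cm M_model sN' Km sN KN.
have pc : continuous pi by exact: conj_map_continuous.
have HT : H `<=` range pi by rewrite (conj_map_surj Cm sN' Km sN KN).
split; split.
- exact: (borel_transfer Zc Ub GH rho_continuous pc (esym pi_rho) HT).
- exact: (borel_transfer Zc Ub YH pc rho_continuous pi_rho pair_types_range).
- exact: (analytic_transfer Zc ZH Ub YH rho_continuous pc (esym pi_rho) HT).
- exact: (analytic_transfer Zc ZH Ub GH pc rho_continuous pi_rho pair_types_range).
- exact: (Fsigma_transfer Zc GH rho_continuous pc (esym pi_rho) HT).
- exact: (Fsigma_transfer Zc YH pc rho_continuous pi_rho pair_types_range).
Qed.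

End Kernel.

Section BorelCardinality.
Let m : N + I -> C := tcat set_val a.
Let cNI : countable [set: N + I].
Proof.
apply: sub_countable (countable_sum cN' I_countable); apply: subset_card_le.
by move=> [].
Qed.
Let sNI : small K [set: N + I] := small_countable (small_nat Cm) cNI.
Let Km : KPbase (range m).
Proof. by apply: KP_base_sub KN => x Nx; exists (inl (SigSub (mem_set Nx))). Qed.
Let pi : conj_types m N -> G := @conj_map K L T C Cm M (N + I) m N sNI sN.
Let Z := types_extending N (ctype_set p).

Let tpcZ (s : aut C) : Z (tpc N (s \o a)).
Proof.
move=> phi phip; split; last exact: (Xsa s phip).
exact: formulas_over_sub (ctype_over phip).
Qed.

Let tau (q : conj_types m N) : Z :=
  SigSub (mem_set (tpcZ (projT1 (cid (conj_typesP Cm q sNI sN))))).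

Let tauE q b : set_val q = tpc N b -> set_val (tau q) = tpc N (b \o inr).
Proof.
rewrite /tau; case: cid => s /= -> /(congr1 (@ctype_set _ _ _ _)) /=.
move=> /(homogeneity Cm sNI sN)[t tN ->]; apply: tpc_eq.
by apply/esym; apply: tp_aut.
Qed.

Let tau_continuous : continuous tau.
Proof.
apply/continuous_closedP => F.
move=> /types_extending_closedP /(closed_type_definable Cm _ sI sN) tF.
apply/(closed_conj_types Cm _ sNI sN).
rewrite (_ : [set b | _] = [set b | tp set0 b = tp set0 m] `&`
  [set b : N + I -> C | [set c | (set_val @` F) (tpc N c)] (b \o inr)]).
  apply: type_definableI; first exact: type_definable_over_sub (type_definable_tp _ _).
  exact: type_definable_preimage.
apply/seteqP; split=> [b [q /= Fq qb]|_ [/esym/(homogeneity Cm sNI s0)[s _ ->] /= [z Fz zs]]].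
  split; last by exists (tau q) => //; exact: tauE.
  have [s] := conj_typesP Cm q sNI sN.
  rewrite qb => /(congr1 (@ctype_set _ _ _ _)) /= /esym/(homogeneity Cm sNI sN)[t _ ->].
  by have := tp_aut (A := set0) m (s := (t * s)%g); apply.
exists (SigSub (mem_set (@tpc_conj _ _ _ m N s))) => //=.
rewrite (_ : tau _ = z)//; apply: val_inj; rewrite /= -!set_valE zs.
exact: tauE.
Qed.

Let tau_surj : range tau = setT.
Proof.
apply/seteqP; split=> // z _.
have [b zb] := ctype_realized Cm (set_val z) sI sN.
have Xb : X b.
  move=> phi phip; have : ctype_set (set_val z) phi by have /set_mem := valP z; apply.
  by rewrite zb => -[].
have [s bs] := (realizationsP b).1 Xb.
exists (SigSub (mem_set (@tpc_conj _ _ _ m N s))) => //.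
by apply: val_inj; rewrite -!set_valE zb bs; exact: (tauE (b := s \o m)).
Qed.

(** A realization of the type of [u a] over [N] is the image of [u a] under an automorphism fixing
    [N]. This lies in Autf_KP and stays within the [E]-class, so any realizations may be used to
    test [E]. *)
Let tau_pi x y : same_lcoset H (pi x) (pi y) <-> type_relation E (tau x) (tau y).
Proof.
have [s xs] := conj_typesP Cm x sNI sN; have [t yt] := conj_typesP Cm y sNI sN.
rewrite /pi (conj_mapE Cm sNI Km sN KN xs) (conj_mapE Cm sNI Km sN KN yt).
have real (q : conj_types m N) (u : aut C) b : set_val q = tpc N (u \o m) ->
    realizations (ctype_set (set_val (tau q))) b -> E (u \o a) b.
  move=> qu /realizations_ctype; rewrite (tauE qu) => /(congr1 (@ctype_set _ _ _ _)) /=.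
  move=> /(homogeneity Cm sI sN)[v vN ->].
  exact: strong_type_KP (KN vN) (Xsa u).
have real_self (q : conj_types m N) (u : aut C) : set_val q = tpc N (u \o m) ->
    realizations (ctype_set (set_val (tau q))) (u \o a).
  by move=> qu; apply/realizations_ctype; rewrite (tauE qu).
have -> : same_lcoset H (pr s) (pr t) <-> E (s \o a) (t \o a).
  rewrite -orbit_map_eq; split=> [[_ [[g _ <-] /orbit_map_lcoset <- /orbit_map_lcoset <-]]//|st].
  by exists (lcoset H (pr s)); split; [exists (pr s)|exact/orbit_map_lcoset|exact/orbit_map_lcoset].
split=> [st|[b [c [xb yc bc]]]].
  by exists (s \o a), (t \o a); split; [exact: real_self|exact: real_self|].
exact: Et (real _ _ _ xs xb) (Et bc (Es (real _ _ _ yt yc))).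
Qed.

Lemma borel_cardinality : borel_equivalent (same_lcoset H) (@type_relation L C I p N E).
Proof.
have [U Ub] := types_extending_base (tp set0 m) (countable_formulas_over L_countable cNI N_countable).
have Zc := @types_extending_compact L C (N + I) N (tp set0 m).
have GH := galKP_hausdorff Cm M_model sNI Km sN KN.
have pc : continuous pi by exact: conj_map_continuous.
have Z0 : [set: conj_types m N] !=set0 by exists (SigSub (mem_set (@tpc_conj _ _ _ m N 1%g))).
split.
  exact: (borel_reducible_transfer Zc Ub Z0 GH pc tau_continuous (conj_map_surj Cm sNI Km sN KN) tau_pi).
apply: (borel_reducible_transfer Zc Ub Z0 _ tau_continuous pc tau_surj).
  exact: types_extending_hausdorff.
by move=> x y; rewrite -tau_pi.
Qed.

End BorelCardinality.
End CountableModel.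
End StrongType.

Theorem theorem3p2 (K : Type) (L : language) (T : theory L) (C : structure L)
    (L_countable : countable_language L) (T_complete : complete_theory T)
    (C_monster : monster_model K T C)
    (I : Type) (I_countable : countable [set: I])
    (p : ctype I (@set0 C)) (E : (I -> C) -> (I -> C) -> Prop)
    (E_strong : strong_type K (realizations (ctype_set p)) E)
    (E_refined : forall b c, realizations (ctype_set p) b ->
      realizations (ctype_set p) c -> equiv_KP K b c -> E b c)
    (a : I -> C) (a_p : realizations (ctype_set p) a)
    (M : set C) (M_model : small_model K M) :
  let X := realizations (ctype_set p) in
  let r : galKP K M -> set (I -> C) := orbit_map E a in
  let H := r @^-1` [set eclass E a] in
  [/\ forall s : aut C, r (to_galKP K M s) = eclass E (s \o a),
      group_closed [in H] /\
      [set r @^-1` [set x] | x in classes X E] = lcosets H,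
      topological_quotient_map
        [set: galKP K M] closed (classes X E) (logic_closed K X E) r /\
      (exists2 h : set (galKP K M) -> set (I -> C),
        forall g, h (lcoset H g) = r g &
        homeomorphism (lcosets H) (lcosets_closed H)
          (classes X E) (logic_closed K X E) h),
      [/\ type_definable K (graph E) <-> closed H,
          borel (pair_types E) <-> borel H,
          analytic (pair_types E) <-> analytic H,
          Fsigma (pair_types E) <-> Fsigma H &
          relatively_definable X E <-> clopen H] &
      forall N : set C, countable N -> elementary_submodel N ->
        borel_equivalent (same_lcoset H) (@type_relation L C I p N E) ].
Proof.
move=> X r H.
(* The clauses on Borel, analytic and F_sigma sets mention no countable model, so one containing [a]
   may be chosen; the last clause is proved for each given model. *)
have [N [cN Nm aN]] : exists N : set C, [/\ countable N, elementary_submodel N & range a `<=` N].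
  apply: loewenheim_skolem => //.
  by apply: (sub_countable (B := [set: I])) I_countable; exact: card_image_le.
have [borelP analyticP FsigmaP] :=
  complexity_kernel L_countable C_monster I_countable E_strong E_refined a_p M_model cN Nm aN.
split.
- by move=> s; exact: (orbit_mapE C_monster I_countable E_strong E_refined a_p).
- split; first exact: (orbit_kernel_group C_monster I_countable E_strong E_refined a_p).
  exact: (orbit_fibers C_monster I_countable E_strong E_refined a_p).
- split.
    exact: (orbit_quotient_map C_monster I_countable E_strong E_refined a_p M_model).
  exact: (orbit_homeomorphism C_monster I_countable E_strong E_refined a_p M_model).
- split=> //.
    exact: (type_definable_kernel C_monster I_countable E_strong E_refined a_p M_model).
  exact: (relatively_definable_kernel C_monster I_countable E_strong E_refined a_p M_model).
- move=> N' cN' N'm; exact: (borel_cardinality L_countable C_monster I_countable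
    E_strong E_refined a_p M_model cN' N'm).
Qed.
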